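(* Let $G$ be any one of the six (pairwise non-isomorphic) non-trivial snarks on $20$ vertices (these include the flower snark $J_5$). Then a $G$ design of order $n$ exists if and only if $n \equiv 1, 16, 25$ or $40 \pmod{60}$ and $n \neq 16$.
   Context: All graphs are simple. A snark is a connected, bridgeless 3-regular graph with chromatic index 4. A snark is non-trivial if it has girth at least 5 and there are no three edges whose deletion yields a disconnected graph each of whose components is non-trivial (has at least one edge). Up to isomorphism there are exactly six non-trivial snarks on 20 vertices. For a graph $G$, a $G$ design of order $n$ is a partition of the edge set of the complete graph $K_n$ into edge sets of subgraphs each isomorphic to $G$. By convention the empty set is a $G$ design of order $1$. *)

(* Defs.v *)
From mathcomp Require Import all_boot.

Set Implicit Arguments.
Unset Strict Implicit.
Unset Printing Implicit Defensive.

Record sgraph := SGraph {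
  vertex :> finType;
  adj : rel vertex;
  adj_sym : symmetric adj;
  adj_irrefl : irreflexive adj
}.

Definition edges (G : sgraph) : {set {set G}} :=
  [set [set p.1; p.2] | p : G * G & adj p.1 p.2].

Section Delete.
Variables (G : sgraph) (S : {set {set G}}).

Definition delete_adj : rel G :=
  fun x y => adj x y && ([set x; y] \notin S).

Lemma delete_adj_sym : symmetric delete_adj.
Proof. by move=> x y; rewrite /delete_adj adj_sym setUC. Qed.

Lemma delete_adj_irrefl : irreflexive delete_adj.
Proof. by move=> x; rewrite /delete_adj adj_irrefl. Qed.

Definition delete_edges : sgraph := SGraph delete_adj_sym delete_adj_irrefl.

End Delete.

Definition components (G : sgraph) : {set {set G}} :=
  equivalence_partition (connect (@adj G)) [set: G].

Definition connected (G : sgraph) : Prop :=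
  forall x y : G, connect (@adj G) x y.

Definition is_bridge (G : sgraph) (e : {set G}) : Prop :=
  e \in edges G /\ #|components G| < #|components (delete_edges [set e])|.

Definition bridgeless (G : sgraph) : Prop := forall e : {set G}, ~ is_bridge e.

Definition regular (k : nat) (G : sgraph) : Prop :=
  forall x : G, #|[set y | adj x y]| = k.

Definition edge_colourable (G : sgraph) (k : nat) : Prop :=
  exists c : {set G} -> nat,
    (forall e, e \in edges G -> c e < k) /\
    (forall e f, e \in edges G -> f \in edges G ->
       e != f -> e :&: f != set0 -> c e != c f).

Definition has_chromatic_index (G : sgraph) (k : nat) : Prop :=
  edge_colourable G k /\ forall j, edge_colourable G j -> k <= j.

Definition girth_at_least (g : nat) (G : sgraph) : Prop :=
  forall c : seq G, 2 < size c -> ucycle (@adj G) c -> g <= size c.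

Definition snark (G : sgraph) : Prop :=
  [/\ connected G, bridgeless G, regular 3 G & has_chromatic_index G 4].

Definition nontrivial_component (G : sgraph) (C : {set G}) : Prop :=
  exists2 e, e \in edges G & e \subset C.

Definition nontrivial_snark (G : sgraph) : Prop :=
  [/\ snark G, girth_at_least 5 G &
    ~ exists S : {set {set G}},
        [/\ S \subset edges G, #|S| = 3, ~ connected (delete_edges S) &
          forall C, C \in components (delete_edges S) ->
            nontrivial_component (G := delete_edges S) C]].

Section Complete.
Variable n : nat.

Definition complete_adj : rel 'I_n := fun x y => x != y.

Lemma complete_adj_sym : symmetric complete_adj.
Proof. by move=> x y; rewrite /complete_adj eq_sym. Qed.

Lemma complete_adj_irrefl : irreflexive complete_adj.
Proof. by move=> x; rewrite /complete_adj eqxx. Qed.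

Definition complete_graph : sgraph :=
  SGraph complete_adj_sym complete_adj_irrefl.

End Complete.

Definition is_subgraph (H : sgraph) (W : {set H}) (F : {set {set H}}) : Prop :=
  F \subset edges H /\ forall e, e \in F -> e \subset W.

Definition isomorphic_to (G H : sgraph) (W : {set H}) (F : {set {set H}}) :
    Prop :=
  exists f : G -> H,
    [/\ injective f, f @: [set: G] = W &
      forall x y : G, adj x y = ([set f x; f y] \in F)].

Definition is_design (G : sgraph) (n : nat)
    (D : {set {set {set complete_graph n}}}) : Prop :=
  partition D (edges (complete_graph n)) /\
  forall F, F \in D ->
    exists W : {set complete_graph n}, is_subgraph W F /\ isomorphic_to G W F.

(* Main.v *)
(* Necessity is counting: every point meets each block in 0 or 3 edges, and a
   block has 60 incidences, so 3 divides n - 1 and 60 divides n (n - 1); a block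
   needs 20 points, which excludes n = 16.

   For sufficiency, the six snarks are first made explicit. A cubic graph on 20
   vertices of girth at least 5 is grown vertex by vertex from a small subgraph
   that it must contain: two pentagons sharing a path of length two, else two
   pentagons sharing an edge, else a pentagon with its five pendant edges, else a
   hexagon, else a vertex with its neighbours. Each leaf of this search is
   3-edge-coloured, or matched with one of six snarks or with one of eight graphs
   having an explicit 3-edge cut.

   For each of the six, K_n is split along a Bose or Skolem triple system whose
   points are blown up: three points of one line become fibres of sizes 1, w1 and
   w2, all others become fibres of size 30, and in the Bose system an extra fibre
   of size 60 may be joined to all columns. The pieces K_{30,30,30},
   K_{30,30,w}, K_{30,30,30,60} and K_m, for finitely many m, come from base
   blocks developed under a cyclic group. It is enough that every pair is covered:
   since the number of blocks is n (n - 1) / 60, no pair can be covered twice. *)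

From HB Require Import structures.
From Stdlib Require Import BinNat.
From mathcomp Require Import all_boot zify.
Require Import Defs.

Set Implicit Arguments.
Unset Strict Implicit.
Unset Printing Implicit Defensive.

(** * Exhaustive generation *)

(** The search needs no isomorph rejection: a given [G] dictates one branch, and it is enough that
    this branch is never pruned. The order of the root subgraphs matters. Excluding the earlier ones
    makes the copy of the next one induced and forbids many pairs of open vertices from having a
    common new neighbour, which keeps the searches small. In the blow-up, a multipartite ingredient
    leaves the pairs inside a fibre uncovered. The fibre of size 1 repairs this: every other point
    of the triple system is on exactly one line with that point, and such a line receives a complete
    graph, K_61 or the initial one, instead of a multipartite graph. The sizes [w1] and [w2] fix the
    residue of [n]: their sum is 60, 75, 84 or 99, and both are multiples of 3, so that the degrees
    in K_{30,30,w} are divisible by 3. A Bose system on [6 q + 3] points adds only multiples of 180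
    vertices to the initial order, hence the three variants needed to advance in steps of 60. *)

Inductive lab :=
  L0|L1|L2|L3|L4|L5|L6|L7|L8|L9|L10|L11|L12|L13|L14|L15|L16|L17|L18|L19.

Definition lab_eqb (a b : lab) : bool :=
  match a, b with
  | L0,L0|L1,L1|L2,L2|L3,L3|L4,L4|L5,L5|L6,L6|L7,L7|L8,L8|L9,L9
  | L10,L10|L11,L11|L12,L12|L13,L13|L14,L14|L15,L15|L16,L16|L17,L17
  | L18,L18|L19,L19 => true
  | _, _ => false
  end.

Lemma lab_eqP : Equality.axiom lab_eqb.
Proof. by move=> a b; apply: (iffP idP) => [|->]; [case: a; case: b | case: b]. Qed.

HB.instance Definition _ := hasDecEq.Build lab lab_eqP.

Definition labels : seq lab :=
  [:: L0;L1;L2;L3;L4;L5;L6;L7;L8;L9;L10;L11;L12;L13;L14;L15;L16;L17;L18;L19].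

(** The innermost tests use [if]: under the strict evaluation of [vm_compute] the boolean
    connectives would compute both arguments. *)
Fixpoint lmem (a : lab) (s : seq lab) : bool :=
  if s is b :: s' then if lab_eqb a b then true else lmem a s' else false.

Fixpoint ldisj (s t : seq lab) : bool :=
  if s is a :: s' then if lmem a t then false else ldisj s' t else true.

(* A graph under construction lists its vertices, the last placed one first, each
   with its neighbours placed earlier. The vertices of degree less than 3 so far are
   also listed separately, there with all their neighbours. *)
Definition vrec := (lab * seq lab)%type.

Section Search.
Variable ok : seq vrec -> vrec -> vrec -> bool.
Variable leaf : seq vrec -> bool.

(** A new vertex is already joined to the vertex being completed, so at most two further neighbours
    are to be chosen. *)
Fixpoint small_subsets (cs : seq vrec) (C : seq vrec) : seq (seq lab) :=
  if C is a :: C' then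
    [:: a.1] :: [seq [:: a.1; b.1] | b <- [seq b <- C' | ok cs a b]]
      ++ small_subsets cs C'
  else [::].

Definition choices cs (u : vrec) (D : seq vrec) : seq (seq lab) :=
  [::] :: small_subsets cs [seq a <- D | ok cs u a].

(** A vertex that reaches degree 3 leaves the list. The record [E] of the new vertex goes to the
    end, so that the list is a queue and the graph grows breadth first. *)
Fixpoint attach (w : lab) (T : seq lab) (D E : seq vrec) : seq vrec :=
  if D is a :: D' then
    if lmem a.1 T then
      if a.2 is [:: _, _ & _] then attach w T D' E
      else (a.1, w :: a.2) :: attach w T D' E
    else a :: attach w T D' E
  else E.

Definition new_vrec (w : lab) (S : seq lab) : seq vrec :=
  if S is [:: _, _, _ & _] then [::] else [:: (w, S)].

Fixpoint deficit (D : seq vrec) : nat :=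
  if D is a :: D' then
    match a.2 with
    | [::] => (deficit D').+3 | [:: _] => (deficit D').+2 | _ => (deficit D').+1
    end
  else 0.

Fixpoint triple (T : seq lab) : nat := if T is _ :: T' then (triple T').+3 else 0.

(** [d] counts the edges still to be drawn from placed to unplaced vertices. Each of the [k]
    unplaced vertices has at most [k - 1] unplaced neighbours, so it receives between [4 - k] and 3
    of these edges; the lower bound is tested for [k <= 2] only. *)
Definition feasible (D : seq vrec) (todo : seq lab) : bool :=
  let d := deficit D in
  match todo with
  | [::] => if d is 0 then true else false
  | [:: _] => if d is 3 then true else false
  | [:: _; _] => match d with 4 | 5 | 6 => true | _ => false end
  | _ => Nat.leb d (triple todo)
  end.

(** The two new neighbours of an open vertex are interchangeable, so each pair of neighbour sets is
    tried in one order only. *)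
Fixpoint all_pairs (A : Type) (P : A -> A -> bool) (s : seq A) : bool :=
  if s is x :: s' then all (P x) s && all_pairs P s' else true.

(** The first open vertex is completed at once, by one or two new vertices, and a new vertex is
    joined immediately to all its placed neighbours; thus the placed part stays an induced subgraph.
    An open vertex without neighbours does not occur, because the roots are connected, and is
    answered by [false], which can only make the search fail. *)
Fixpoint search (todo : seq lab) (D cs : seq vrec) {struct todo} : bool :=
  match todo with
  | [::] => if D is [::] then leaf cs else true
  | w :: todo1 =>
    if D is u :: D1 then
      let a := u.1 in
      match u.2 with
      | [:: _; _] =>
        all (fun T =>
          let D2 := attach w T D1 (new_vrec w (a :: T)) in
          if feasible D2 todo1 then search todo1 D2 ((w, a :: T) :: cs)
          else true) (choices cs u D1)
      | [:: _] =>
        if todo1 is w' :: todo2 then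
          all_pairs (fun T T' =>
            if ldisj T T' then
              let D2 := attach w T D1 (new_vrec w (a :: T)) in
              let D3 := attach w' T' D2 (new_vrec w' (a :: T')) in
              if feasible D3 todo2 then
                search todo2 D3 [:: (w', a :: T'), (w, a :: T) & cs]
              else true
            else true) (choices cs u D1)
        else true
      | _ => false
      end
    else true
  end.
End Search.

(** * Backtracking for 3-edge-colourings *)

Inductive colour := cA | cB | cC.
Inductive mask := m0 | mA | mB | mC | mAB | mAC | mBC | mABC.

Definition add_colour (c : colour) (m : mask) (k : mask -> bool) : bool :=
  match c, m with
  | cA, m0 => k mA | cA, mB => k mAB | cA, mC => k mAC | cA, mBC => k mABC
  | cB, m0 => k mB | cB, mA => k mAB | cB, mC => k mBC | cB, mAC => k mABC
  | cC, m0 => k mC | cC, mA => k mAC | cC, mB => k mBC | cC, mAB => k mABC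
  | _, _ => false
  end.

Definition cstate := seq (lab * mask).

(** Continuation passing: [k] is the rest of the colouring, so a dead end there returns to the
    latest choice of colours. *)
Fixpoint paint (a : lab) (c : colour) (l : cstate) (k : cstate -> bool)
    {struct l} : bool :=
  if l is x :: l' then
    if lab_eqb a x.1 then add_colour c x.2 (fun m => k ((x.1, m) :: l'))
    else paint a c l' (fun l2 => k (x :: l2))
  else false.

(** Vertices are treated in the reverse of the order in which they were placed. When a vertex is
    reached, its edges to later ones are coloured, so its back edges must receive exactly the
    colours missing from its mask. *)
Fixpoint colourable (cs : seq vrec) (l : cstate) {struct cs} : bool :=
  match cs, l with
  | x :: cs', y :: l' =>
    match x.2 with
    | [::] => colourable cs' l'
    | [:: a] =>
      let try := fun c => paint a c l' (colourable cs') in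
      match y.2 with mAB => try cC | mAC => try cB | mBC => try cA
      | _ => false end
    | [:: a; b] =>
      let try := fun c d =>
        if paint a c l' (fun l2 => paint b d l2 (colourable cs')) then true
        else paint a d l' (fun l2 => paint b c l2 (colourable cs')) in
      match y.2 with mA => try cB cC | mB => try cA cC | mC => try cA cB
      | _ => false end
    | [:: a; b; e] =>
      let try := fun c d f =>
        paint a c l' (fun l2 => paint b d l2 (fun l3 =>
          paint e f l3 (colourable cs'))) in
      if y.2 is m0 then
        if try cA cB cC then true else if try cB cC cA then true else
        if try cC cA cB then true else if try cA cC cB then true else
        if try cB cA cC then true else try cC cB cA
      else false
    | _ => false
    end
  | _, _ => true
  end.

Definition unpainted (cs : seq vrec) : cstate := [seq (x.1, m0) | x <- cs].

Fixpoint look (A : Type) (d : A) (m : seq (lab * A)) (a : lab) : A :=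
  if m is x :: m' then if lab_eqb a x.1 then x.2 else look d m' a else d.

Definition nbrs (g : seq vrec) (a : lab) : seq lab := look [::] g a.

Definition complete (cs : seq vrec) : seq vrec :=
  [seq (x.1, x.2 ++ [seq y.1 | y <- cs & lmem x.1 y.2]) | x <- cs].

(** The empty list stands for failure. *)
Fixpoint first (A : Type) (f : A -> seq (lab * lab)) (s : seq A) : seq (lab * lab) :=
  if s is x :: s' then if f x is y :: r then y :: r else first f s' else [::].

(** The number of 5-cycles through [v] when there are no shorter cycles: choose two neighbours of
    [v] and an edge between their other neighbours. This isomorphism invariant narrows the
    candidates in [embed]. *)
Definition pentagons (g : seq vrec) (v : lab) : nat :=
  let out := fun p => [seq x <- nbrs g p | ~~ lab_eqb x v] in
  let joins := fun s t => count (fun x => ~~ ldisj (nbrs g x) t) s in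
  if nbrs g v is [:: p; q; r] then
    let P := out p in let Q := out q in let R := out r in
    joins P Q + joins P R + joins Q R
  else 0.

Definition profile (g : seq vrec) : seq (lab * nat) :=
  [seq (x.1, pentagons g x.1) | x <- g].

Section Embed.
Variables (g : seq vrec) (gp tp : seq (lab * nat)).

(** A heuristic whose answer is checked afresh by [is_embedding], so nothing has to be proved about
    it. Every vertex of a target but the first has an earlier neighbour, which leaves at most three
    candidates. *)
Fixpoint embed (t : seq vrec) (m : seq (lab * lab)) {struct t} :
    seq (lab * lab) :=
  if t is x :: t' then
    first (fun a =>
      if Nat.eqb (look 0 gp a) (look 0 tp x.1) then
        if lmem a [seq p.2 | p <- m] then [::] else
        if all (fun b => lmem (look L0 m b) (nbrs g a)) x.2
        then embed t' ((x.1, a) :: m) else [::]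
      else [::])
      (if x.2 is b :: _ then nbrs g (look L0 m b) else labels)
  else m.
End Embed.

Definition is_embedding (g t : seq vrec) (m : seq (lab * lab)) : bool :=
  if uniq [seq look L0 m a | a <- labels] then
    all (fun x => all (fun b => lmem (look L0 m b) (nbrs g (look L0 m x.1))) x.2) t
  else false.

Fixpoint hasb (A : Type) (p : A -> bool) (s : seq A) : bool :=
  if s is x :: s' then if p x then true else hasb p s' else false.

Definition isomorphic_to_one_of (ts : seq (seq vrec * seq (lab * nat))) (cs : seq vrec) : bool :=
  let g := complete cs in
  let gp := profile g in
  hasb (fun t => let m := embed g gp t.2 t.1 [::] in
    if m is [::] then false else is_embedding g t.1 m) ts.

Definition tadj (t : seq vrec) (a b : lab) : bool :=
  lmem b (nbrs t a) || lmem a (nbrs t b).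

Definition is_cubic (t : seq vrec) : bool :=
  all (fun a => count (tadj t a) labels == 3) labels.

(** Both sides need two vertices, since the three edges at a single vertex always form a cut. *)
Definition is_cut (t : seq vrec) (U : seq lab) : bool :=
  [&& uniq U, 1 < size U, size U < 19 &
    count (fun p => [&& lmem p.1 U, ~~ lmem p.2 U & tadj t p.1 p.2])
      [seq (a, b) | a <- labels, b <- labels] == 3].

Definition leaf ts cs : bool :=
  if colourable cs (unpainted cs) then true else isomorphic_to_one_of ts cs.

(** Whether a new vertex can be joined to both without closing a triangle or a 4-cycle. *)
Definition ok_pair (a b : vrec) : bool :=
  if lmem b.1 a.2 then false else ldisj a.2 b.2.

Definition pair_in (F : seq (lab * lab)) (a b : lab) : bool :=
  has (fun p => (lab_eqb a p.1 && lab_eqb b p.2) || (lab_eqb a p.2 && lab_eqb b p.1)) F.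

Definition ok_girth5 (cs : seq vrec) (a b : vrec) : bool := ok_pair a b.

Definition ok_forbidding F (cs : seq vrec) (a b : vrec) : bool :=
  if ok_pair a b then ~~ pair_in F a.1 b.1 else false.

Definition linked (cs : seq vrec) (x y : lab) : bool :=
  if lmem y (look [::] cs x) then true else lmem x (look [::] cs y).

(** An edge between neighbours of [a] and [b] would close a pentagon through the new vertex; in
    [ok_girth7], a common neighbour of such neighbours would close a hexagon. *)
Definition ok_girth6 (cs : seq vrec) (a b : vrec) : bool :=
  if ok_pair a b then all (fun x => all (fun y => ~~ linked cs x y) b.2) a.2 else false.

Definition ok_girth7 (cs : seq vrec) (a b : vrec) : bool :=
  if ok_girth6 cs a b then
  let g := complete cs in all (fun x => all (fun y => ldisj (nbrs g x) (nbrs g y)) b.2) a.2 else false.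

(* the paths 0-1-2, 0-3-4-2 and 0-5-6-2 *)
Definition theta_root : seq vrec :=
  [:: (L6,[::L2;L5]); (L5,[::L0]); (L4,[::L2;L3]); (L3,[::L0]);
    (L2,[::L1]);(L1,[::L0]);(L0,[::])].

Definition theta_open : seq vrec :=
  [:: (L1,[::L0;L2]); (L3,[::L0;L4]); (L4,[::L3;L2]); (L5,[::L0;L6]); (L6,[::L5;L2])].

(* the paths 0-1, 0-2-3-4-1 and 0-5-6-7-1 *)
Definition edge_root : seq vrec :=
  [:: (L7,[::L1;L6]); (L6,[::L5]); (L5,[::L0]); (L4,[::L1;L3]); (L3,[::L2]);
    (L2,[::L0]);(L1,[::L0]);(L0,[::])].

Definition edge_open : seq vrec :=
  [:: (L2,[::L0;L3]); (L3,[::L2;L4]); (L4,[::L1;L3]); (L5,[::L0;L6]); (L6,[::L5;L7]);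
    (L7,[::L1;L6])].

(* a new vertex joined to such a pair would create [theta_root] *)
Definition edge_forbidden := [:: (L4,L5);(L2,L7);(L3,L7);(L3,L5);(L4,L6);(L2,L6)].

Definition pendant_root : seq vrec :=
  [:: (L9,[::L4]); (L8,[::L3]); (L7,[::L2]); (L6,[::L1]); (L5,[::L0]); (L4,[::L0;L3]);
    (L3,[::L2]); (L2,[::L1]);(L1,[::L0]);(L0,[::])].

Definition pendant_open : seq vrec :=
  [:: (L5,[::L0]);(L6,[::L1]);(L7,[::L2]);(L8,[::L3]);(L9,[::L4])].

(* a new vertex joined to such a pair would create [edge_root] *)
Definition pendant_forbidden := [:: (L5,L6);(L6,L7);(L7,L8);(L8,L9);(L9,L5)].

Definition hexagon_root : seq vrec :=
  [:: (L5,[::L0;L4]); (L4,[::L3]); (L3,[::L2]); (L2,[::L1]);(L1,[::L0]);(L0,[::])].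

Definition hexagon_open : seq vrec :=
  [:: (L0,[::L1;L5]);(L1,[::L0;L2]);(L2,[::L1;L3]);(L3,[::L2;L4]);(L4,[::L3;L5]);(L5,[::L0;L4])].

Definition claw_root : seq vrec := [:: (L3,[::L0]); (L2,[::L0]);(L1,[::L0]);(L0,[::])].

Definition claw_open : seq vrec := [:: (L1,[::L0]);(L2,[::L0]);(L3,[::L0])].

(** The flower snark J_5: 0 to 4 form the pentagon, 5 to 9 are the centres of the five stars, and
    the ten-cycle 10, 12, 14, 16, 19, 11, 13, 15, 17, 18 passes all stars twice in the order of the
    pentagon. *)
Definition snark1 : seq vrec :=
  [:: (L0, [::]); (L1, [:: L0]); (L2, [:: L1]); (L3, [:: L2]); (L4, [:: L0; L3]); (L5, [:: L0]);
    (L6, [:: L1]); (L7, [:: L2]); (L8, [:: L3]); (L9, [:: L4]); (L10, [:: L5]); (L11, [:: L5]);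
    (L12, [:: L6; L10]); (L13, [:: L6; L11]); (L14, [:: L7; L12]); (L15, [:: L7; L13]); (L16, [::
    L8; L14]); (L17, [:: L8; L15]); (L18, [:: L9; L10; L17]); (L19, [:: L9; L11; L16])].

(** In this table and the next four the first seven entries are two pentagons sharing a path of
    length two: the paths 0-2-1, 0-3-4-1 and 0-5-6-1. *)
Definition snark2 : seq vrec :=
  [:: (L0, [::]); (L2, [:: L0]); (L1, [:: L2]); (L3, [:: L0]); (L4, [:: L1; L3]); (L5, [:: L0]);
    (L6, [:: L1; L5]); (L7, [:: L2]); (L8, [:: L3; L7]); (L9, [:: L4; L7]); (L10, [:: L5]); (L11,
    [:: L6]); (L12, [:: L8; L11]); (L13, [:: L9]); (L14, [:: L10]); (L15, [:: L10]); (L16, [::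
    L11; L15]); (L17, [:: L12; L14]); (L18, [:: L13; L14; L16]); (L19, [:: L13; L15; L17])].

Definition snark3 : seq vrec :=
  [:: (L0, [::]); (L2, [:: L0]); (L1, [:: L2]); (L3, [:: L0]); (L4, [:: L1; L3]); (L5, [:: L0]);
    (L6, [:: L1; L5]); (L7, [:: L2]); (L8, [:: L3; L7]); (L9, [:: L4]); (L10, [:: L5; L9]); (L11,
    [:: L6]); (L12, [:: L7; L10]); (L13, [:: L8]); (L14, [:: L9]); (L15, [:: L11; L14]); (L16, [::
    L11]); (L17, [:: L12; L16]); (L18, [:: L13; L14; L16]); (L19, [:: L13; L15; L17])].

Definition snark4 : seq vrec :=
  [:: (L0, [::]); (L2, [:: L0]); (L1, [:: L2]); (L3, [:: L0]); (L4, [:: L1; L3]); (L5, [:: L0]);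
    (L6, [:: L1; L5]); (L7, [:: L2]); (L8, [:: L3; L7]); (L9, [:: L4]); (L10, [:: L5; L9]); (L11,
    [:: L6]); (L12, [:: L7; L9]); (L13, [:: L8]); (L14, [:: L10]); (L15, [:: L11; L14]); (L16, [::
    L11]); (L17, [:: L12; L16]); (L18, [:: L13; L14; L16]); (L19, [:: L13; L15; L17])].

Definition snark5 : seq vrec :=
  [:: (L0, [::]); (L2, [:: L0]); (L1, [:: L2]); (L3, [:: L0]); (L4, [:: L1; L3]); (L5, [:: L0]);
    (L6, [:: L1; L5]); (L7, [:: L2]); (L8, [:: L3; L7]); (L9, [:: L4]); (L10, [:: L5; L7]); (L11,
    [:: L6]); (L12, [:: L8; L11]); (L13, [:: L9]); (L14, [:: L9]); (L15, [:: L10]); (L16, [:: L11;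
    L14]); (L17, [:: L12; L13]); (L18, [:: L13; L15; L16]); (L19, [:: L14; L15; L17])].

Definition snark6 : seq vrec :=
  [:: (L0, [::]); (L2, [:: L0]); (L1, [:: L2]); (L3, [:: L0]); (L4, [:: L1; L3]); (L5, [:: L0]);
    (L6, [:: L1; L5]); (L7, [:: L2]); (L8, [:: L3; L6]); (L9, [:: L4]); (L10, [:: L5]); (L11, [::
    L7; L10]); (L12, [:: L7]); (L13, [:: L8; L11]); (L14, [:: L9; L12]); (L15, [:: L9]); (L16, [::
    L10]); (L17, [:: L12; L15; L16]); (L18, [:: L13; L15]); (L19, [:: L14; L16; L18])].

Definition snarks := [:: snark1; snark2; snark3; snark4; snark5; snark6].

(** In each graph the side with nine vertices is the Petersen graph minus a vertex. By parity a
    3-edge-colouring would give the three cut edges different colours and so colour the Petersen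
    graph; hence the colouring test cannot dispose of these leaves. *)
Definition three_cut_graphs : seq (seq vrec * seq lab) :=
  [:: ([:: (L0, [::]); (L2, [:: L0]); (L1, [:: L2]); (L3, [:: L0]); (L4, [:: L1; L3]); (L5, [::
    L0]); (L6, [:: L1; L5]); (L7, [:: L2]); (L8, [:: L3; L7]); (L9, [:: L4; L7]); (L10, [:: L5;
    L9]); (L11, [:: L6]); (L12, [:: L8]); (L13, [:: L10]); (L14, [:: L11]); (L15, [:: L11]); (L16,
    [:: L12; L14]); (L17, [:: L12; L15]); (L18, [:: L13; L14; L17]); (L19, [:: L13; L15; L16])],
   [:: L0; L1; L2; L3; L4; L5; L6; L7; L8; L9; L10]);
  ([:: (L0, [::]); (L2, [:: L0]); (L1, [:: L2]); (L3, [:: L0]); (L4, [:: L1; L3]); (L5, [:: L0]);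
    (L6, [:: L1; L5]); (L7, [:: L2]); (L8, [:: L3; L7]); (L9, [:: L4; L7]); (L10, [:: L5; L8]);
    (L11, [:: L6]); (L12, [:: L9]); (L13, [:: L10]); (L14, [:: L11]); (L15, [:: L11]); (L16, [::
    L12; L14]); (L17, [:: L12; L15]); (L18, [:: L13; L14; L17]); (L19, [:: L13; L15; L16])],
   [:: L0; L1; L2; L3; L4; L5; L6; L7; L8; L9; L10]);
  ([:: (L0, [::]); (L2, [:: L0]); (L1, [:: L2]); (L3, [:: L0]); (L4, [:: L1; L3]); (L5, [:: L0]);
    (L6, [:: L1; L5]); (L7, [:: L2]); (L8, [:: L3; L7]); (L9, [:: L4]); (L10, [:: L5; L8; L9]);
    (L11, [:: L6]); (L12, [:: L7]); (L13, [:: L9]); (L14, [:: L11]); (L15, [:: L11]); (L16, [::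
    L12; L14]); (L17, [:: L12; L15]); (L18, [:: L13; L14; L17]); (L19, [:: L13; L15; L16])],
   [:: L0; L1; L2; L3; L4; L5; L6; L7; L8; L9; L10]);
  ([:: (L0, [::]); (L2, [:: L0]); (L1, [:: L2]); (L3, [:: L0]); (L4, [:: L1; L3]); (L5, [:: L0]);
    (L6, [:: L1; L5]); (L7, [:: L2]); (L8, [:: L3; L7]); (L9, [:: L4]); (L10, [:: L5]); (L11, [::
    L6; L8; L9]); (L12, [:: L7]); (L13, [:: L9]); (L14, [:: L10]); (L15, [:: L10]); (L16, [:: L12;
    L14]); (L17, [:: L12; L15]); (L18, [:: L13; L14; L17]); (L19, [:: L13; L15; L16])],
   [:: L0; L1; L2; L3; L4; L5; L6; L7; L8; L9; L11]);
  ([:: (L0, [::]); (L2, [:: L0]); (L1, [:: L2]); (L3, [:: L0]); (L4, [:: L1; L3]); (L5, [:: L0]);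
    (L6, [:: L1; L5]); (L7, [:: L2]); (L8, [:: L3; L7]); (L9, [:: L4]); (L10, [:: L5; L7; L9]);
    (L11, [:: L6]); (L12, [:: L8]); (L13, [:: L9]); (L14, [:: L11]); (L15, [:: L11]); (L16, [::
    L12; L14]); (L17, [:: L12; L15]); (L18, [:: L13; L14; L17]); (L19, [:: L13; L15; L16])],
   [:: L0; L1; L2; L3; L4; L5; L6; L7; L8; L9; L10]);
  ([:: (L0, [::]); (L2, [:: L0]); (L1, [:: L2]); (L3, [:: L0]); (L4, [:: L1; L3]); (L5, [:: L0]);
    (L6, [:: L1; L5]); (L7, [:: L2]); (L8, [:: L3; L6; L7]); (L9, [:: L4]); (L10, [:: L5; L9]);
    (L11, [:: L7]); (L12, [:: L9]); (L13, [:: L10]); (L14, [:: L11]); (L15, [:: L11]); (L16, [::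
    L12; L14]); (L17, [:: L12; L15]); (L18, [:: L13; L14; L17]); (L19, [:: L13; L15; L16])],
   [:: L0; L1; L2; L3; L4; L5; L6; L7; L8]);
  ([:: (L0, [::]); (L2, [:: L0]); (L1, [:: L2]); (L3, [:: L0]); (L4, [:: L1; L3]); (L5, [:: L0]);
    (L6, [:: L1; L5]); (L7, [:: L2]); (L8, [:: L3; L6; L7]); (L9, [:: L4]); (L10, [:: L5]); (L11,
    [:: L7]); (L12, [:: L9]); (L13, [:: L9]); (L14, [:: L10; L13]); (L15, [:: L10]); (L16, [::
    L11; L12]); (L17, [:: L11; L15]); (L18, [:: L12; L14; L17]); (L19, [:: L13; L15; L16])],
   [:: L0; L1; L2; L3; L4; L5; L6; L7; L8]);
  ([:: (L0, [::]); (L2, [:: L0]); (L1, [:: L2]); (L3, [:: L0]); (L4, [:: L1; L3]); (L5, [:: L0]);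
    (L6, [:: L1; L5]); (L7, [:: L2]); (L8, [:: L3; L7]); (L9, [:: L4; L5; L7]); (L10, [:: L6]);
    (L11, [:: L8]); (L12, [:: L10]); (L13, [:: L10]); (L14, [:: L11]); (L15, [:: L11]); (L16, [::
    L12; L14]); (L17, [:: L12; L15]); (L18, [:: L13; L14; L17]); (L19, [:: L13; L15; L16])],
   [:: L0; L1; L2; L3; L4; L5; L7; L8; L9])].

Definition targets := Eval vm_compute in
  [seq (t, profile (complete t)) | t <- snarks ++ [seq x.1 | x <- three_cut_graphs]].

Definition pentagon : seq vrec :=
  [:: (L4,[::L0;L3]); (L3,[::L2]); (L2,[::L1]);(L1,[::L0]);(L0,[::])].

(** * Soundness of the generation *)

Lemma lmemE a s : lmem a s = (a \in s).
Proof.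
elim: s => //= b s ->; rewrite inE.
by change (lab_eqb a b) with (a == b); case: eqP.
Qed.

Lemma ldisjE s t : ldisj s t = ~~ has (mem t) s.
Proof. by elim: s => //= a s ->; rewrite lmemE negb_or; case: (a \in t). Qed.

Lemma mem_labels a : a \in labels.
Proof. by case: a. Qed.

Definition upd (A : Type) (env : lab -> A) w x := fun l => if l == w then x else env l.

Lemma upd_eq A (env : lab -> A) w x : upd env w x w = x.
Proof. by rewrite /upd eqxx. Qed.

Lemma upd_neq A (env : lab -> A) w x l : l != w -> upd env w x l = env l.
Proof. by rewrite /upd => /negPf->. Qed.

Lemma mem_attach w S D E r :
  r \in attach w S D E ->
  r \in E \/ exists2 r0, r0 \in D &
    (r0.1 \notin S /\ r = r0) \/
    [/\ r0.1 \in S, size r0.2 < 2 & r = (r0.1, w :: r0.2)].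
Proof.
elim: D => [|r0 D IH] /=; first by left.
have up : r \in attach w S D E -> r \in E \/ exists2 r1, r1 \in r0 :: D &
    (r1.1 \notin S /\ r = r1) \/
    [/\ r1.1 \in S, size r1.2 < 2 & r = (r1.1, w :: r1.2)].
  by case/IH => [|[r1 r1D h]]; [left | right; exists r1; rewrite // inE r1D orbT].
rewrite lmemE; case: ifP => r0S; last first.
  rewrite inE => /orP[/eqP->|/up //]; right; exists r0; rewrite ?mem_head //.
  by left; rewrite r0S.
case E2: r0.2 => [|c [|d l]]; rewrite ?inE.
- move=> /orP[/eqP->|/up //]; right; exists r0; rewrite ?mem_head //.
  by right; rewrite E2.
- move=> /orP[/eqP->|/up //]; right; exists r0; rewrite ?mem_head //.
  by right; rewrite E2.
- exact: up.
Qed.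

Lemma attach_kept w S D E r :
  r \in D -> (r.1 \notin S) || (size r.2 < 2) -> r.1 \in unzip1 (attach w S D E).
Proof.
elim: D => //= r0 D IH; rewrite lmemE inE => /orP[/eqP->|rD] h; last first.
  have := IH rD h; case: ifP => _; last by rewrite inE => ->; rewrite orbT.
  by case: (r0.2) => [|c [|d l]] //=; rewrite inE => ->; rewrite orbT.
move: h; case r0S: (r0.1 \in S) => /= h; last by rewrite mem_head.
by move: h; case: (r0.2) => [|c [|d l]] //=; rewrite mem_head.
Qed.

Lemma attach_new w S D E a : a \in unzip1 E -> a \in unzip1 (attach w S D E).
Proof.
move=> aE; elim: D => //= r0 D IH; case: ifP => _; last by rewrite inE IH orbT.
by case: (r0.2) => [|c [|d l]] //=; rewrite inE IH orbT.
Qed.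

Lemma attach_subseq w S D E :
  subseq (unzip1 (attach w S D E)) (unzip1 D ++ unzip1 E).
Proof.
elim: D => [|r0 D IH]; first exact: subseq_refl.
have keep x : subseq (r0.1 :: unzip1 (attach w S D E)) (unzip1 (r0 :: D) ++ x) =
    subseq (unzip1 (attach w S D E)) (unzip1 D ++ x) by rewrite /= eqxx.
rewrite [attach _ _ _ _]/=; case: ifP => _; last by rewrite keep.
case: (r0.2) => [|c [|d l]]; rewrite ?keep //.
exact: subseq_trans IH (subseq_cons _ r0.1).
Qed.

Lemma attach_congr w S S' D E :
  {in unzip1 D, S =i S'} -> attach w S D E = attach w S' D E.
Proof.
elim: D => //= r0 D IH h; rewrite !lmemE h ?mem_head // IH // => a aD.
by apply: h; rewrite inE aD orbT.
Qed.

Lemma filter_attach (p : pred lab) w S D E :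
  {in S, forall a, ~~ p a} ->
  [seq b <- unzip1 (attach w S D E) | p b] =
  [seq b <- unzip1 D | p b] ++ [seq b <- unzip1 E | p b].
Proof.
move=> pS; elim: D => //= r0 D IH; rewrite lmemE; case: ifP => r0S /=.
  rewrite (negPf (pS _ r0S)).
  by case: (r0.2) => [|c [|d l]] //=; rewrite (negPf (pS _ r0S)).
by case: ifP => _; rewrite IH.
Qed.

Lemma all_pairsP (A : eqType) (P : A -> A -> bool) s x y :
  all_pairs P s -> x \in s -> y \in s -> P x y || P y x.
Proof.
elim: s => //= a s IH /andP[/andP[Paa Pa] Ps].
rewrite !inE => /orP[/eqP->|xs] /orP[/eqP->|ys]; rewrite ?Paa ?(allP Pa) ?orbT //.
exact: IH.
Qed.

Lemma small_subsetsP (ok : seq vrec -> vrec -> vrec -> bool) cs (s C : seq vrec) :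
  subseq s C -> size s <= 2 -> (forall a b : vrec, s = [:: a; b] -> ok cs a b) ->
  unzip1 s \in [::] :: small_subsets ok cs C.
Proof.
elim: C s => [|a C IH] s; first by move/eqP->.
case: s => [|b s] //=; case: eqP => [-> sub|_ sub] sz h; last first.
  have := IH _ sub sz h; rewrite !inE mem_cat => /orP[//|->]; rewrite !orbT //.
case: s sub sz h => [|c [|//]] sub _ h; first by rewrite !inE eqxx.
rewrite !inE mem_cat; apply/orP; right; apply/orP; right; apply/orP; left.
apply/mapP; exists c => //; rewrite mem_filter h //=.
by rewrite -sub1seq.
Qed.

Lemma deficitE D : {in D, forall r, size r.2 < 3} ->
  deficit D = \sum_(r <- D) (3 - size r.2).
Proof.
elim: D => [|r D IH] h; first by rewrite big_nil.
rewrite big_cons /= IH; last by move=> r' r'D; apply: h; rewrite inE r'D orbT.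
have := h r (mem_head _ _).
by case: (r.2) => [|? [|? [|? ?]]].
Qed.

Lemma tripleE s : triple s = 3 * size s.
Proof. by elim: s => //= _ s ->; rewrite mulnS. Qed.

(** * Following a given graph through the search tree *)

Section Soundness.
Variable G : sgraph.
Hypothesis cubic : regular 3 G.
Hypothesis conn : connected G.
Hypothesis card20 : #|G| = 20.
Hypothesis no3 : forall x y z : G, adj x y -> adj y z -> adj z x -> False.
Hypothesis no4 : forall x y a b : G,
  adj x a -> adj x b -> adj y a -> adj y b -> a != b -> x = y.

Implicit Types (env : lab -> G) (cs D : seq vrec) (todo S : seq lab).

(** Edges and non-edges are both recorded, so the placed part is an induced subgraph of [G]. *)
Fixpoint exact env cs : Prop :=
  if cs is r :: post then
    [/\ uniq r.2, {subset r.2 <= unzip1 post},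
        {in unzip1 post, forall b, (b \in r.2) = adj (env r.1) (env b)}
      & exact env post]
  else True.

Lemma exact_eq env env' cs :
  {in unzip1 cs, env =1 env'} -> exact env cs -> exact env' cs.
Proof.
elim: cs => //= r cs IH h [u s e x]; split=> //.
  move=> b bcs; rewrite e // !h ?mem_head // inE bcs orbT //.
by apply: IH => // b bcs; apply: h; rewrite inE bcs orbT.
Qed.

Definition labelled env cs : {pred G} := mem [seq env a | a <- unzip1 cs].

(** [D] lists the placed vertices that may still have unplaced neighbours. By [inv_full] all others
    are saturated, hence an unplaced vertex can be adjacent to open vertices only. *)
Record inv env todo D cs : Prop := Inv {
  inv_uniq : uniq (unzip1 cs ++ todo);
  inv_size : size cs + size todo = 20;
  inv_inj : {in unzip1 cs &, injective env};
  inv_exact : exact env cs;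
  inv_D : forall r, r \in D ->
    [/\ r.1 \in unzip1 cs, uniq r.2, size r.2 < 3 &
      forall b, (b \in r.2) = (b \in unzip1 cs) && adj (env r.1) (env b)];
  inv_uniqD : uniq (unzip1 D);
  inv_full : forall a, a \in unzip1 cs -> a \notin unzip1 D ->
    forall x, adj (env a) x -> x \in labelled env cs
}.

(** In a cubic graph three distinct known neighbours are all the neighbours. *)
Lemma full_nbrs env (ls s : seq lab) a x :
  {in ls &, injective env} -> {subset s <= ls} -> uniq s -> 2 < size s ->
  (forall b, b \in s -> adj a (env b)) -> adj a x -> x \in [seq env b | b <- s].
Proof.
move=> inj sub us ss h ax.
have sub' : {subset [seq env b | b <- s] <= enum [set y | adj a y]}.
  by move=> y /mapP[b bs ->]; rewrite mem_enum inE h.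
have us' : uniq [seq env b | b <- s].
  by rewrite map_inj_in_uniq // => b c bs cs; apply: inj; apply: sub.
have [] := uniq_min_size us' sub' _; first by rewrite -cardE cubic size_map.
by move=> _ /(_ x) ->; rewrite mem_enum inE.
Qed.

Lemma nbrs_le3 (a : G) (s : seq G) : uniq s -> {in s, forall b, adj a b} -> size s <= 3.
Proof.
move=> us h; rewrite -(cubic a) cardE; apply: uniq_leq_size => // y ys.
by rewrite mem_enum inE h.
Qed.

Section State.
Variables (env : lab -> G) (todo : seq lab) (D cs : seq vrec).
Hypothesis I : inv env todo D cs.

Lemma labelled_in b : b \in unzip1 cs -> env b \in labelled env cs.
Proof. by move=> bc; apply: map_f. Qed.

Definition free_nbrs x : seq lab := [seq b <- unzip1 D | adj x (env b)].

Lemma mem_unzip1D a : a \in unzip1 D -> a \in unzip1 cs.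
Proof. by case/mapP=> r rD ->; case: (inv_D I rD). Qed.

Lemma mem_free_nbrs x b : x \notin labelled env cs -> b \in unzip1 cs ->
  (b \in free_nbrs x) = adj x (env b).
Proof.
move=> xL bc; rewrite mem_filter; case xb: (adj x (env b)) => //=.
apply/negPn/negP => bD; case/negP: xL.
by apply: (inv_full I bc bD); rewrite adj_sym.
Qed.

Lemma uniq_free_nbrs x : uniq (free_nbrs x).
Proof. exact/filter_uniq/(inv_uniqD I). Qed.

Lemma uniq_env_free_nbrs x : uniq [seq env b | b <- free_nbrs x].
Proof.
rewrite map_inj_in_uniq ?uniq_free_nbrs // => b c.
rewrite !mem_filter => /andP[_ bD] /andP[_ cD].
by apply: (inv_inj I); apply: mem_unzip1D.
Qed.

Lemma size_free_nbrs x : size (free_nbrs x) <= 3.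
Proof.
rewrite -(size_map env); apply: (@nbrs_le3 x); first exact: uniq_env_free_nbrs.
by move=> y /mapP[b]; rewrite mem_filter => /andP[xb _] ->.
Qed.

Lemma uniq_labelled : uniq [seq env a | a <- unzip1 cs].
Proof.
rewrite map_inj_in_uniq; last exact: (inv_inj I).
by have := inv_uniq I; rewrite cat_uniq => /andP[].
Qed.

Lemma card_unlabelled : #|[set x | x \notin labelled env cs]| = size todo.
Proof.
apply/eqP; rewrite -(eqn_add2l (size cs)) (inv_size I) -card20; apply/eqP.
have -> : size cs = #|[set x | x \in labelled env cs]|.
  by rewrite cardsE (card_uniqP uniq_labelled) !size_map.
have -> : [set x | x \notin labelled env cs] = ~: [set x | x \in labelled env cs].
  by apply/setP => x; rewrite !inE.
by rewrite cardsC.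
Qed.

Lemma card_unlabelled_nbrs r : r \in D ->
  #|[set x | adj (env r.1) x & x \notin labelled env cs]| = 3 - size r.2.
Proof.
move=> rD; have [rc ur sr hr] := inv_D I rD.
rewrite -(cubic (env r.1)) (_ : size r.2 = #|[set y | adj (env r.1) y & y \in labelled env cs]|).
  rewrite -[X in _ = X - _](cardsID [set y | y \in labelled env cs]).
  rewrite (_ : _ :&: _ = [set y | adj (env r.1) y & y \in labelled env cs]); last first.
    by apply/setP => y; rewrite !inE.
  rewrite addKn; apply: eq_card => y; rewrite !inE andbC //.
have uE : uniq [seq env b | b <- r.2].
  rewrite map_inj_in_uniq // => b c.
  by rewrite !hr => /andP[bc _] /andP[cc _]; apply: (inv_inj I).
rewrite -(size_map env) -(card_uniqP uE); apply: eq_card => y; rewrite !inE.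
apply/mapP/andP => [[b]|[ay /mapP[b bc yE]]].
  by rewrite hr => /andP[bc ab] ->; split=> //; apply: labelled_in.
by exists b => //; rewrite hr bc -yE.
Qed.

(** Double counting of the edges between placed and unplaced vertices. *)
Lemma deficit_free : deficit D = \sum_(x in [set x | x \notin labelled env cs]) size (free_nbrs x).
Proof.
rewrite deficitE; last by move=> r rD; case: (inv_D I rD).
rewrite big_seq (eq_bigr (fun r : vrec =>
  \sum_(x in [set x | x \notin labelled env cs]) (adj (env r.1) x : nat))); last first.
  move=> r rD; rewrite -card_unlabelled_nbrs // -sum1_card big_mkcond [RHS]big_mkcond.
  by apply: eq_bigr => x _; rewrite !inE; case: (adj _ _); case: (_ \in _).
rewrite -big_seq exchange_big; apply: eq_bigr => x _ /=.
rewrite /free_nbrs size_filter /unzip1 count_map -sum1_count [RHS]big_mkcond.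
by apply: eq_bigr => r _ /=; rewrite adj_sym; case: (adj _ _).
Qed.

Lemma free_nbrs_ge x : x \notin labelled env cs ->
  4 <= size (free_nbrs x) + size todo.
Proof.
move=> xL.
have sub : [set y | adj x y] \subset
    [set y in [seq env b | b <- free_nbrs x]] :|:
    [set y | y \notin labelled env cs] :\ x.
  apply/subsetP => y; rewrite !inE => xy.
  case yL: (y \in labelled env cs) => /=; last first.
    by rewrite andbT (_ : y != x) ?orbT //; apply/eqP => E; rewrite E adj_irrefl in xy.
  rewrite andbF orbF; case/mapP: yL => b bc yE; apply/mapP; exists b => //.
  by rewrite mem_free_nbrs // -yE.
have := subset_leq_card sub; rewrite cubic => h.
have := leq_trans h (leq_card_setU _ _).
rewrite cardsE (card_uniqP (uniq_env_free_nbrs x)) size_map => h2.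
have := card_unlabelled; rewrite (cardsD1 x) inE xL => <-.
by rewrite addnCA ltnS.
Qed.

Lemma feasible_inv : feasible D todo.
Proof.
have U := card_unlabelled; have dE := deficit_free.
have le : deficit D <= 3 * size todo.
  rewrite dE mulnC -U -sum_nat_const; apply: leq_sum => x _; exact: size_free_nbrs.
have ge : size todo * (4 - size todo) <= deficit D.
  rewrite dE -{1}U -sum_nat_const; apply: leq_sum => x; rewrite inE => xL.
  by rewrite leq_subLR addnC free_nbrs_ge.
move: le ge; rewrite /feasible; case: todo => [|a [|b [|c l]]] /=.
- by case: (deficit D).
- by case: (deficit D) => [|[|[|[|d]]]].
- by case: (deficit D) => [|[|[|[|[|[|[|d]]]]]]].
by move=> le _; apply/PeanoNat.Nat.leb_le/leP; rewrite tripleE; lia.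
Qed.

Lemma exact_adj a b : a \in unzip1 cs -> b \in unzip1 cs ->
  adj (env a) (env b) = (b \in nbrs cs a) || (a \in nbrs cs b).
Proof.
have : uniq (unzip1 cs) by have := inv_uniq I; rewrite cat_uniq => /andP[].
move: (inv_exact I); rewrite /nbrs; elim: cs => //= r s IH [ur sub ex exs] /andP[rs us].
have look0 c : c \notin unzip1 s -> look [::] s c = [::].
  elim: (s) => //= r' s' IH'; rewrite inE negb_or => /andP[ne h].
  by change (lab_eqb c r'.1) with (c == r'.1); rewrite (negPf ne) IH'.
have out c : c \in unzip1 s -> (r.1 \in look [::] s c) = false.
  move=> _; apply/negbTE; apply: contra rs => h.
  have : {subset look [::] s c <= unzip1 s}.
    move: exs {IH ex sub us h}; elim: (s) => //= r' s' IH' [_ sub' _ ex'] d.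
    by case: ifP => _; [move/sub' | move/(IH' ex')]; rewrite inE => ->; rewrite orbT.
  exact.
rewrite !inE; change (lab_eqb a r.1) with (a == r.1); change (lab_eqb b r.1) with (b == r.1).
case: (a =P r.1) => [->|/eqP na] /=; case: (b =P r.1) => [->|/eqP nb] /= ha hb.
- by rewrite adj_irrefl (negbTE (contra (sub _) rs)).
- by rewrite ex // out ?orbF.
- by rewrite adj_sym ex // out.
- exact: IH.
Qed.

End State.

Lemma labelled_upd env cs w x : w \notin unzip1 cs ->
  {in unzip1 cs, env =1 upd env w x}.
Proof. by move=> wc a ac; rewrite upd_neq //; apply: contraNneq wc => <-. Qed.

(** The set [S] contains every placed neighbour of [x], because saturated vertices have no unplaced
    neighbour; this is why the placed part remains induced. *)
Lemma inv_extend env w todo D cs x (S := free_nbrs env D x) :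
  inv env (w :: todo) D cs -> x \notin labelled env cs ->
  inv (upd env w x) todo (attach w S D (new_vrec w S)) ((w, S) :: cs).
Proof.
move=> I xL; have Ux := inv_uniq I.
have wc : w \notin unzip1 cs.
  by move: Ux; rewrite cat_uniq => /and3P[_ /norP[]].
have agree := @labelled_upd env cs w x wc.
have SD b : b \in S -> b \in unzip1 D by rewrite mem_filter => /andP[].
have Sc b : b \in S -> b \in unzip1 cs by move/SD/(mem_unzip1D I).
have Sadj b : b \in S -> adj x (env b) by rewrite mem_filter => /andP[].
have uS : uniq S := uniq_free_nbrs I x.
have inj' : {in unzip1 ((w, S) :: cs) &, injective (upd env w x)}.
  have h b : b \in unzip1 cs -> upd env w x b != x.
    by move=> bc; rewrite -agree //; apply: contraNneq xL => <-; apply: labelled_in.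
  move=> b c; rewrite !inE => /orP[/eqP->|bc] /orP[/eqP->|cc] //.
  - by rewrite upd_eq => E; move: (h _ cc); rewrite -E eqxx.
  - by rewrite upd_eq => E; move: (h _ bc); rewrite E eqxx.
  - by rewrite -!agree //; apply: (inv_inj I).
have lab' y : y \in labelled env cs -> y \in labelled (upd env w x) ((w, S) :: cs).
  case/mapP => b bc ->; apply/mapP; exists b; first by rewrite inE bc orbT.
  exact: agree.
split.
- by move: Ux; rewrite -[w :: todo]cat1s uniq_catCA.
- by rewrite /= -(inv_size I) /= addnS.
- exact: inj'.
- split=> //.
    by move=> b bc; rewrite /= upd_eq -agree //; apply: (mem_free_nbrs I xL bc).
  exact: exact_eq agree (inv_exact I).
- move=> r /mem_attach[rE|[r0 r0D h]].
    have [sz ->] : size S < 3 /\ r = (w, S).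
      by move: rE; rewrite /new_vrec; case: (S) => [|? [|? [|? ?]]]; rewrite ?inE // => /eqP->.
    split; rewrite ?mem_head // => b; rewrite inE /= upd_eq.
    case: (b =P w) => [->|/eqP nb] /=.
      by rewrite upd_eq adj_irrefl; apply/negbTE; apply: contra wc => /Sc.
    rewrite upd_neq //; case bc: (b \in unzip1 cs) => /=; first exact: (mem_free_nbrs I xL bc).
    by apply/negP => /Sc; rewrite bc.
  have [rc ur sr hr] := inv_D I r0D.
  have r0D' : r0.1 \in unzip1 D by apply: map_f.
  have wr : w \notin r0.2 by rewrite hr (negPf wc).
  have nw : r0.1 != w by apply: contraNneq wc => <-.
  case: h => [[nS ->]|[inS sz ->]]; split => //=; rewrite ?inE ?rc ?orbT ?wr //.
    move=> b; rewrite hr inE upd_neq //; case: (b =P w) => [->|/eqP nb] /=.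
      rewrite upd_eq (negPf wc) /= adj_sym; apply/esym/negbTE.
      by move: nS; rewrite mem_filter r0D' andbT.
    by rewrite upd_neq.
  move=> b; rewrite !inE hr upd_neq //; case: (b =P w) => [->|/eqP nb] /=.
    by rewrite upd_eq adj_sym Sadj.
  by rewrite upd_neq.
- apply: subseq_uniq (attach_subseq _ _ _ _) _; rewrite cat_uniq (inv_uniqD I) /=.
  have nwD : w \notin unzip1 D by apply: contra wc; apply: (mem_unzip1D I).
  by rewrite /new_vrec; case: (S) => [|? [|? [|? ?]]] //=; rewrite orbF nwD.
- move=> a aC aD y; rewrite inE in aC; case/orP: aC => [/eqP E|ac].
    rewrite E upd_eq => xy; apply: lab'.
    have sz : 2 < size S.
      rewrite ltnNge; apply/negP => sz; case/negP: aD; apply: attach_new.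
      by rewrite E /new_vrec; move: sz; case: (S) => [|? [|? [|? ?]]] //= _; rewrite mem_head.
    have /mapP[b bS ->] := full_nbrs (inv_inj I) Sc uS sz Sadj xy.
    exact/labelled_in/Sc.
  rewrite -agree // => ay.
  case aD0: (a \in unzip1 D); last first.
    by apply: lab'; apply: (inv_full I ac) ay; rewrite aD0.
  case/mapP: aD0 => r rD aE.
  (* A label that was open before and is closed now had two neighbours and has received [w] as its
     third. *)
  have [aS sz] : a \in S /\ 1 < size r.2.
    have := @attach_kept w S D (new_vrec w S) r rD; rewrite -aE (negPf aD).
    case: (a \in S) => /=; last by move/(_ isT).
    by case: ltnP => // ? /(_ isT).
  have [rc ur sr hr] := inv_D I rD.
  have wr : w \notin r.2 by rewrite hr (negPf wc).
  have sub : {subset w :: r.2 <= unzip1 ((w, S) :: cs)}.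
    by move=> b; rewrite !inE hr => /orP[->//|/andP[->]]; rewrite orbT.
  have all_adj b : b \in w :: r.2 -> adj (env a) (upd env w x b).
    rewrite inE => /orP[/eqP->|br]; first by rewrite upd_eq adj_sym Sadj.
    by move: br; rewrite hr aE => /andP[bc ab]; rewrite -agree.
  have uw : uniq (w :: r.2) by rewrite /= wr.
  have /mapP[b bw ->] := full_nbrs inj' sub uw (sz : 2 < size (w :: r.2)) all_adj ay.
  by apply: labelled_in; apply: sub.
Qed.

Section SearchSound.
Variables (ok : seq vrec -> vrec -> vrec -> bool) (leaf : seq vrec -> bool).
(** [R] is the set of root labels, whose images never change. A rule such as [ok_forbidding] speaks
    about particular labels and holds only for the given images of them. *)
Variables (R : seq lab) (env0 : lab -> G).
Hypothesis ok_complete : forall env todo D cs r1 r2 x,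
  inv env todo D cs -> {subset R <= unzip1 cs} -> {in R, env =1 env0} ->
  r1 \in D -> r2 \in D -> r1.1 != r2.1 -> x \notin labelled env cs ->
  adj x (env r1.1) -> adj x (env r2.1) -> ok cs r1 r2.

Lemma mem_choices env todo u D cs x :
  inv env todo (u :: D) cs -> {subset R <= unzip1 cs} -> {in R, env =1 env0} ->
  x \notin labelled env cs -> adj x (env u.1) ->
  free_nbrs env D x \in choices ok cs u D.
Proof.
move=> I RS Re xL xu; have := inv_uniqD I => /= /andP[uD UD].
set p := fun r : vrec => adj x (env r.1).
have -> : free_nbrs env D x = unzip1 [seq r <- D | p r].
  by rewrite /free_nbrs /unzip1 filter_map.
have -> : [seq r <- D | p r] = [seq r <- [seq r <- D | ok cs u r] | p r].
  rewrite -filter_predI; apply: eq_in_filter => r rD /=; case pr: (p r) => //=.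
  apply/esym; apply: (ok_complete I RS Re _ _ _ xL) => //; rewrite ?mem_head //.
    by rewrite inE rD orbT.
  by apply: contraNneq uD => ->; apply: map_f.
set s := filter _ _; apply: small_subsetsP; first exact: filter_subseq.
  have := size_free_nbrs I x; rewrite /free_nbrs /= xu /= ltnS /unzip1 filter_map size_map.
  apply: leq_trans; rewrite !size_filter; apply: leq_count_subseq; exact: filter_subseq.
move=> a b sE.
have sub : subseq s D by apply: subseq_trans (filter_subseq _ _) (filter_subseq _ _).
have us : uniq (unzip1 s) by apply: subseq_uniq UD; apply: map_subseq.
have [as_ bs] : a \in s /\ b \in s by rewrite sE !inE !eqxx orbT.
have pp r : r \in s -> adj x (env r.1) by rewrite mem_filter => /andP[].
apply: (ok_complete I RS Re _ _ _ xL); rewrite ?pp //.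
- by rewrite inE (mem_subseq sub as_) orbT.
- by rewrite inE (mem_subseq sub bs) orbT.
- by move: us; rewrite sE /= inE andbT.
Qed.

(** With no open vertex left, the placed set is closed under adjacency, so by connectedness it is
    everything. *)
Lemma all_labelled env todo cs :
  0 < size cs -> inv env todo [::] cs -> todo = [::].
Proof.
move=> cs0 I; have [r rcs] : exists r, r \in cs.
  by case: (cs) cs0 => // r s _; exists r; rewrite mem_head.
have cl : closed (@adj G) (labelled env cs).
  have h x y : adj x y -> x \in labelled env cs -> y \in labelled env cs.
    by move=> xy /mapP[a ac xE]; apply: (inv_full I ac) => //; rewrite -xE.
  by move=> x y xy; apply/idP/idP; apply: h; rewrite // adj_sym.
have allL x : x \in labelled env cs.
  rewrite -(closed_connect cl (conn (env r.1) x)).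
  by apply: labelled_in; apply: map_f.
apply: size0nil; rewrite -(card_unlabelled I); apply/eqP; rewrite cards_eq0.
by apply/eqP/setP => x; rewrite !inE allL.
Qed.

Definition one_step w todo a D cs T :=
  let D2 := attach w T D (new_vrec w (a :: T)) in
  if feasible D2 todo then search ok leaf todo D2 ((w, a :: T) :: cs) else true.

Definition two_step w w' todo a D cs T T' :=
  if ldisj T T' then
    let D2 := attach w T D (new_vrec w (a :: T)) in
    let D3 := attach w' T' D2 (new_vrec w' (a :: T')) in
    if feasible D3 todo then
      search ok leaf todo D3 [:: (w', a :: T'), (w, a :: T) & cs]
    else true
  else true.

Lemma search_one w todo a c d D cs :
  search ok leaf (w :: todo) ((a, [:: c; d]) :: D) cs =
  all (one_step w todo a D cs) (choices ok cs (a, [:: c; d]) D).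
Proof. by []. Qed.

Lemma search_two w w' todo a c D cs :
  search ok leaf [:: w, w' & todo] ((a, [:: c]) :: D) cs =
  all_pairs (two_step w w' todo a D cs) (choices ok cs (a, [:: c]) D).
Proof. by []. Qed.

(** The branch to follow is read off from [G]: the unplaced neighbours of the first open vertex,
    with their true sets of placed neighbours, are among the choices that were tried. *)
Lemma search_sound todo D cs env :
  0 < size cs -> inv env todo D cs -> {subset R <= unzip1 cs} ->
  {in R, env =1 env0} -> search ok leaf todo D cs ->
  exists env' cs', [/\ inv env' [::] [::] cs', {in R, env' =1 env0} & leaf cs'].
Proof.
have [n] := ubnP (size todo); elim: n todo D cs env => // n IH todo D cs env.
case: D => [|u D].
  move=> _ cs0 I _ Re; have t0 := all_labelled cs0 I; subst todo.
  by move=> /= lf; exists env, cs.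
move=> sz cs0 I RS Re.
have uin : u \in u :: D by rewrite mem_head.
have := card_unlabelled_nbrs I uin; set U := [set _ | _ & _] => cU.
have [uc uu us hu] := inv_D I uin.
have [uD UD] : u.1 \notin unzip1 D /\ uniq (unzip1 D) by apply/andP; exact: (inv_uniqD I).
case: todo sz I => [|w todo] sz I.
  have : U \subset [set x | x \notin labelled env cs].
    by apply/subsetP => x; rewrite !inE => /andP[].
  move/subset_leq_card; rewrite cU (card_unlabelled I) /= leqn0 subn_eq0 leqNgt us //.
have wc : w \notin unzip1 cs.
  by move: (inv_uniq I); rewrite cat_uniq => /and3P[_ /norP[]].
have Re' x : {in R, upd env w x =1 env0}.
  by move=> a aR; rewrite -Re // -(@labelled_upd env cs w x wc) // RS.
have freeE x : adj (env u.1) x -> free_nbrs env (u :: D) x = u.1 :: free_nbrs env D x.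
  by move=> ux; rewrite /free_nbrs /= adj_sym ux.
have attE T E : {subset T <= unzip1 D} -> attach w (u.1 :: T) D E = attach w T D E.
  move=> TD; apply: attach_congr => a aD; rewrite inE.
  by case: eqP => // aE; rewrite aE (negPf uD) in aD.
have subT x : {subset free_nbrs env D x <= unzip1 D}.
  by move=> a; rewrite mem_filter => /andP[].
case: u => a nb in uin U cU uc uu us hu uD UD I freeE attE *.
simpl fst in *; simpl snd in *.
case: nb => [|c [|d [|? ?]]] // in uin U cU uu us hu I freeE *.
- case: todo sz I => [|w' todo] sz I.
    have : U \subset [set x | x \notin labelled env cs].
      by apply/subsetP => x; rewrite !inE => /andP[].
    by move/subset_leq_card; rewrite cU (card_unlabelled I).
  have /cards2P[x [y [xy UE]]] : #|U| == 2 by rewrite cU.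
  have [/andP[ax xL] /andP[ay yL]] :
      adj (env a) x && (x \notin labelled env cs) /\
      adj (env a) y && (y \notin labelled env cs).
    have xU : x \in U by rewrite UE !inE eqxx.
    have yU : y \in U by rewrite UE !inE eqxx orbT.
    by rewrite !inE in xU yU.
  have [xa ya] : adj x (env a) /\ adj y (env a) by rewrite !(adj_sym _ (env a)).
  rewrite search_two.
  move=> sr; have := all_pairsP sr (mem_choices I RS Re xL xa) (mem_choices I RS Re yL ya).
  (* The successful branch may name [y] first; the situation is symmetric. *)
  wlog h : x y xy {UE} ax ay xL yL xa ya /
      two_step w w' todo a D cs (free_nbrs env D x) (free_nbrs env D y).
    move=> W /orP[h|h]; [apply: (W x y) | apply: (W y x)] => //; rewrite ?h // eq_sym //.
  move=> _; move: h; rewrite /two_step.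
  set T := free_nbrs env D x; set T' := free_nbrs env D y.
  (* [x] and [y] already share the neighbour [env a]; a second one would close a 4-cycle. *)
  have disj b : b \in T -> b \notin T'.
    rewrite !mem_filter => /andP[xb bD]; rewrite bD andbT; apply/negP => yb.
    have bc : b \in unzip1 cs by apply: (mem_unzip1D I); rewrite inE bD orbT.
    have ab : env a != env b.
      apply/eqP => /(inv_inj I uc bc) abE; rewrite -abE in bD.
      by rewrite bD in uD.
    by case/eqP: xy; apply: (no4 xa xb ya yb ab).
  rewrite ldisjE (_ : ~~ _ = true); last by apply/hasPn => b bT; apply: disj.
  set E1 := new_vrec w (a :: T); set E2 := new_vrec w' (a :: T').
  have I1 := inv_extend I xL; rewrite freeE // -/T in I1.
  have D1E : attach w (a :: T) ((a, [:: c]) :: D) E1 =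
      (a, [:: w; c]) :: attach w T D E1.
    rewrite /= attE; last exact: subT.
    by change (lab_eqb a a) with (a == a); rewrite eqxx.
  rewrite D1E in I1.
  have yL1 : y \notin labelled (upd env w x) ((w, a :: T) :: cs).
    rewrite /labelled /= inE upd_eq negb_or eq_sym xy /=.
    rewrite (_ : [seq _ | _ <- _] = [seq env b | b <- unzip1 cs]) //.
    by apply/eq_in_map => b bc; rewrite -(@labelled_upd env cs w x wc).
  have I2 := inv_extend I1 yL1.
  have aw : a != w by apply: contraNneq wc => <-.
  have aD1 : a \notin unzip1 (attach w T D E1).
    apply/negP => /(mem_subseq (attach_subseq _ _ _ _)); rewrite mem_cat (negPf uD) /=.
    by rewrite /E1 /new_vrec; case: (T) => [|? [|? ?]] //=; rewrite inE (negPf aw).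
  (* Placing [x] does not change the free neighbours of [y]: the label [w] is not among them, as
     [x], [y] and [env a] would form a triangle, and the labels that [x] may have saturated lie in
     [T], which is disjoint from [T']. *)
  have fy : free_nbrs (upd env w x) ((a, [:: w; c]) :: attach w T D E1) y = a :: T'.
    rewrite /free_nbrs /= upd_neq // ya; congr (_ :: _).
    rewrite filter_attach; last first.
      move=> b bT; have bD := subT _ _ bT.
      have bc : b \in unzip1 cs by apply: (mem_unzip1D I); rewrite inE bD orbT.
      rewrite -(@labelled_upd env cs w x wc) //; move: (disj _ bT).
      by rewrite mem_filter bD andbT.
    rewrite (_ : [seq b <- unzip1 E1 | _] = [::]) ?cats0; last first.
      have xyN : adj y x = false by apply/negP => yx; apply: (no3 ax _ ya); rewrite adj_sym.
      by rewrite /E1 /new_vrec; case: (T) => [|? [|? ?]] //=; rewrite upd_eq xyN.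
    apply: eq_in_filter => b bD.
    have bc : b \in unzip1 cs by apply: (mem_unzip1D I); rewrite inE bD orbT.
    by rewrite -(@labelled_upd env cs w x wc).
  rewrite fy in I2.
  have D2E : attach w' (a :: T') ((a, [:: w; c]) :: attach w T D E1) E2 =
      attach w' T' (attach w T D E1) E2.
    rewrite /=; change (lab_eqb a a) with (a == a); rewrite eqxx.
    apply: attach_congr => b bD; rewrite inE; case: eqP => // bE.
    by rewrite bE (negPf aD1) in bD.
  rewrite D2E in I2; rewrite (feasible_inv I2) => sr'.
  apply: IH I2 _ _ sr' => //; first by apply: ltnW; rewrite ltnS in sz.
    by move=> b bR; rewrite /= !inE RS ?orbT.
  have w'c : w' \notin unzip1 ((w, a :: T) :: cs).
    by move: (inv_uniq I1); rewrite cat_uniq => /and3P[_ /norP[]].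
  move=> b bR; rewrite -(Re' x) //; apply/esym/(@labelled_upd (upd env w x) _ w' y w'c).
  by rewrite /= inE RS ?orbT.
- have /cards1P[x UE] : #|U| == 1 by rewrite cU.
  have /andP[ax xL] : adj (env a) x && (x \notin labelled env cs).
    have : x \in U by rewrite UE inE.
    by rewrite inE.
  have xa : adj x (env a) by rewrite adj_sym.
  rewrite search_one => /allP /(_ _ (mem_choices I RS Re xL xa)); rewrite /one_step.
  have I1 := inv_extend I xL; rewrite freeE // in I1.
  have D1E E : attach w (a :: free_nbrs env D x) ((a, [:: c; d]) :: D) E =
      attach w (free_nbrs env D x) D E.
    rewrite /= attE; last exact: subT.
    by change (lab_eqb a a) with (a == a); rewrite eqxx.
  rewrite D1E in I1; rewrite (feasible_inv I1) => sr.
  apply: IH I1 _ (Re' x) sr => //.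
  by move=> b bR; rewrite /= inE RS ?orbT.
Qed.

End SearchSound.

Section Leaf.
Variables (env : lab -> G) (cs : seq vrec).
Hypothesis I : inv env [::] [::] cs.

Lemma leaf_labels a : a \in unzip1 cs.
Proof.
have u : uniq (unzip1 cs) by have := inv_uniq I; rewrite cats0.
have sub : {subset unzip1 cs <= labels} by move=> b _; apply: mem_labels.
have [] := uniq_min_size u sub _; last by move=> _ ->; apply: mem_labels.
by rewrite size_map; have := inv_size I; rewrite addn0 => ->.
Qed.

Lemma leaf_inj : injective env.
Proof. by move=> a b; apply: (inv_inj I); apply: leaf_labels. Qed.

Lemma leaf_adj a b : adj (env a) (env b) = tadj cs a b.
Proof. by rewrite (exact_adj I) ?leaf_labels // /tadj !lmemE. Qed.

Lemma leaf_surj x : exists a, x = env a.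
Proof.
have /mapP[a _ ->] : x \in labelled env cs; last by exists a.
apply/negPn/negP => xL; have := card_unlabelled I; rewrite (cardsD1 x) inE xL.
by [].
Qed.

End Leaf.

(** The images of the three neighbours of [a] exhaust the degree of [phi a], so non-edges are
    preserved as well. *)
Lemma full_iso (t : seq vrec) (phi : lab -> G) :
  is_cubic t -> injective phi ->
  (forall a b, tadj t a b -> adj (phi a) (phi b)) ->
  forall a b, adj (phi a) (phi b) = tadj t a b.
Proof.
move=> /allP ct inj h a b; apply/idP/idP => [ab|]; last exact: h.
have us : uniq [seq b <- labels | tadj t a b] by rewrite filter_uniq.
have sz : 2 < size [seq b <- labels | tadj t a b].
  by rewrite size_filter (eqP (ct a (mem_labels a))).
have sub : {subset [seq b <- labels | tadj t a b] <= labels}.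
  by move=> c _; apply: mem_labels.
have hs c : c \in [seq b <- labels | tadj t a b] -> adj (phi a) (phi c).
  by rewrite mem_filter => /andP[/h].
have /mapP[c] := full_nbrs (in2W inj) sub us sz hs ab.
by rewrite mem_filter => /andP[ac _] /inj->.
Qed.

End Soundness.

Lemma look_in (A : eqType) d (m : seq (lab * A)) a :
  a \in unzip1 m -> (a, look d m a) \in m.
Proof.
elim: m => //= x m IH; rewrite inE; change (lab_eqb a x.1) with (a == x.1).
case: eqP => [->|_] /= h; first by rewrite -surjective_pairing mem_head.
by rewrite inE IH ?orbT.
Qed.

Lemma look_eq (A : eqType) d (m : seq (lab * A)) a x :
  uniq (unzip1 m) -> (a, x) \in m -> look d m a = x.
Proof.
elim: m => //= y m IH /andP[ym um]; rewrite inE; change (lab_eqb a y.1) with (a == y.1).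
case/orP => [/eqP<-|axm]; first by rewrite eqxx.
case: eqP => [E|_]; last exact: IH.
by case/negP: ym; rewrite -E; apply/mapP; exists (a, x).
Qed.

Lemma nbrs_complete cs a b : uniq (unzip1 cs) -> a \in unzip1 cs -> b \in unzip1 cs ->
  (b \in nbrs (complete cs) a) = tadj cs a b.
Proof.
move=> u ac bc.
have -> : nbrs (complete cs) a = nbrs cs a ++ [seq y.1 | y <- cs & lmem a y.2].
  apply: look_eq; first by rewrite /unzip1 -map_comp.
  by apply/mapP; exists (a, nbrs cs a) => //; apply: look_in.
rewrite mem_cat /tadj !lmemE; congr (_ || _); apply/mapP/idP => [[y]|h].
  rewrite mem_filter lmemE => /andP[ay ycs] ->.
  by rewrite /nbrs (@look_eq _ [::] cs y.1 y.2) // -surjective_pairing.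
by exists (b, nbrs cs b) => //; rewrite mem_filter lmemE h look_in.
Qed.

(** * Correctness of the colouring search *)

Definition in_mask (c : colour) (m : mask) : bool :=
  match c, m with
  | cA, (mA | mAB | mAC | mABC) | cB, (mB | mAB | mBC | mABC)
  | cC, (mC | mAC | mBC | mABC) => true
  | _, _ => false
  end.

Lemma add_colourP c m k : add_colour c m k ->
  exists m', [/\ k m', ~~ in_mask c m, in_mask c m' &
    forall d, in_mask d m -> in_mask d m'].
Proof.
by case: c m => [] [] //= km; eexists; split; try exact: km; try by []; case.
Qed.

Lemma paintP a c l k : paint a c l k ->
  exists l', [/\ k l', unzip1 l' = unzip1 l, ~~ in_mask c (look m0 l a),
    in_mask c (look m0 l' a) &
    forall b d, in_mask d (look m0 l b) -> in_mask d (look m0 l' b)].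
Proof.
elim: l k => //= x l IH k; case: ifP => ax.
  move=> /add_colourP[m' [km nc c' mono]]; exists ((x.1, m') :: l); split=> //=.
    by rewrite ax.
  by move=> b d; case: ifP => // _; apply: mono.
move=> /IH[l' [kl ul nc c' mono]]; exists (x :: l'); split=> //=; rewrite ?ax ?ul //.
by move=> b d; case: ifP => // _; apply: mono.
Qed.

Fixpoint well_founded_back (cs : seq vrec) : Prop :=
  if cs is r :: post then
    [/\ uniq r.2, {subset r.2 <= unzip1 post} & well_founded_back post]
  else True.

Definition back_edges (cs : seq vrec) : seq (lab * lab) :=
  [seq (r.1, s) | r <- cs, s <- r.2].

Definition ends (e : lab * lab) : seq lab := [:: e.1; e.2].

(** A uniform summary of the four shapes of [S]. Masks only grow, which lets facts about later
    states be pulled back to earlier ones. *)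
Lemma colourable_step v (S : seq lab) cs m l :
  uniq S -> colourable ((v, S) :: cs) ((v, m) :: l) ->
  exists gam l2, [/\ colourable cs l2, unzip1 l2 = unzip1 l,
    forall s, s \in S -> [/\ ~~ in_mask (gam s) (look m0 l s),
      in_mask (gam s) (look m0 l2 s) & ~~ in_mask (gam s) m],
    {in S &, injective gam} &
    forall b d, in_mask d (look m0 l b) -> in_mask d (look m0 l2 b)].
Proof.
case: S => [|a [|b [|e [|? ?]]]] //=.
- by move=> _ h; exists (fun _ => cA), l; split.
- move=> _ h.
  have {h} [c cm /paintP[l2 [h1 h2 h3 h4 h5]]] :
      exists2 c, ~~ in_mask c m & paint a c l (colourable cs).
    by case: m h => //= h; [exists cC | exists cB | exists cA].
  exists (fun _ => c), l2; split=> // [s|s s']; rewrite !inE => /eqP->; first by split.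
  by move/eqP->.
- rewrite inE andbT => ab h.
  have {h} [c [d [cm dm cd]]] : exists c d, [/\ ~~ in_mask c m, ~~ in_mask d m, c <> d &
      paint a c l (fun l2 => paint b d l2 (colourable cs))].
    by case: m h => //=; case: ifP => h h';
      [exists cB, cC | exists cC, cB | exists cA, cC | exists cC, cA
      | exists cA, cB | exists cB, cA]; split.
  move=> /paintP[l1 [/paintP[l2 [k1 k2 k3 k4 k5]] h2 h3 h4 h5]].
  exists (fun s => if s == a then c else d), l2; split=> //; first by rewrite k2.
  - move=> s; rewrite !inE => /orP[]/eqP->; rewrite ?eqxx; first by split=> //; apply: k5.
    rewrite eq_sym (negPf ab); split=> //; apply: contra k3; apply: h5.
  - move=> s s'; rewrite !inE => /orP[]/eqP-> /orP[]/eqP->; rewrite ?eqxx //;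
      by rewrite (eq_sym b) (negPf ab) // => /esym.
  - by move=> x y /h5/k5.
- rewrite !inE negb_or andbT => /andP[/andP[ab ae] be] h.
  have {h} [c [d [f [cm cd cf df]]]] : exists c d f, [/\ m = m0, c <> d, c <> f, d <> f &
      paint a c l (fun l2 => paint b d l2 (fun l3 => paint e f l3 (colourable cs)))].
    case: m h => //.
    case: ifP => [h _|_]; first by exists cA, cB, cC.
    case: ifP => [h _|_]; first by exists cB, cC, cA.
    case: ifP => [h _|_]; first by exists cC, cA, cB.
    case: ifP => [h _|_]; first by exists cA, cC, cB.
    case: ifP => [h _|_]; first by exists cB, cA, cC.
    by move=> h; exists cC, cB, cA.
  move=> /paintP[l1 [/paintP[l2 [/paintP[l3 [j1 j2 j3 j4 j5]] k2 k3 k4 k5]] h2 h3 h4 h5]].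
  exists (fun s => if s == a then c else if s == b then d else f), l3; split=> //.
  - by rewrite j2 k2.
  - move=> s; rewrite !inE cm => /or3P[]/eqP->; rewrite ?eqxx.
    + by split=> //; [apply: j5; apply: k5 | case: (c)].
    + rewrite eq_sym (negPf ab); split=> //; [by apply: contra k3; apply: h5 | exact: j5 | by case: (d)].
    + rewrite eq_sym (negPf ae) eq_sym (negPf be); split=> //; last by case: (f).
      by apply: contra j3 => /h5/k5.
  - move=> s s'; rewrite !inE => /or3P[]/eqP-> /or3P[]/eqP->; rewrite ?eqxx //;
      rewrite ?(eq_sym b a) ?(eq_sym e a) ?(eq_sym e b) ?(negPf ab) ?(negPf ae) ?(negPf be) ?eqxx //;
      by move/esym.
  - by move=> x y /h5/k5/j5.
Qed.

(** The first clause strengthens the induction: an edge treated later avoids every colour already in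
    the masks of its ends, in particular those of the edges treated before it. *)
Lemma colourable_sound cs l :
  uniq (unzip1 cs) -> unzip1 l = unzip1 cs -> well_founded_back cs ->
  colourable cs l ->
  exists kap : lab * lab -> colour, forall e, e \in back_edges cs ->
    (forall t, t \in ends e -> ~~ in_mask (kap e) (look m0 l t)) /\
    forall e', e' \in back_edges cs -> e != e' ->
      forall t, t \in ends e -> t \in ends e' -> kap e <> kap e'.
Proof.
elim: cs l => [|[v S] cs IH] l; first by exists (fun _ => cA).
case: l => [//|[v' m] l] /andP[vcs ucs] [-> ul] [uS subS wf].
simpl fst in *; simpl snd in *.
move=> /(colourable_step uS)[gam [l2 [cl2 ul2 hg inj mono]]].
have [kap hk] := IH l2 ucs (etrans ul2 ul) wf cl2.
have inS e : e \in back_edges ((v, S) :: cs) ->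
    (e.1 = v /\ e.2 \in S) \/ e \in back_edges cs.
  rewrite /back_edges /= mem_cat => /orP[/mapP[s sS ->]|]; last by right.
  by left.
have fst_cs e : e \in back_edges cs -> e.1 \in unzip1 cs.
  by case/allpairsPdep => r [s [rc sr ->]]; apply: map_f.
have snd_cs e : e \in back_edges cs -> e.2 \in unzip1 cs.
  move: (wf); elim: (cs) => //= r post IH' [_ sub wfp].
  rewrite /back_edges /= mem_cat inE => /orP[/mapP[s /sub sr ->]|/IH'-> //]; rewrite ?sr ?orbT //.
have ends_cs e t : e \in back_edges cs -> t \in ends e -> t \in unzip1 cs.
  by move=> ec; rewrite !inE => /orP[]/eqP->; [apply: fst_cs | apply: snd_cs].
have nv t : t \in unzip1 cs -> t == v = false.
  by move=> tc; apply: contraNF vcs => /eqP<-.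
exists (fun e => if e.1 == v then gam e.2 else kap e) => e /inS[[ev eS]|ec].
  have [g1 g2 g3] := hg _ eS; rewrite ev eqxx; split.
    move=> t; rewrite !inE ev /=; change (lab_eqb t v) with (t == v).
    case/orP => /eqP->; first by rewrite eqxx.
    by rewrite nv //; apply: subS.
  move=> e' /inS[[ev' eS']|ec'] ne t; rewrite !inE ?ev ?ev'.
    rewrite eqxx => _ _ /inj-/(_ eS eS') E; case/eqP: ne.
    by rewrite (surjective_pairing e) (surjective_pairing e') ev ev' E.
  move=> te te'; have te2 : t \in ends e' by rewrite !inE.
  have tc := ends_cs _ _ ec' te2; rewrite (nv _ (fst_cs _ ec')).
  have {te} /eqP tE : t == e.2 by move: te; rewrite (nv _ tc).
  move=> E; have := (hk _ ec').1 _ te2; rewrite -E tE => /negP; exact.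
rewrite (nv _ (fst_cs _ ec)); split.
  move=> t te; have tc := ends_cs _ _ ec te; rewrite /=; change (lab_eqb t v) with (t == v).
  rewrite (nv _ tc); apply: contra ((hk _ ec).1 _ te); exact: mono.
move=> e' /inS[[ev' eS']|ec'] ne t te te'; last first.
  by rewrite (nv _ (fst_cs _ ec')); apply: ((hk _ ec).2 _ ec' ne t).
have [g1 g2 g3] := hg _ eS'; rewrite ev' eqxx.
have tc := ends_cs _ _ ec te.
have /eqP tE : t == e'.2 by move: te'; rewrite !inE ev' (nv _ tc).
by move=> E; have := (hk _ ec).1 _ te; rewrite E tE => /negP; apply.
Qed.

(** * Classification of the snarks *)

Definition colour_index (c : colour) : nat := match c with cA => 0 | cB => 1 | cC => 2 end.

Lemma colour_index_inj : injective colour_index.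
Proof. by case=> [] []. Qed.

Lemma set2_inj (T : finType) (a b c d : T) :
  [set a; b] = [set c; d] -> (a = c /\ b = d) \/ (a = d /\ b = c).
Proof.
move=> E.
have : a \in [set c; d] by rewrite -E !inE eqxx.
have : b \in [set c; d] by rewrite -E !inE eqxx orbT.
have : c \in [set a; b] by rewrite E !inE eqxx.
have : d \in [set a; b] by rewrite E !inE eqxx orbT.
rewrite !inE => /orP[]/eqP-> /orP[]/eqP-> /orP[]/eqP ? /orP[]/eqP ?; subst; auto.
Qed.

Lemma exact_well_founded (G : sgraph) (env : lab -> G) cs :
  exact env cs -> well_founded_back cs.
Proof. by elim: cs => //= r cs IH [? ? ? /IH]. Qed.

(** * Copies of small subgraphs and when they are induced *)

Section Roots.
Variable G : sgraph.
Implicit Types (env : lab -> G) (cs : seq vrec).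

Definition realizes cs env : bool :=
  uniq [seq env a | a <- unzip1 cs] &&
  all (fun e => adj (env e.1) (env e.2)) (back_edges cs).

(** Finite functions make this a boolean, so that the roots can be excluded one after the other by
    case distinction. *)
Definition contains cs : bool :=
  [exists f : {ffun 'I_20 -> G}, realizes cs (fun l => f (inord (index l labels)))].

Lemma eq_realizes cs env env' : env =1 env' -> realizes cs env = realizes cs env'.
Proof.
move=> E; rewrite /realizes (eq_map E); congr (_ && _).
by apply: eq_all => e; rewrite !E.
Qed.

Lemma containsI cs env : realizes cs env -> contains cs.
Proof.
move=> h; apply/existsP; exists [ffun i : 'I_20 => env (nth L0 labels i)].
rewrite (@eq_realizes _ _ env) // => l; rewrite ffunE inordK.
  by rewrite nth_index // mem_labels.
by have := mem_labels l; rewrite -index_mem.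
Qed.

Lemma containsE cs : contains cs -> exists env, realizes cs env.
Proof. by case/existsP => f h; exists (fun l => f (inord (index l labels))). Qed.

(** [m] lists the images of [L0], [L1] and so on. Only labels are involved, so concrete instances
    are settled by evaluation. *)
Definition maps_into (es : seq (lab * lab)) (ls : seq lab) cs (m : seq lab) : bool :=
  let f a := nth L0 m (index a labels) in
  [&& uniq [seq f a | a <- unzip1 cs], all (mem ls) [seq f a | a <- unzip1 cs] &
    all (fun e => ((f e.1, f e.2) \in es) || ((f e.2, f e.1) \in es)) (back_edges cs)].

Lemma contains_sub env es ls cs m :
  {in ls &, injective env} -> all (fun e => adj (env e.1) (env e.2)) es ->
  maps_into es ls cs m -> contains cs.
Proof.
set f := fun a => nth L0 m (index a labels).
move=> inj /allP ae /and3P[u /allP sub /allP h]; apply: (@containsI _ (env \o f)).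
apply/andP; split.
  by rewrite (map_comp env f) map_inj_in_uniq // => a b ha hb; apply: inj; apply: sub.
apply/allP => e /h /orP[] /ae h'; first exact: h'.
by rewrite adj_sym; exact: h'.
Qed.

Lemma realizes_inj cs env : realizes cs env -> {in unzip1 cs &, injective env}.
Proof.
case/andP => u _ a b ac bc E.
have := index_uniq (env a) (i := index a (unzip1 cs)) (s := [seq env a | a <- unzip1 cs]).
rewrite size_map index_mem => /(_ ac u).
have := index_uniq (env a) (i := index b (unzip1 cs)) (s := [seq env a | a <- unzip1 cs]).
rewrite size_map index_mem => /(_ bc u).
rewrite !(nth_map a) ?index_mem // !nth_index // E => -> h.
by rewrite -(nth_index a ac) -(nth_index a bc) h.
Qed.

Hypothesis no3 : forall x y z : G, adj x y -> adj y z -> adj z x -> False.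
Hypothesis no4 : forall x y a b : G,
  adj x a -> adj x b -> adj y a -> adj y b -> a != b -> x = y.

(** An edge between such a pair would be a loop or close a triangle or a 4-cycle. *)
Definition near (t : seq vrec) (a b : lab) : bool :=
  [|| a == b, has (fun c => tadj t a c && tadj t c b) labels |
    has (fun c => has (fun d => [&& tadj t a c, tadj t c d, tadj t d b, c != b & a != d]) (unzip1 t)) (unzip1 t)].

Lemma near_nonadj cs env a b :
  {in unzip1 cs &, injective env} ->
  (forall c d, tadj cs c d -> adj (env c) (env d)) ->
  a \in unzip1 cs -> b \in unzip1 cs -> near cs a b -> ~~ adj (env a) (env b).
Proof.
move=> inj h ac bc; case/or3P => [/eqP->|/hasP[c _ /andP[/h h1 /h h2]]|].
- by rewrite adj_irrefl.
- by apply/negP => ab; apply: (no3 h1 h2); rewrite adj_sym.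
case/hasP => c cc /hasP[d dc /and5P[/h h1 /h h2 /h h3 cb ad]]; apply/negP => ab.
case/eqP: ad; apply: (inj a d ac dc); apply: (no4 h1 ab).
- by rewrite adj_sym.
- by [].
- by apply: contra cb => /eqP/(inj c b cc bc)->.
Qed.

Fixpoint exactb (t cs : seq vrec) : bool :=
  if cs is r :: post then
    [&& uniq r.2, all (mem (unzip1 post)) r.2,
      all (fun b => (b \in r.2) == tadj t r.1 b) (unzip1 post) & exactb t post]
  else true.

Definition root_ok (todo : seq lab) (D cs : seq vrec) : bool :=
  [&& uniq (unzip1 cs ++ todo), size cs + size todo == 20, exactb cs cs,
    uniq (unzip1 D),
    all (fun r => [&& r.1 \in unzip1 cs, uniq r.2, size r.2 < 3, all (mem (unzip1 cs)) r.2 &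
      all (fun b => (b \in r.2) == tadj cs r.1 b) (unzip1 cs)]) D &
    all (fun a => (a \in unzip1 D) || (count (tadj cs a) (unzip1 cs) == 3)) (unzip1 cs)].

Hypothesis cubic : regular 3 G.

Lemma root_inv env todo D cs :
  root_ok todo D cs -> {in unzip1 cs &, injective env} ->
  {in unzip1 cs &, forall a b, adj (env a) (env b) = tadj cs a b} ->
  inv env todo D cs.
Proof.
case/and5P => u /eqP sz ex uD /andP[/allP hD /allP hf] inj ha; split=> //.
- have ex' s : exactb cs s -> {subset unzip1 s <= unzip1 cs} -> exact env s.
    elim: s => //= r s IH /and4P[ur /allP sub /allP e es] ss; split=> //.
      by move=> b bs; rewrite ha ?(eqP (e _ bs)) //; apply: ss; rewrite inE ?eqxx ?bs ?orbT.
    by apply: IH => // a as_; apply: ss; rewrite inE as_ orbT.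
  exact: ex'.
- move=> r /hD /and5P[rc ur sr /allP sub /allP hr]; split=> // b.
  case bc: (b \in unzip1 cs) => /=; first by rewrite ha // (eqP (hr _ bc)).
  by apply/negP => /sub; rewrite inE bc.
- move=> a ac aD x ax; have := hf a ac; rewrite (negPf aD) /= => /eqP c3.
  have us : uniq [seq b <- unzip1 cs | tadj cs a b].
    by apply: filter_uniq; move: u; rewrite cat_uniq => /andP[].
  have sub : {subset [seq b <- unzip1 cs | tadj cs a b] <= unzip1 cs}.
    by move=> b; rewrite mem_filter => /andP[].
  have sz2 : 2 < size [seq b <- unzip1 cs | tadj cs a b] by rewrite size_filter c3.
  have hs b : b \in [seq b <- unzip1 cs | tadj cs a b] -> adj (env a) (env b).
    by rewrite mem_filter => /andP[ab bc]; rewrite ha.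
  have /mapP[b bs ->] := full_nbrs cubic inj sub us sz2 hs ax.
  by apply: map_f; apply: sub.
Qed.

(** Girth makes a copy of [cs] induced except possibly at the pairs of [ex], which need their own
    argument. *)
Definition nonedges_near (cs : seq vrec) (ex : seq (lab * lab)) : bool :=
  all (fun a => all (fun b => [|| tadj cs a b, near cs a b, (a, b) \in ex | (b, a) \in ex])
    (unzip1 cs)) (unzip1 cs).

Lemma realizes_adj cs env ex :
  uniq (unzip1 cs) -> all (mem (unzip1 cs)) (flatten (unzip2 cs)) ->
  realizes cs env -> nonedges_near cs ex ->
  (forall p, p \in ex -> ~~ adj (env p.1) (env p.2)) ->
  {in unzip1 cs &, forall a b, adj (env a) (env b) = tadj cs a b}.
Proof.
move=> u /allP sub rz /allP nn hex a b ac bc.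
have inj := realizes_inj rz.
have h c d : tadj cs c d -> adj (env c) (env d).
  case/andP: rz => _ /allP rz.
  have h1 c' d' : d' \in nbrs cs c' -> adj (env c') (env d').
    rewrite /nbrs => hd.
    have c'c : c' \in unzip1 cs.
      apply: contraLR hd => nc; rewrite (_ : look _ _ _ = [::]) //.
      move: nc; elim: (cs) => //= r s IH; rewrite inE negb_or => /andP[/negPf n1 n2].
      by change (lab_eqb c' r.1) with (c' == r.1); rewrite n1 IH.
    apply: (rz (c', d')); apply/allpairsPdep; exists (c', look [::] cs c'), d'.
    by split=> //; apply: look_in.
  by rewrite /tadj !lmemE => /orP[/h1 //|/h1]; rewrite adj_sym.
apply/idP/idP => [ab|]; last exact: h.
have /allP/(_ b bc)/or4P[//|nr|hx|hx] := nn a ac.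
- by case/negP: (near_nonadj inj h ac bc nr).
- by case/negP: (hex _ hx).
- by case/negP: (hex _ hx); rewrite /= adj_sym.
Qed.

End Roots.

Section Leaves.
Variable G : sgraph.
Hypothesis cubic : regular 3 G.
Hypothesis card20 : #|G| = 20.
Variables (env : lab -> G) (cs : seq vrec).
Hypothesis I : inv env [::] [::] cs.

Lemma leaf_colourable : colourable cs (unpainted cs) -> edge_colourable G 3.
Proof.
have ucs : uniq (unzip1 cs) by have := inv_uniq I; rewrite cats0.
have ul : unzip1 (unpainted cs) = unzip1 cs by rewrite /unzip1 -map_comp.
move=> /(colourable_sound ucs ul (exact_well_founded (inv_exact I)))[kap hk].
pose hit (e : {set G}) (p : lab * lab) := e == [set env p.1; env p.2].
(* The colours live on ordered pairs of labels; [code] recovers the back edge of an edge of [G], and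
   the default value is never reached on edges. *)
pose code e := nth (L0, L0) (back_edges cs) (find (hit e) (back_edges cs)).
have codeP e : e \in edges G -> code e \in back_edges cs /\ e = [set env (code e).1; env (code e).2].
  case/imsetP => -[x y]; rewrite inE /= => xy eE.
  have : has (hit e) (back_edges cs).
    have [a xE] := leaf_surj card20 I x; have [b yE] := leaf_surj card20 I y.
    have := xy; rewrite xE yE (leaf_adj I) /tadj !lmemE.
    have mem c d : d \in nbrs cs c -> (c, d) \in back_edges cs.
      move=> h; apply/allpairsPdep; exists (c, nbrs cs c), d; split=> //.
      exact/look_in/(leaf_labels I).
    case/orP => /mem h; apply/hasP; eexists; try exact: h.
      by rewrite /hit eE xE yE.
    by rewrite /hit eE xE yE setUC.
  move=> hs; split; first by rewrite mem_nth // -has_find.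
  by apply/eqP; apply: (nth_find (L0, L0) hs).
exists (fun e => colour_index (kap (code e))); split.
  by move=> e _; case: (kap _).
move=> e f eG fG ef /set0Pn[x]; rewrite inE => /andP[xe xf].
have [ce eE] := codeP e eG; have [cf fE] := codeP f fG.
have ne : code e != code f by apply: contraNneq ef => E; rewrite eE fE E.
have [t xE] := leaf_surj card20 I x.
have te : t \in ends (code e).
  have : env t \in [set env (code e).1; env (code e).2] by rewrite -eE -xE.
  by rewrite !inE !(inj_eq (leaf_inj I)).
have tf : t \in ends (code f).
  have : env t \in [set env (code f).1; env (code f).2] by rewrite -fE -xE.
  by rewrite !inE !(inj_eq (leaf_inj I)).
apply/eqP => /colour_index_inj; exact: ((hk _ ce).2 _ cf ne t te tf).
Qed.

Lemma leaf_isomorphic ts :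
  all (fun t => is_cubic t.1 && uniq (unzip1 t.1) && (size t.1 == 20)) ts ->
  isomorphic_to_one_of ts cs ->
  exists2 t, t \in unzip1 ts & exists2 phi : lab -> G, injective phi &
    forall a b, adj (phi a) (phi b) = tadj t a b.
Proof.
move=> hts h.
have ucs : uniq (unzip1 cs) by have := inv_uniq I; rewrite cats0.
have {h} [t tts [m]] : exists2 t, t \in ts & exists m, is_embedding (complete cs) t.1 m.
  move: h; rewrite /isomorphic_to_one_of; elim: ts {hts} => //= t ts IH.
  case: ifP => [h _|_ /IH[t' h1 h2]]; last by exists t'; rewrite // inE h1 orbT.
  exists t; rewrite ?mem_head //.
  exists (embed (complete cs) (profile (complete cs)) t.2 t.1 [::]); move: h.
  by case: (embed _ _ _ _ _).
have /andP[/andP[ct ut] st] := allP hts _ tts.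
rewrite /is_embedding; case: ifP => // um /allP hm.
exists t.1; first exact: map_f.
have minj : injective (look L0 m).
  move=> a b E; have := mem_labels a; have := mem_labels b.
  rewrite -!index_mem => ib ia.
  have := nth_uniq L0 _ _ um; rewrite size_map => /(_ _ _ ia ib).
  rewrite !(nth_map L0) // !nth_index ?mem_labels // E eqxx => /esym/eqP h.
  by rewrite -(nth_index L0 (mem_labels a)) -(nth_index L0 (mem_labels b)) h.
have tl a : a \in unzip1 t.1.
  have sub : {subset unzip1 t.1 <= labels} by move=> c _; apply: mem_labels.
  have [] := uniq_min_size ut sub _; last by move=> _ ->; apply: mem_labels.
  by rewrite size_map (eqP st).
exists (env \o look L0 m); first by move=> a b /(leaf_inj I)/minj.
apply: full_iso => //; first by move=> a b /(leaf_inj I)/minj.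
have h1 a b : b \in nbrs t.1 a -> adj (env (look L0 m a)) (env (look L0 m b)).
  move=> h; have /hm/allP/(_ b h) := look_in [::] (tl a).
  by rewrite lmemE nbrs_complete ?(leaf_labels I) // (leaf_adj I).
by move=> a b; rewrite /tadj !lmemE => /orP[/h1//|/h1]; rewrite adj_sym.
Qed.

End Leaves.

(** * Edge cuts of size three *)

Section Cut.
Variable G : sgraph.
Hypothesis cubic : regular 3 G.
Hypothesis conn : connected G.

(* An isolated vertex of the cut graph would carry all three cut edges, and
   the rest of its side would then be a union of components. *)
Lemma three_edge_cut (A : {set G}) :
  1 < #|A| -> 1 < #|~: A| ->
  #|[set p : G * G | [&& p.1 \in A, p.2 \notin A & adj p.1 p.2]]| = 3 ->
  exists S : {set {set G}},
    [/\ S \subset edges G, #|S| = 3, ~ connected (delete_edges S) &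
      forall C, C \in components (delete_edges S) ->
        nontrivial_component (G := delete_edges S) C].
Proof.
set P := [set _ | _] => A1 A2 P3.
pose S := [set [set p.1; p.2] | p : G * G in P].
have inP x y : x \in A -> y \notin A -> adj x y -> (x, y) \in P.
  by move=> xA yA xy; rewrite inE /= xA yA.
have PE p : p \in P -> [/\ p.1 \in A, p.2 \notin A & adj p.1 p.2].
  by rewrite inE => /and3P[].
have S3 : #|S| = 3.
  rewrite card_in_imset // => -[x y] [x' y'] /PE[/= xA yA _] /PE[/= xA' yA' _].
  case/set2_inj => [[-> ->] //|[E1 E2]]; rewrite E1 in xA.
  by rewrite xA in yA'.
have inS x y : [set x; y] \in S -> (x \in A) != (y \in A).
  case/imsetP => p /PE[pA pB _] /set2_inj[[-> ->]|[-> ->]]; by rewrite pA (negPf pB).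
have del x y : adj x y -> (x \in A) = (y \in A) -> adj (s := delete_edges S) x y.
  by move=> xy E; rewrite /= /delete_adj xy /=; apply/negP => /inS; rewrite E eqxx.
have clA : closed (@adj (delete_edges S)) (mem A).
  move=> x y /= /andP[xy]; case xA: (x \in A); case yA: (y \in A) => //.
    by case/negP; apply/imsetP; exists (x, y) => //; apply: inP; rewrite ?yA.
  by case/negP; apply/imsetP; exists (y, x); rewrite /= 1?setUC //; apply: inP; rewrite ?xA // adj_sym.
have [a aA] : exists a, a \in A by apply/set0Pn; rewrite -card_gt0 ltnW.
have [b bA] : exists b, b \notin A.
  have [b] : exists b, b \in ~: A by apply/set0Pn; rewrite -card_gt0 ltnW.
  by rewrite inE => bA; exists b.
exists S; split=> //.
- apply/subsetP => e /imsetP[p /PE[_ _ pp] ->]; apply/imsetP; exists p => //; rewrite inE; exact: pp.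
- by move=> h; have E : (a \in A) = (b \in A) := closed_connect clA (h a b); rewrite -E aA in bA.
move=> C CC.
have keep x : exists2 y, adj x y & (x \in A) = (y \in A).
  have [/exists_inP[y]|/negP none] := boolP [exists (y | adj x y), (x \in A) == (y \in A)].
    by move=> xy /eqP E; exists y.
  have all_cross y : adj x y -> (x \in A) != (y \in A).
    by move=> xy; apply/negP => E; apply: none; apply/exists_inP; exists y.
  pose N := [set y | adj x y].
  pose f y := if x \in A then (x, y) else (y, x).
  have fN : f @: N = P.
    apply/eqP; rewrite eqEcard P3 card_imset ?cubic ?leqnn ?andbT; last first.
      by move=> y y'; rewrite /f; case: ifP => _ [].
    apply/subsetP => _ /imsetP[y + ->]; rewrite !inE => xy.
    have := all_cross y xy; rewrite /f; case xA: (x \in A); case yA: (y \in A) => //= _.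
      by rewrite xA ?yA.
    by rewrite ?xA ?yA adj_sym.
  pose B := if x \in A then A else ~: A.
  have xB : x \in B by rewrite /B; case: ifP; rewrite ?inE // => ->.
  have cB : 1 < #|B| by rewrite /B; case: ifP.
  have [y yB yx] : exists2 y, y \in B & y != x.
    have : 0 < #|B :\ x| by move: cB; rewrite (cardsD1 x) xB.
    by case/card_gt0P => y; rewrite !inE => /andP[yx yB]; exists y.
  have cl : closed (@adj G) (mem (B :\ x)).
    have step u v : adj u v -> u \in B :\ x -> v \in B :\ x.
      rewrite !inE => uv /andP[ux uB].
      have sideU : (u \in A) = (x \in A).
        by move: uB; rewrite /B; case: (x \in A); rewrite ?inE // => /negPf.
      have vx : v != x.
        apply: contraNneq ux => vE; rewrite vE in uv.
        have := all_cross u; rewrite adj_sym uv sideU eqxx => /(_ isT).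
        by [].
      rewrite vx /=; apply/negPn/negP => vB.
      have sideV : (v \in A) = ~~ (x \in A).
        by move: vB; rewrite /B; case: (x \in A); rewrite ?inE ?negbK // => /negPf.
      have : (if x \in A then (u, v) else (v, u)) \in P.
        case xA: (x \in A); rewrite inE /= sideU sideV xA //=.
        by rewrite adj_sym.
      rewrite -fN => /imsetP[w _]; rewrite /f; case: ifP => _ [E1 E2].
        by rewrite E1 eqxx in ux.
      by rewrite E2 eqxx in ux.
    by move=> u v uv; apply/idP/idP; apply: step; rewrite // adj_sym.
  have E : (y \in B :\ x) = (x \in B :\ x) := closed_connect cl (conn y x).
  by move: E; rewrite !inE yx yB eqxx.
have eqr : {in [set: delete_edges S] & &, equivalence_rel (connect (@adj (delete_edges S)))}.
  have cs : connect_sym (@adj (delete_edges S)) by apply: sym_connect_sym; apply: adj_sym.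
  by move=> x y z _ _ _; split=> [|xy]; [apply: connect0 | apply: same_connect].
have := equivalence_partitionP eqr => /and3P[_ _ n0].
have [x xC] : exists x, x \in C.
  by apply/set0Pn; apply: contraNneq n0 => <-.
have [y xy sd] := keep x; have dxy := del x y xy sd.
exists [set x; y]; first by apply/imsetP; exists (x, y) => //; rewrite inE; exact: dxy.
have CE : C = [set z in [set: delete_edges S] | connect (@adj (delete_edges S)) x z].
  have := pblock_equivalence_partition eqr (x := x) (y := x) => _.
  case/imsetP: CC xC => w _ -> ; rewrite !inE => /= wx.
  have cs : connect_sym (@adj (delete_edges S)) by apply: sym_connect_sym; apply: adj_sym.
  by apply/setP => z; rewrite !inE /= (same_connect cs wx).
by rewrite CE; apply/subsetP => z; rewrite !inE => /orP[]/eqP->; rewrite ?connect0 // connect1.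
Qed.

End Cut.

Lemma girth5_no_triangle (G : sgraph) : girth_at_least 5 G ->
  forall x y z : G, adj x y -> adj y z -> adj z x -> False.
Proof.
move=> g x y z xy yz zx; have := g [:: x; y; z] isT.
have ne (u v : G) : adj u v -> u != v by apply: contraTneq => ->; rewrite adj_irrefl.
have uc : ucycle (@adj G) [:: x; y; z].
  apply/andP; rewrite /= !inE xy yz zx negb_or (ne _ _ xy) (ne _ _ yz).
  by rewrite eq_sym (ne _ _ zx).
by move/(_ uc).
Qed.

Lemma girth5_no_square (G : sgraph) : girth_at_least 5 G ->
  forall x y a b : G, adj x a -> adj x b -> adj y a -> adj y b -> a != b -> x = y.
Proof.
move=> g x y a b xa xb ya yb ab; apply/eqP/negPn/negP => xy.
have := g [:: x; a; y; b] isT.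
have ne (u v : G) : adj u v -> u != v by apply: contraTneq => ->; rewrite adj_irrefl.
have uc : ucycle (@adj G) [:: x; a; y; b].
  apply/andP; rewrite /= !inE xa yb (adj_sym a) ya (adj_sym b) xb; split=> //.
  by rewrite !negb_or (ne _ _ xa) xy (ne _ _ xb) ab (eq_sym a) (ne _ _ ya) (ne _ _ yb).
by move/(_ uc).
Qed.

Section Completeness.
Variable G : sgraph.
Hypothesis cubic : regular 3 G.
Hypothesis conn : connected G.
Hypothesis card20 : #|G| = 20.
Hypothesis no3 : forall x y z : G, adj x y -> adj y z -> adj z x -> False.
Hypothesis no4 : forall x y a b : G,
  adj x a -> adj x b -> adj y a -> adj y b -> a != b -> x = y.
Implicit Types (env : lab -> G) (cs D : seq vrec) (todo : seq lab).

(** The rule [ok] never rejects two open vertices that have a common unplaced neighbour in [G],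
    which is all that the soundness of the pruning requires. *)
Definition admits_all (ok : seq vrec -> vrec -> vrec -> bool) (R : seq lab) (env0 : lab -> G) :=
  forall env todo D cs r1 r2 x,
  inv env todo D cs -> {subset R <= unzip1 cs} -> {in R, env =1 env0} ->
  r1 \in D -> r2 \in D -> r1.1 != r2.1 -> x \notin labelled env cs ->
  adj x (env r1.1) -> adj x (env r2.1) -> ok cs r1 r2.

Section Extend.
Variables (env : lab -> G) (todo : seq lab) (D cs : seq vrec) (r1 r2 : vrec) (x : G).
Hypotheses (I : inv env todo D cs) (h1 : r1 \in D) (h2 : r2 \in D) (ne : r1.1 != r2.1).
Hypotheses (xL : x \notin labelled env cs) (x1 : adj x (env r1.1)) (x2 : adj x (env r2.1)).

Lemma back_adj r b : r \in D -> b \in r.2 -> b \in unzip1 cs /\ adj (env r.1) (env b).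
Proof. by move=> rD; have [_ _ _ ->] := inv_D I rD => /andP. Qed.

Lemma fresh_neq b : b \in unzip1 cs -> x != env b.
Proof. by move=> bc; apply: contraNneq xL => ->; apply: map_f. Qed.

Lemma env_ne : env r1.1 != env r2.1.
Proof.
apply: contra ne => /eqP E; apply/eqP; apply: (inv_inj I) => //.
  by have [] := inv_D I h1.
by have [] := inv_D I h2.
Qed.

Lemma fresh_ok_pair : ok_pair r1 r2.
Proof.
rewrite /ok_pair lmemE; case: ifP => [/(back_adj h1)[_ h]|_].
  by case: (no3 x1 h); rewrite adj_sym.
rewrite ldisjE; apply/hasPn => b b1; apply/negP => b2.
have [bc a1] := back_adj h1 b1; have [_ a2] := back_adj h2 b2.
have := fresh_neq bc; rewrite (no4 (y := env b) x1 x2 _ _ env_ne) ?eqxx //; by rewrite adj_sym.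
Qed.

Lemma fresh_ok_girth6 : ~~ contains G pentagon -> ok_girth6 cs r1 r2.
Proof.
move=> nc; rewrite /ok_girth6 fresh_ok_pair; apply/allP => a a1; apply/allP => b b2.
have [ac aa] := back_adj h1 a1; have [bc bb] := back_adj h2 b2.
apply: contra nc => lk.
have ab : adj (env a) (env b).
  by rewrite (exact_adj I) // -!lmemE; move: lk; rewrite /linked /nbrs; case: ifP.
pose s := [:: x; env r1.1; env a; env b; env r2.1].
have r1c : r1.1 \in unzip1 cs by have [] := inv_D I h1.
have r2c : r2.1 \in unzip1 cs by have [] := inv_D I h2.
have ne' (u v : G) : adj u v -> u != v by apply: contraTneq => ->; rewrite adj_irrefl.
have n1 : env r1.1 != env b.
  by apply/eqP => E; apply: (no3 x2 bb); rewrite -E adj_sym.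
have n2 : env a != env r2.1.
  by apply/eqP => E; apply: (no3 x1 aa); rewrite E adj_sym.
apply: (@containsI G pentagon (fun l => nth x s (index l labels))).
rewrite /realizes; apply/andP; split.
  have -> : [seq nth x s (index l labels) | l <- unzip1 pentagon] = rev s by [].
  rewrite rev_uniq /s [uniq _]/= !inE !negb_or.
  by rewrite !fresh_neq // n1 n2 (ne' _ _ aa) (ne' _ _ ab) env_ne (eq_sym (env b)) (ne' _ _ bb).
by rewrite /= adj_sym x2 bb (adj_sym (env b)) ab (adj_sym (env a)) aa (adj_sym (env r1.1)) x1.
Qed.

Lemma fresh_ok_girth7 : ~~ contains G pentagon -> ~~ contains G hexagon_root -> ok_girth7 cs r1 r2.
Proof.
move=> nc5 nc; rewrite /ok_girth7 fresh_ok_girth6 //; apply/allP => a a1; apply/allP => b b2.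
rewrite ldisjE; apply/hasPn => c c1; apply/negP => c2.
have [ac aa] := back_adj h1 a1; have [bc bb] := back_adj h2 b2.
have ucs : uniq (unzip1 cs) by have := inv_uniq I; rewrite cat_uniq => /andP[].
have hc d : d \in unzip1 cs -> c \in nbrs (complete cs) d -> c \in unzip1 cs /\ adj (env d) (env c).
  move=> dc h.
  have cc : c \in unzip1 cs.
    move: h; rewrite /nbrs; have := look_in [::] (m := complete cs) (a := d).
    have -> : unzip1 (complete cs) = unzip1 cs by rewrite /unzip1 -map_comp.
    move=> /(_ dc); move: (look _ _ _) => nb /mapP[r rcs [dE ->]].
    rewrite mem_cat => /orP[cr|/mapP[y]].
      have := inv_exact I; move: rcs cr; elim: (cs) => //= r' s IH.
      rewrite inE => /orP[/eqP<-|rs] cr [_ sub _ ex]; first by rewrite inE sub ?orbT.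
      by rewrite inE IH ?orbT.
    by rewrite mem_filter => /andP[_ ycs] ->; apply: map_f.
  split=> //; move: h; rewrite nbrs_complete // /tadj !lmemE.
  by rewrite (exact_adj I).
have [cc ca] := hc a ac c1; have [_ cb] := hc b bc c2.
case/negP: nc.
pose s := [:: x; env r1.1; env a; env c; env b; env r2.1].
have r1c : r1.1 \in unzip1 cs by have [] := inv_D I h1.
have r2c : r2.1 \in unzip1 cs by have [] := inv_D I h2.
have ne' (u v : G) : adj u v -> u != v by apply: contraTneq => ->; rewrite adj_irrefl.
have n1 : env r1.1 != env b.
  by apply/eqP => E; apply: (no3 x2 bb); rewrite -E adj_sym.
have n2 : env a != env r2.1.
  by apply/eqP => E; apply: (no3 x1 aa); rewrite E adj_sym.
have n3 : env a != env b.
  have := fresh_ok_pair; rewrite /ok_pair; case: ifP => // _; rewrite ldisjE => /hasPn/(_ a a1).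
  by apply: contra => /eqP/(inv_inj I ac bc)->.
have n4 : env r1.1 != env c.
  apply/eqP => E; have := fresh_neq bc.
  rewrite (no4 x1 x2 (y := env b)) ?eqxx ?env_ne //; last by rewrite adj_sym.
  by rewrite E.
have n5 : env c != env r2.1.
  apply/eqP => E; have := fresh_neq ac.
  rewrite (no4 x1 x2 (y := env a)) ?eqxx ?env_ne //; first by rewrite adj_sym.
  by rewrite -E.
apply: (@containsI G hexagon_root (fun l => nth x s (index l labels))).
rewrite /realizes; apply/andP; split.
  have -> : [seq nth x s (index l labels) | l <- unzip1 hexagon_root] = rev s by [].
  rewrite rev_uniq /s [uniq _]/= !inE !negb_or.
  rewrite !fresh_neq // n1 n2 n3 n4 n5 (ne' _ _ aa) (ne' _ _ ca) env_ne.
  by rewrite (eq_sym (env b)) (ne' _ _ bb) (eq_sym (env c)) (ne' _ _ cb).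
rewrite /= adj_sym x2 bb cb (adj_sym (env c)) ca (adj_sym (env a)) aa.
by rewrite (adj_sym (env r1.1)) x1.
Qed.

End Extend.

Lemma girth5_admits R env0 : admits_all ok_girth5 R env0.
Proof. by move=> env todo D cs r1 r2 x I _ _ h1 h2 ne xL x1 x2; apply: (fresh_ok_pair I h1 h2 ne xL). Qed.

Lemma girth6_admits R env0 : ~~ contains G pentagon -> admits_all ok_girth6 R env0.
Proof.
by move=> nc env todo D cs r1 r2 x I _ _ h1 h2 ne xL x1 x2; apply: (fresh_ok_girth6 I h1 h2 ne xL).
Qed.

Lemma girth7_admits R env0 : ~~ contains G pentagon -> ~~ contains G hexagon_root -> admits_all ok_girth7 R env0.
Proof.
by move=> n5 n6 env todo D cs r1 r2 x I _ _ h1 h2 ne xL x1 x2; apply: (fresh_ok_girth7 I h1 h2 ne xL).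
Qed.

Lemma forbidding_admits F R env0 :
  all (fun p => (p.1 \in R) && (p.2 \in R)) F ->
  (forall p x, p \in F -> x \notin [seq env0 a | a <- R] ->
    adj x (env0 p.1) -> adj x (env0 p.2) -> False) ->
  admits_all (ok_forbidding F) R env0.
Proof.
move=> /allP FR hF env todo D cs r1 r2 x I RS Re h1 h2 ne xL x1 x2.
rewrite /ok_forbidding (fresh_ok_pair I h1 h2 ne xL) //; apply/negP => /hasP[p pF].
have xR : x \notin [seq env0 a | a <- R].
  apply: contra xL => /mapP[a aR ->]; rewrite -Re //; apply: map_f; exact: RS.
have /andP[p1 p2] := FR p pF.
case/orP => /andP[/lab_eqP e1 /lab_eqP e2]; apply: (hF p x pF xR); by rewrite -Re // -?e1 -?e2.
Qed.

(** [L19] names the new vertex; the roots do not use this label. *)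
Definition extended_edges cs (p : lab * lab) : seq (lab * lab) :=
  [:: (L19, p.1), (L19, p.2) & back_edges cs].

Lemma contains_extended cs cs' env x (p : lab * lab) m :
  realizes cs env -> all (fun e => (e.1 != L19) && (e.2 != L19)) ((p.1, p.2) :: back_edges cs) ->
  L19 \notin unzip1 cs -> x \notin [seq env a | a <- unzip1 cs] ->
  adj x (env p.1) -> adj x (env p.2) ->
  maps_into (extended_edges cs p) (L19 :: unzip1 cs) cs' m -> contains G cs'.
Proof.
move=> rz /= /andP[/andP[p1 p2] /allP he] l19 xn x1 x2.
pose env' l := if l == L19 then x else env l.
have envE l : l != L19 -> env' l = env l by rewrite /env' => /negPf->.
apply: (@contains_sub _ env').
  have key l : l \in unzip1 cs -> env' l = env l.
    by move=> lc; apply: envE; apply: contraNneq l19 => <-.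
  have nx l : l \in unzip1 cs -> x <> env l.
    by move=> lc xE; case/negP: xn; rewrite xE; apply: map_f.
  have e19 : env' L19 = x by rewrite /env' eqxx.
  move=> a b; rewrite !inE => /orP[/eqP->|ac] /orP[/eqP->|bc] //.
  - by rewrite e19 key // => /(nx _ bc).
  - by rewrite e19 key // => /esym/(nx _ ac).
  - by rewrite !key //; apply: (realizes_inj rz).
have e19 : env' L19 = x by rewrite /env' eqxx.
rewrite /= e19 !envE // x1 x2 /=; apply/allP => e ein.
by have /andP[n1 n2] := he e ein; rewrite !envE //; case/andP: rz => _ /allP; apply.
Qed.

Lemma root_search ok todo D cs ex env :
  admits_all ok (unzip1 cs) env -> realizes cs env -> 0 < size cs ->
  uniq (unzip1 cs) -> all (mem (unzip1 cs)) (flatten (unzip2 cs)) ->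
  root_ok todo D cs -> nonedges_near cs ex ->
  (forall p, p \in ex -> ~~ adj (env p.1) (env p.2)) ->
  search ok (leaf targets) todo D cs ->
  exists env' cs', inv (G := G) env' [::] [::] cs' /\ leaf targets cs'.
Proof.
move=> adm rz s0 u sub rk nn hex sr.
have ha := realizes_adj no3 no4 u sub rz nn hex.
have I := root_inv cubic rk (realizes_inj rz) ha.
have [env' [cs' [I' _ lf]]] :=
  search_sound cubic conn card20 no3 no4 adm s0 I (fun a h => h) (fun a _ => erefl) sr.
by exists env', cs'.
Qed.

End Completeness.

(** * The five exhaustive searches *)

Lemma theta_search : search ok_girth5 (leaf targets) (drop 7 labels) theta_open theta_root.
Proof. by vm_compute. Qed.

Lemma edge_search : search (ok_forbidding edge_forbidden) (leaf targets) (drop 8 labels) edge_open edge_root.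
Proof. by vm_compute. Qed.

Lemma pendant_search : search (ok_forbidding pendant_forbidden) (leaf targets) (drop 10 labels) pendant_open pendant_root.
Proof. by vm_compute. Qed.

Lemma hexagon_search : search ok_girth6 (leaf targets) (drop 6 labels) hexagon_open hexagon_root.
Proof. by vm_compute. Qed.

Lemma claw_search : search ok_girth7 (leaf targets) (drop 4 labels) claw_open claw_root.
Proof. by vm_compute. Qed.

Section Classification.
Variable G : sgraph.
Hypothesis cubic : regular 3 G.
Hypothesis conn : connected G.
Hypothesis card20 : #|G| = 20.
Hypothesis no3 : forall x y z : G, adj x y -> adj y z -> adj z x -> False.
Hypothesis no4 : forall x y a b : G,
  adj x a -> adj x b -> adj y a -> adj y b -> a != b -> x = y.

Let reached := exists (env : lab -> G) cs, inv env [::] [::] cs /\ leaf targets cs.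

Lemma reached_from_theta : contains G theta_root -> reached.
Proof.
case/containsE => env rz.
apply: (root_search (ex := [::]) cubic conn card20 no3 no4 _ rz _ _ _ _ _ _ theta_search);
  try by vm_compute.
exact: (girth5_admits no3 no4).
Qed.

Lemma reached_from_edge : ~~ contains G theta_root -> contains G edge_root -> reached.
Proof.
move=> /negP nA /containsE[env rz].
(* [L3] and [L6], opposite to the shared edge, are the only non-adjacent pair not settled by
   girth. *)
apply: (root_search (ex := [:: (L3, L6)]) cubic conn card20 no3 no4 _ rz _ _ _ _ _ _ edge_search);
  try by vm_compute.
  apply: (forbidding_admits no3 no4) => [|p x pF xR x1 x2]; first by vm_compute.
  suff [m hm] : exists m, maps_into (extended_edges edge_root p) (L19 :: unzip1 edge_root) theta_root m.
    apply: nA; apply: (contains_extended rz _ _ xR x1 x2 hm); last by vm_compute.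
    have h : all (fun p => all (fun e => (e.1 != L19) && (e.2 != L19)) ((p.1, p.2) :: back_edges edge_root)) edge_forbidden.
      by vm_compute.
    exact: (allP h p pF).
  (* In each list the pentagon through the new vertex [L19] shares a path of length two with one of
     the two given pentagons. *)
  have h : all (fun p => has (maps_into (extended_edges edge_root p) (L19 :: unzip1 edge_root) theta_root)
    [:: [:: L4; L1; L0; L3; L2; L19; L5]; [:: L2; L0; L1; L3; L4; L19; L7];
        [:: L3; L4; L1; L2; L0; L19; L7]; [:: L3; L2; L0; L4; L1; L19; L5];
        [:: L1; L7; L6; L0; L5; L4; L19]; [:: L0; L5; L6; L1; L7; L2; L19]]) edge_forbidden by vm_compute.
  by have /hasP[m _ hm] := allP h p pF; exists m.
move=> p; rewrite inE => /eqP->; apply/negP => h; apply: nA.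
have ae : all (fun e => adj (env e.1) (env e.2)) ((L3, L6) :: back_edges edge_root).
  by apply/andP; split=> //; case/andP: rz.
(* With the edge 3-6 the three paths are 3-2-0, 3-4-1-0 and 3-6-5-0. *)
apply: (contains_sub (realizes_inj rz) ae (m := [:: L3; L2; L0; L4; L1; L6; L5])).
by vm_compute.
Qed.

Lemma reached_from_pendant : ~~ contains G theta_root -> ~~ contains G edge_root -> contains G pendant_root -> reached.
Proof.
move=> /negP nA /negP nB /containsE[env rz].
(* Pendant vertices over cycle vertices at distance two: an edge between them closes a pentagon that
   shares a path of length two with the given one. *)
pose ex := [:: (L5, L7); (L6, L8); (L7, L9); (L8, L5); (L9, L6)].
apply: (root_search (ex := ex) cubic conn card20 no3 no4 _ rz _ _ _ _ _ _ pendant_search);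
  try by vm_compute.
  apply: (forbidding_admits no3 no4) => [|p x pF xR x1 x2]; first by vm_compute.
  suff [m hm] : exists m, maps_into (extended_edges pendant_root p) (L19 :: unzip1 pendant_root) edge_root m.
    apply: nB; apply: (contains_extended rz _ _ xR x1 x2 hm); last by vm_compute.
    have h : all (fun p => all (fun e => (e.1 != L19) && (e.2 != L19)) ((p.1, p.2) :: back_edges pendant_root)) pendant_forbidden.
      by vm_compute.
    exact: (allP h p pF).
  (* A common new neighbour of consecutive pendant vertices closes a pentagon that shares one edge
     with the given one. *)
  have h : all (fun p => has (maps_into (extended_edges pendant_root p) (L19 :: unzip1 pendant_root) edge_root)
    [:: [:: L0; L1; L4; L3; L2; L5; L19; L6]; [:: L1; L2; L0; L4; L3; L6; L19; L7];
        [:: L2; L3; L1; L0; L4; L7; L19; L8]; [:: L3; L4; L2; L1; L0; L8; L19; L9];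
        [:: L4; L0; L3; L2; L1; L9; L19; L5]]) pendant_forbidden by vm_compute.
  by have /hasP[m _ hm] := allP h p pF; exists m.
move=> p pex; apply/negP => h; apply: nA.
have ae : all (fun e => adj (env e.1) (env e.2)) (p :: back_edges pendant_root).
  by apply/andP; split=> //; case/andP: rz.
suff [m hm] : exists m, maps_into (p :: back_edges pendant_root) (unzip1 pendant_root) theta_root m.
  exact: (contains_sub (realizes_inj rz) ae hm).
have hx : all (fun p => has (maps_into (p :: back_edges pendant_root) (unzip1 pendant_root) theta_root)
  [:: [:: L0; L1; L2; L4; L3; L5; L7]; [:: L1; L2; L3; L0; L4; L6; L8];
      [:: L2; L3; L4; L1; L0; L7; L9]; [:: L3; L4; L0; L2; L1; L8; L5];
      [:: L4; L0; L1; L3; L2; L9; L6]]) ex by vm_compute.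
by have /hasP[m _ hm] := allP hx p pex; exists m.
Qed.

Lemma reached_from_hexagon : ~~ contains G pentagon -> contains G hexagon_root -> reached.
Proof.
move=> n5 /containsE[env rz].
apply: (root_search (ex := [::]) cubic conn card20 no3 no4 _ rz _ _ _ _ _ _ hexagon_search);
  try by vm_compute.
exact: (girth6_admits no3 no4).
Qed.

Lemma third_neighbour (v : G) (P : seq G) : size P < 3 -> exists2 t, adj v t & t \notin P.
Proof.
move=> s2; have : ~~ ([set y | adj v y] \subset P).
  apply/negP => /subset_leq_card; rewrite cubic => h.
  by have := leq_trans h (card_size P); lia.
by case/subsetPn => t; rewrite inE => vt tP; exists t.
Qed.

(** By the Moore bound a cubic graph of girth at least 7 has at least 1 + 3 + 6 + 12 = 22 vertices,
    so this case is empty; the search takes the place of the bound. *)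
Lemma reached_from_claw : ~~ contains G pentagon -> ~~ contains G hexagon_root -> reached.
Proof.
move=> n5 n6.
have [v _] : exists v : G, v \in G by apply/card_gt0P; rewrite card20.
have [a va _] := third_neighbour v (P := [::]) isT.
have [b vb] := third_neighbour v (P := [:: a]) isT; rewrite inE => ba.
have [c vc] := third_neighbour v (P := [:: a; b]) isT; rewrite !inE negb_or => /andP[ca cb].
have ne (u w : G) : adj u w -> u != w by apply: contraTneq => ->; rewrite adj_irrefl.
have rz : realizes claw_root (fun l => nth v [:: v; a; b; c] (index l labels)).
  rewrite /realizes; apply/andP; split.
    rewrite [uniq _]/= !inE !negb_or ca cb ba /=.
    by rewrite !(eq_sym _ v) !ne.
  by rewrite /= !(adj_sym _ v) va vb vc.
apply: (root_search (ex := [::]) cubic conn card20 no3 no4 _ rz _ _ _ _ _ _ claw_search);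
  try by vm_compute.
exact: (girth7_admits no3 no4).
Qed.

Definition cyc5 (i j : nat) : bool := (j == i.+1 %% 5) || (i == j.+1 %% 5).

Lemma cyc5_dist i j : i < 5 -> j < 5 -> i != j ->
  cyc5 i j \/ exists2 k, k < 5 & cyc5 i k && cyc5 k j.
Proof.
move=> i5 j5 ij.
have h : all (fun i => all (fun j => [|| i == j, cyc5 i j | has (fun k => cyc5 i k && cyc5 k j) (iota 0 5)])
  (iota 0 5)) (iota 0 5) by vm_compute.
have := allP h i; rewrite mem_iota => /(_ i5)/allP/(_ j); rewrite mem_iota => /(_ j5).
rewrite (negPf ij) => /orP[//|/orP[->|/hasP[k]]]; first by left.
by rewrite mem_iota => /= k5 hk; right; exists k.
Qed.

(** Two vertices of a 5-cycle have distance at most two, so if two third neighbours coincided, or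
    one of them lay on the cycle, a triangle or a 4-cycle would arise. *)
Lemma pendant_pentagon : contains G pentagon -> contains G pendant_root.
Proof.
case/containsE => env rz; pose c i := env (nth L0 labels i).
have cinj i j : i < 5 -> j < 5 -> c i = c j -> i = j.
  move=> i5 j5 E; have u : uniq (take 5 labels) by [].
  have mm k : k < 5 -> nth L0 labels k \in unzip1 pentagon.
    by case: k => [|[|[|[|[|]]]]].
  have := realizes_inj rz (mm i i5) (mm j j5) E => /eqP.
  rewrite nth_uniq //; first by move/eqP.
    by apply: ltn_trans i5 _.
  by apply: ltn_trans j5 _.
have cadj i j : i < 5 -> j < 5 -> cyc5 i j -> adj (c i) (c j).
  move: rz => /andP[_ /allP rz] i5 j5.
  have h k : k < 5 -> adj (c k) (c (k.+1 %% 5)).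
    move=> k5; have : ((nth L0 labels k, nth L0 labels (k.+1 %% 5)) \in back_edges pentagon) ||
      ((nth L0 labels (k.+1 %% 5), nth L0 labels k) \in back_edges pentagon).
      by case: k k5 => [|[|[|[|[|]]]]].
    by case/orP => /rz //=; rewrite adj_sym.
  by case/orP => /eqP->; rewrite ?h // adj_sym h.
(* The neighbours of [c i] on the cycle are at positions [i + 1] and [i - 1], the latter written
   [i + 4] modulo 5. *)
have /fin_all_exists[t ht] : forall i : 'I_5, exists t,
    adj (c i) t /\ t \notin [:: c (i.+1 %% 5); c ((i + 4) %% 5)].
  by move=> i; have [t h1 h2] := third_neighbour (c i) (P := [:: c (i.+1 %% 5); c ((i + 4) %% 5)]) isT; exists t.
pose T i := t (inord i).
have Tadj i : i < 5 -> adj (c i) (T i).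
  by move=> i5; have [] := ht (inord i); rewrite inordK.
have Tne i j : i < 5 -> j < 5 -> cyc5 i j -> T i != c j.
  move=> i5 j5 ij; have [_] := ht (inord i); rewrite inordK // !inE negb_or => /andP[h1 h2].
  case/orP: ij => /eqP E; first by rewrite E.
  have -> : j = (i + 4) %% 5; last by [].
  by rewrite E -modnDml; case: j j5 {E} => [|[|[|[|[|]]]]].
have Tc i j : i < 5 -> j < 5 -> T i != c j.
  move=> i5 j5; have [<-|ij] := eqVneq i j.
    by apply: contraTneq (Tadj i i5) => ->; rewrite adj_irrefl.
  have [h|[k k5 /andP[ik kj]]] := cyc5_dist i5 j5 ij; first exact: Tne.
  apply/eqP => E; apply: (no3 (cadj _ _ i5 k5 ik) (cadj _ _ k5 j5 kj)).
  by rewrite -E adj_sym; apply: Tadj.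
have Tinj i j : i < 5 -> j < 5 -> T i = T j -> i = j.
  move=> i5 j5 E; apply/eqP/negPn/negP => ij.
  have [h|[k k5 /andP[ik kj]]] := cyc5_dist i5 j5 ij.
    apply: (no3 (cadj _ _ i5 j5 h) (Tadj j j5)); rewrite -E adj_sym; exact: Tadj.
  have ti := Tadj i i5; have tj := Tadj j j5; rewrite -E in tj.
  have n : c i != c j by apply: contra ij => /eqP/(cinj _ _ i5 j5)->.
  have := Tc i k i5 k5.
  rewrite (no4 (x := T i) (y := c k) _ _ _ _ n) ?eqxx //; try by rewrite adj_sym.
    by rewrite adj_sym; apply: cadj.
  exact: cadj.
pose env' l := if index l labels < 5 then env l else T (index l labels - 5).
apply: (@containsI G pendant_root env'); apply/andP; split.
  have -> : [seq env' a | a <- unzip1 pendant_root] =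
    [seq T i | i <- [:: 4; 3; 2; 1; 0]] ++ [seq c i | i <- [:: 4; 3; 2; 1; 0]] by [].
  have lt5 i : i \in [:: 4; 3; 2; 1; 0] -> i < 5.
    by rewrite !inE => /orP[/eqP->|/orP[/eqP->|/orP[/eqP->|/orP[]/eqP->]]].
  rewrite cat_uniq !map_inj_in_uniq.
  - rewrite [uniq _]/= andbT andTb; apply/hasPn => _ /mapP[j /lt5 j5 ->]; apply/negP => /mapP[i /lt5 i5].
    by move=> E; have := Tc i j i5 j5; rewrite E eqxx.
  - by move=> i j /lt5 i5 /lt5 j5; apply: cinj.
  - by move=> i j /lt5 i5 /lt5 j5; apply: Tinj.
have sz : size labels = 20 by [].
have eT i : i < 5 -> env' (nth L0 labels (i + 5)) = T i.
  by move=> i5; rewrite /env' index_uniq ?ifN ?addnK //; rewrite ?sz; lia.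
have ec i : i < 5 -> env' (nth L0 labels i) = c i.
  by move=> i5; rewrite /env' index_uniq ?i5 //; rewrite ?sz; lia.
have h : all (fun e => has (fun i => e == (nth L0 labels (i + 5), nth L0 labels i)) (iota 0 5) ||
    has (fun i => has (fun j => cyc5 i j && (e == (nth L0 labels i, nth L0 labels j))) (iota 0 5))
      (iota 0 5)) (back_edges pendant_root) by vm_compute.
apply/allP => e /(allP h)/orP[/hasP[i]|/hasP[i]].
  by rewrite mem_iota => i5 /eqP->; rewrite [_.1]/= [_.2]/= eT // ec // adj_sym Tadj.
rewrite mem_iota => i5 /hasP[j]; rewrite mem_iota => j5 /andP[ij /eqP->].
by rewrite [_.1]/= [_.2]/= !ec // cadj.
Qed.

Lemma labelling_reached : reached.
Proof.
have [/reached_from_theta//|nA] := boolP (contains G theta_root).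
have [/(reached_from_edge nA)//|nB] := boolP (contains G edge_root).
have [/pendant_pentagon/(reached_from_pendant nA nB)//|n5] := boolP (contains G pentagon).
have [/(reached_from_hexagon n5)//|n6] := boolP (contains G hexagon_root).
exact: reached_from_claw.
Qed.

Lemma cut_image (phi : lab -> G) t U :
  injective phi -> (forall a b, adj (phi a) (phi b) = tadj t a b) -> is_cut t U ->
  exists S : {set {set G}},
    [/\ S \subset edges G, #|S| = 3, ~ connected (delete_edges S) &
      forall C, C \in components (delete_edges S) ->
        nontrivial_component (G := delete_edges S) C].
Proof.
move=> inj hp /and4P[uU sU1 sU2 /eqP ct].
have surj x : exists a, x = phi a.
  have u : uniq [seq phi a | a <- labels] by rewrite map_inj_uniq.
  have sub : {subset [seq phi a | a <- labels] <= enum G} by move=> y _; rewrite mem_enum.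
  have [] := uniq_min_size u sub _; first by rewrite -cardE card20.
  by move=> _ /(_ x); rewrite mem_enum => /mapP[a _ ->]; exists a.
pose A := [set x | x \in [seq phi a | a <- U]].
have AE a : (phi a \in A) = (a \in U) by rewrite inE mem_map.
have cA : #|A| = size U.
  by rewrite cardsE (card_uniqP _) ?size_map // map_inj_uniq.
apply: (@three_edge_cut G cubic conn A).
- by rewrite cA.
- by have := cardsC A; rewrite cA card20; lia.
pose f (p : lab * lab) := (phi p.1, phi p.2).
pose q (p : lab * lab) := [&& lmem p.1 U, ~~ lmem p.2 U & tadj t p.1 p.2].
have [s [us hs cs]] : exists s, [/\ uniq s, forall a b, (a, b) \in s & count q s = 3].
  exists [seq (a, b) | a <- labels, b <- labels] => //; split=> // a b.
  by apply/allpairsP; exists (a, b); rewrite !mem_labels.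
have finj : injective f by move=> [a b] [a' b'] [/inj-> /inj->].
rewrite -cs -size_filter -(size_map f) -(card_uniqP _); last first.
  by rewrite map_inj_uniq // filter_uniq.
apply: eq_card => -[x y]; rewrite inE.
have [a ->] := surj x; have [b ->] := surj y.
rewrite -[(phi a, phi b)]/(f (a, b)) mem_map // mem_filter hs andbT.
by rewrite /q /f ![_.1]/= ![_.2]/= !AE hp !lmemE.
Qed.

End Classification.

Theorem nontrivial_snark20 (G : sgraph) : nontrivial_snark G -> #|G| = 20 ->
  exists2 t, t \in snarks & exists2 phi : lab -> G, injective phi &
    forall a b, adj (phi a) (phi b) = tadj t a b.
Proof.
case=> -[conn _ cubic [_ chi]] /[dup] /girth5_no_triangle no3 /girth5_no_square no4 nocut card20.
have [env [cs [I]]] := labelling_reached cubic conn card20 no3 no4.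
rewrite /leaf; case: ifP => [/(leaf_colourable card20 I)/chi //|_].
move=> /(leaf_isomorphic cubic I)[|t]; first by vm_compute.
rewrite (_ : unzip1 targets = snarks ++ unzip1 three_cut_graphs); last by vm_compute.
rewrite mem_cat => /orP[tin [phi inj hp]|/mapP[tU tin -> [phi inj hp]]].
  by exists t => //; exists phi.
case: nocut; apply: (cut_image cubic conn card20 inj hp (U := tU.2)).
have h : all (fun tU => is_cut tU.1 tU.2) three_cut_graphs by vm_compute.
exact: (allP h).
Qed.

(** * Covers and cyclic development *)

Section Covers.
Variable es : seq (nat * nat).

Section Def.
Variable T : eqType.
Implicit Types (x y : T) (b : seq T) (V : pred T) (H : T -> T -> Prop).

Definition joined b x y : bool :=
  has (fun e => ((onth b e.1 == Some x) && (onth b e.2 == Some y)) ||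
                ((onth b e.2 == Some x) && (onth b e.1 == Some y))) es.

Lemma joined_sym b x y : joined b x y = joined b y x.
Proof. by apply: eq_has => e; rewrite orbC andbC [X in _ || X]andbC. Qed.

(** A block lists the images of the 20 vertices of the graph, whose edges are the position pairs in
    [es]. Covering and the number of blocks are all that is tracked; how often a pair is covered is
    left open. *)
Definition covers V H (m : nat) : Prop :=
  exists B : seq (seq T),
    [/\ size B = m, {in B, forall b, [/\ size b = 20, uniq b & all V b]} &
      forall x y, H x y -> exists2 b, b \in B & joined b x y].

Lemma covers0 V H : (forall x y, ~ H x y) -> covers V H 0.
Proof. by move=> h; exists [::]; split=> // x y /h. Qed.

Lemma eq_covers V (H H' : T -> T -> Prop) m m' :
  m = m' -> (forall x y, H' x y -> H x y) -> covers V H m -> covers V H' m'.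
Proof. by move=> <- h [B [? ? c]]; exists B; split=> // x y /h/c. Qed.

Lemma covers_union V (H1 H2 : T -> T -> Prop) m1 m2 :
  covers V H1 m1 -> covers V H2 m2 -> covers V (fun x y => H1 x y \/ H2 x y) (m1 + m2).
Proof.
move=> [B1 [<- g1 c1]] [B2 [<- g2 c2]]; exists (B1 ++ B2); split; first by rewrite size_cat.
  by move=> b; rewrite mem_cat => /orP[/g1|/g2].
by move=> x y [/c1|/c2] [b bB j]; exists b; rewrite // mem_cat bB ?orbT.
Qed.

Lemma covers_seq (I : eqType) (s : seq I) V (H : I -> T -> T -> Prop) (m : I -> nat) :
  (forall i, i \in s -> covers V (H i) (m i)) ->
  covers V (fun x y => exists2 i, i \in s & H i x y) (\sum_(i <- s) m i).
Proof.
elim: s => [|i s IH] h; first by rewrite big_nil; apply: covers0 => x y [].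
rewrite big_cons.
have h1 := h i (mem_head i s).
have h2 : covers V (fun x y => exists2 j, j \in s & H j x y) (\sum_(j <- s) m j).
  by apply: IH => j js; apply: h; rewrite inE js orbT.
apply: eq_covers (covers_union h1 h2) => // x y [j]; rewrite inE => /orP[/eqP->|js] hj.
  by left.
by right; exists j.
Qed.

End Def.

Lemma covers_map (T T' : eqType) (g : T -> T') (V : pred T) (V' : pred T')
    (H : T -> T -> Prop) (H' : T' -> T' -> Prop) m :
  {in V &, injective g} -> (forall x, V x -> V' (g x)) ->
  (forall x' y', H' x' y' -> exists x y, [/\ g x = x', g y = y' & H x y \/ H y x]) ->
  covers V H m -> covers V' H' m.
Proof.
move=> inj gV gH [B [sB gB cB]]; exists (map (map g) B); split; first by rewrite size_map.
  move=> _ /mapP[b /gB[sb ub /allP Vb] ->]; split; first by rewrite size_map.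
    by rewrite map_inj_in_uniq // => x y /Vb xV /Vb yV; apply: inj.
  by apply/allP => _ /mapP[x /Vb xV ->]; apply: gV.
move=> x' y' /gH[x [y [<- <- hxy]]].
have [b bB hj] : exists2 b, b \in B & joined b x y.
  by case: hxy => /cB[b bB hj]; exists b => //; rewrite joined_sym.
exists (map g b); first exact: map_f.
case/hasP: hj => e ein he; apply/hasP; exists e => //; rewrite !onth_map.
by case/orP: he => /andP[/eqP-> /eqP->]; rewrite !eqxx ?orbT.
Qed.

(** * Base blocks developed under a cyclic group *)

Section Develop.
Variables (N f : nat) (lens : seq nat) (allow : nat -> nat -> nat -> bool).

Definition orbit_length j := nth 0 lens j.

Definition decode (p : BinNums.N) : nat * nat := edivn p N.

Definition valid_point (p : nat * nat) : bool := p.2 < orbit_length p.1.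

(** The mixed differences from orbit [j] to orbit [k], each edge being read in both directions. They
    are taken modulo the length of the second orbit, which divides [N]. *)
Definition codes_between (j k : nat) (b : seq (nat * nat)) : seq nat :=
  flatten [seq let p := nth (0, 0) b e.1 in let q := nth (0, 0) b e.2 in
    (if (p.1 == j) && (q.1 == k) then [:: (q.2 + (N - p.2)) %% orbit_length k] else [::]) ++
    (if (q.1 == j) && (p.1 == k) then [:: (p.2 + (N - q.2)) %% orbit_length k] else [::]) | e <- es].

(** Only pairs with an end in one of the first [f] orbits, which are full, are checked: on a full
    orbit a translation is determined by the image of one point. [allow] selects the differences
    that have to occur. *)
Definition develops (bs : seq (seq (nat * nat))) : bool :=
  [&& all (fun b => [&& size b == 20, uniq b & all valid_point b]) bs,
    all (fun l => (0 < l) && (l %| N)) lens, all (fun e => (e.1 < 20) && (e.2 < 20)) es,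
    all (fun j => orbit_length j == N) (iota 0 f) &
    all (fun j => all (fun k =>
      let cs := flatten [seq codes_between j k b | b <- bs] in
      all (fun d => allow j k d ==> has (eqn d) cs) (iota 0 (orbit_length k)))
      (iota 0 (size lens))) (iota 0 f)].

Definition translate (t : nat) (p : nat * nat) : nat * nat :=
  (p.1, (p.2 + t) %% orbit_length p.1).

Definition same_code (p q : nat * nat) : Prop :=
  [/\ valid_point p, valid_point q, p.1 < f &
    allow p.1 q.1 ((q.2 + (N - p.2)) %% orbit_length q.1)].

(* An edge (p, q) with p in a full orbit is moved onto (x, y) with the same
   code by the translation taking p to x. *)
Lemma develops_covers bs :
  develops bs -> covers valid_point same_code (N * size bs).
Proof.
case/and5P => /allP gb /allP gl /allP ge /allP gf /allP gc.
have len_dvd j a : a < orbit_length j -> 0 < orbit_length j /\ orbit_length j %| N.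
  move=> ha; have js : j < size lens.
    by rewrite ltnNge; apply/negP => h; rewrite /orbit_length nth_default in ha.
  by have /andP[] := gl _ (mem_nth 0 js).
exists [seq map (translate t) b | t <- iota 0 N, b <- bs]; split.
- by rewrite size_allpairs size_iota.
- move=> _ /allpairsP[[t b] [_ /gb/and3P[/eqP sb ub /allP vb] ->]] /=; split.
  + by rewrite size_map.
  + rewrite map_inj_in_uniq // => -[j a] [k c] /vb /= va /vb /= vc [jk]; subst k.
    rewrite /valid_point /= in va vc.
    by move/eqP; rewrite eqn_modDr !modn_small // => /eqP->.
  + apply/allP => _ /mapP[[j a] /vb va ->]; rewrite /valid_point /=.
    by rewrite ltn_mod; have [] := len_dvd j a va.
move=> [j a] [k c] [/= vx vy jf al]; rewrite /valid_point /= in vx vy.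
have [ck0 kN] := len_dvd k c vy.
have jN : orbit_length j = N by apply/eqP/gf; rewrite mem_iota.
have N0 : 0 < N by rewrite -jN; have [] := len_dvd j a vx.
have ks : k < size lens.
  by rewrite ltnNge; apply/negP => h; rewrite /orbit_length nth_default in vy.
have := gc j; rewrite mem_iota => /(_ jf)/allP/(_ k); rewrite mem_iota => /(_ ks) /=.
move=> /allP/(_ ((c + (N - a)) %% orbit_length k)); rewrite mem_iota ltn_mod ck0 => /(_ isT).
rewrite al /= => /hasP[d /flattenP[_ /mapP[b bb ->] /flattenP[_ /mapP[e ein ->]]]].
have /and3P[/eqP sb ub /allP vb] := gb _ bb.
have /andP[e1 e2] := ge _ ein.
have v1 : valid_point (nth (0, 0) b e.1) by apply: vb; rewrite mem_nth ?sb.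
have v2 : valid_point (nth (0, 0) b e.2) by apply: vb; rewrite mem_nth ?sb.
have key (p q : nat * nat) : valid_point p -> valid_point q -> p.1 = j -> q.1 = k ->
    (c + (N - a)) %% orbit_length k = (q.2 + (N - p.2)) %% orbit_length k ->
    exists2 t, t < N & translate t p = (j, a) /\ translate t q = (k, c).
  case: p q => [j' a'] [k' c']; rewrite /valid_point /= => vp vq jE kE; subst j' k'; rewrite /translate /=.
  move=> E; exists ((a + (N - a')) %% N); rewrite ?ltn_mod //.
  have vp' : a' < N by rewrite -jN.
  split.
    congr pair; rewrite jN modnDmr.
    have -> : a' + (a + (N - a')) = a + N by lia.
    by rewrite modnDr modn_small // -jN.
  congr pair.
  have -> : (c' + (a + (N - a')) %% N) %% orbit_length k = (c' + (a + (N - a'))) %% orbit_length k.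
    by rewrite -modnDmr modn_dvdm // modnDmr.
  have -> : c' + (a + (N - a')) = c' + (N - a') + a by lia.
  rewrite -modnDml -E modnDml.
  have -> : c + (N - a) + a = c + N by have := vx; rewrite jN; lia.
  by rewrite -modnDmr (eqP kN) addn0 modn_small.
have found p q i i' : onth b i = Some p -> onth b i' = Some q -> valid_point p -> valid_point q ->
    p.1 = j -> q.1 = k -> (c + (N - a)) %% orbit_length k = (q.2 + (N - p.2)) %% orbit_length k ->
    (i, i') = (e.1, e.2) \/ (i, i') = (e.2, e.1) ->
    exists2 b', b' \in [seq map (translate t) b | t <- iota 0 N, b <- bs] & joined b' (j, a) (k, c).
  move=> hp hq vp vq pj qk E ii; have [t tN [t1 t2]] := key p q vp vq pj qk E.
  exists (map (translate t) b).
    by apply/allpairsP; exists (t, b); rewrite mem_iota.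
  apply/hasP; exists e => //; rewrite !onth_map.
  by case: ii => -[<- <-]; rewrite hp hq /= t1 t2 !eqxx ?orbT.
have hon i : i < 20 -> onth b i = Some (nth (0, 0) b i).
  by move=> i20; rewrite onthE (nth_map (0, 0)) ?sb.
rewrite mem_cat => /orP[]; case: ifP => // /andP[/eqP pj /eqP qk]; rewrite inE => /eqP-> /eqnP E.
  by apply: (found _ _ _ _ (hon _ e1) (hon _ e2)) => //; left.
by apply: (found _ _ _ _ (hon _ e2) (hon _ e1)) => //; right.
Qed.

End Develop.
End Covers.

(** * Triple systems with blown-up points *)

Definition complete_cover (es : seq (nat * nat)) (n m : nat) : Prop :=
  covers es (fun x : nat => x < n) (fun x y => [/\ x < n, y < n & x != y]) m.

Definition multipartite_cover (es : seq (nat * nat)) (ws : seq nat) (m : nat) : Prop :=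
  covers es (fun p : nat * nat => p.2 < nth 0 ws p.1)
    (fun p q => [/\ p.2 < nth 0 ws p.1, q.2 < nth 0 ws q.1 & p.1 != q.1]) m.

(** * Fibres over the points of a triple system *)

Section Fibres.
Variable es : seq (nat * nat).
Variables (w1 w2 inf winf : nat).
Hypothesis inf3 : 2 < inf.
Let n0 := 1 + w1 + w2.

(** The points 0, 1 and 2 form the line with the exceptional fibres. The last point [inf] has its
    own size [winf]; size 0 means that it is absent. *)
Definition fibre_start (P : nat) : nat :=
  match P with 0 => 0 | 1 => 1 | 2 => 1 + w1 | _ => n0 + 30 * (P - 3) end.

Definition fibre_size (P : nat) : nat :=
  match P with
  | 0 => 1 | 1 => w1 | 2 => w2
  | _ => if P == inf then winf else 30
  end.

Let n := fibre_start inf + winf.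

Lemma fibre_startE P : 2 < P -> fibre_start P = n0 + 30 * (P - 3).
Proof. by case: P => [|[|[|P]]]. Qed.

Lemma fibre_sizeE P : 2 < P -> P != inf -> fibre_size P = 30.
Proof. by case: P => [|[|[|P]]] // _ /negPf; rewrite /fibre_size => ->. Qed.

Lemma fibre_size_inf : fibre_size inf = winf.
Proof. by rewrite /fibre_size eqxx; case: inf inf3 => [|[|[|]]]. Qed.

Lemma fibre_next P Q : P < Q -> Q <= inf -> fibre_start P + fibre_size P <= fibre_start Q.
Proof.
move=> PQ Qi; have [P2|P2] := ltnP 2 P.
  rewrite fibre_sizeE //; last by lia.
  by rewrite !fibre_startE; lia.
have [Q2|Q2] := ltnP 2 Q.
  by rewrite (fibre_startE Q2); case: P P2 PQ => [|[|[|]]] //= *; rewrite /n0; lia.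
by case: P P2 PQ => [|[|[|]]] //=; case: Q Q2 Qi => [|[|[|]]] //= *; lia.
Qed.

Lemma fibre_inj P Q a b : P <= inf -> Q <= inf -> a < fibre_size P -> b < fibre_size Q ->
  fibre_start P + a = fibre_start Q + b -> P = Q /\ a = b.
Proof.
move=> Pi Qi aP bQ E; case: (ltngtP P Q) => PQ.
- by have := fibre_next PQ Qi; lia.
- by have := fibre_next PQ Pi; lia.
- by subst Q; split=> //; lia.
Qed.

Lemma fibre_bound P a : P <= inf -> a < fibre_size P -> fibre_start P + a < n.
Proof.
rewrite leq_eqVlt => /orP[/eqP->|Pi] h; first by rewrite /n ltn_add2l -fibre_size_inf.
by have := fibre_next Pi (leqnn _); rewrite /n; lia.
Qed.

Lemma fibre_surj x : x < n ->
  exists P a, [/\ P <= inf, a < fibre_size P & x = fibre_start P + a].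
Proof.
move=> xn; have [h|h] := leqP (fibre_start inf) x.
  exists inf, (x - fibre_start inf); rewrite fibre_size_inf leqnn.
  by move: xn; rewrite /n; split=> //; lia.
have [h0|h0] := ltnP x n0.
  have [->|x0] := posnP x; first by exists 0, 0.
  have [hx|hx] := ltnP x (1 + w1).
    by exists 1, (x - 1); rewrite /=; split; lia.
  by exists 2, (x - (1 + w1)); rewrite /=; split; rewrite /n0 in h0; lia.
move: h; rewrite fibre_startE // => h.
exists (3 + (x - n0) %/ 30), ((x - n0) %% 30).
have Pi : 3 + (x - n0) %/ 30 < inf by lia.
by rewrite fibre_sizeE ?fibre_startE; try lia; split; lia.
Qed.

(** A line through the point 0 is also responsible for the pairs inside its fibres. Every other
    point is on a single line with 0, so each inner pair is claimed once. *)
Definition on_line (l : seq nat) (x y : nat) : Prop :=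
  exists P a Q b, [/\ P \in l, Q \in l, x = fibre_start P + a /\ a < fibre_size P,
    y = fibre_start Q + b /\ b < fibre_size Q &
    P != Q \/ (0 \in l /\ a != b)].

Lemma on_line_eq l l' x y : l =i l' -> on_line l x y -> on_line l' x y.
Proof.
by move=> E [P [a [Q [b [hP hQ hx hy h]]]]]; exists P, a, Q, b; split; rewrite -?E.
Qed.

Let line_cover l m := covers es (fun x : nat => x < n) (on_line l) m.

Lemma line_cover_eq l l' m : l =i l' -> line_cover l m -> line_cover l' m.
Proof. by move=> E; apply: eq_covers => // x y; apply: on_line_eq => z; rewrite E. Qed.

Lemma multipartite_line l m : uniq l -> all (fun P => P <= inf) l -> 0 \notin l ->
  multipartite_cover es [seq fibre_size P | P <- l] m -> line_cover l m.
Proof.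
move=> ul /allP li l0; set ws := map _ _.
have wsE i : nth 0 ws i = if i < size l then fibre_size (nth 0 l i) else 0.
  by case: ltnP => h; [rewrite (nth_map 0) | rewrite nth_default // size_map].
have vl p : p.2 < nth 0 ws p.1 -> p.1 < size l /\ p.2 < fibre_size (nth 0 l p.1).
  by rewrite wsE; case: ifP.
apply: (@covers_map _ _ _ (fun p : nat * nat => fibre_start (nth 0 l p.1) + p.2)).
- move=> [i a] [j b] /vl /= [il ia] /vl /= [jl jb] E.
  have [||e ->] := fibre_inj _ _ ia jb E; try by apply: li; apply: mem_nth.
  by move/eqP: e; rewrite nth_uniq // => /eqP->.
- by move=> [i a] /vl /= [il ia]; apply: fibre_bound => //; apply: li; apply: mem_nth.
move=> x y [P [a [Q [b [hP hQ [-> aP] [-> bQ] h]]]]].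
have iP : index P l < size l by rewrite index_mem.
have iQ : index Q l < size l by rewrite index_mem.
exists (index P l, a), (index Q l, b); rewrite /= !nth_index //; split=> //; left.
rewrite !wsE iP iQ !nth_index //; split=> //.
case: h => [|[h0]]; last by rewrite h0 in l0.
by apply: contra => /eqP e; rewrite -(nth_index 0 hP) -(nth_index 0 hQ) e.
Qed.

Hypothesis cover30 : multipartite_cover es [:: 30; 30; 30] 90.
Hypothesis cover61 : complete_cover es 61 61.
Hypothesis cover_w1 : multipartite_cover es [:: 30; 30; w1] (30 + 2 * w1).
Hypothesis cover_w2 : multipartite_cover es [:: 30; 30; w2] (30 + 2 * w2).

Definition ordinary P := [&& 2 < P, P <= inf & fibre_size P == 30].

Lemma ordinary_line P Q S : ordinary P -> ordinary Q -> ordinary S ->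
  uniq [:: P; Q; S] -> line_cover [:: P; Q; S] 90.
Proof.
move=> /and3P[P2 Pi /eqP wP] /and3P[Q2 Qi /eqP wQ] /and3P[S2 Si /eqP wS] u.
apply: multipartite_line => //=; rewrite ?Pi ?Qi ?Si ?wP ?wQ ?wS //.
by rewrite !inE; lia.
Qed.

(** Edge counts divided by 30: [61 * 60 / 2] edges for K_61 and [900 + 60 w] edges for
    K_{30,30,w}. *)
Definition special_cost (j : nat) : nat :=
  match j with 0 => 61 | 1 => 30 + 2 * w1 | _ => 30 + 2 * w2 end.

Lemma special_line j P Q : j < 3 -> ordinary P -> ordinary Q -> P != Q ->
  line_cover [:: P; Q; j] (special_cost j).
Proof.
move=> j3 /and3P[P2 Pi /eqP wP] /and3P[Q2 Qi /eqP wQ] PQ.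
have [j0|j0] := posnP j; last first.
  have u : uniq [:: P; Q; j] by rewrite /= !inE; lia.
  apply: multipartite_line => //=; rewrite ?Pi ?Qi ?wP ?wQ //=; first by lia.
    by rewrite !inE; lia.
  by case: j j3 j0 {u} => [|[|[|]]].
subst j; rewrite /special_cost.
(* The line through 0 carries K_61: first the single vertex over 0, then the two fibres of size
   30. *)
pose g u := if u == 0 then 0 else if u < 31 then fibre_start P + (u - 1) else fibre_start Q + (u - 31).
have sP := fibre_startE P2; have sQ := fibre_startE Q2.
have bP := @fibre_bound P; have bQ := @fibre_bound Q.
apply: (covers_map (g := g) _ _ _ cover61).
- move=> u v; rewrite /in_mem /= /g => u61 v61.
  case: (eqVneq u 0) => u0; case: (eqVneq v 0) => v0; try lia.
  + by case: ifP; rewrite ?sP ?sQ /n0; lia.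
  + by case: ifP; rewrite ?sP ?sQ /n0; lia.
  case: ifP => u31; case: ifP => v31; try lia.
- move=> u u61; rewrite /g; case: ifP => // _; last first.
    by case: ifP => u31; [apply: bP | apply: bQ]; rewrite ?wP ?wQ //; lia.
  by have := bP 0 Pi; rewrite wP => /(_ isT); lia.
move=> x y [R [a [S [b [hR hS [-> aR] [-> bS] h]]]]].
have pre R' c : R' \in [:: P; Q; 0] -> c < fibre_size R' ->
    exists2 u, u < 61 & g u = fibre_start R' + c.
  rewrite !inE => /or3P[]/eqP->.
  - rewrite wP => c30; exists c.+1; first by lia.
    by rewrite /g (_ : c.+1 < 31) ?subn1 //; lia.
  - rewrite wQ => c30; exists (c + 31); first by lia.
    by rewrite /g !ifN ?addnK //; lia.
  - by rewrite /= ltnS leqn0 => /eqP->; exists 0.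
have [u u61 gu] := pre R a hR aR; have [v v61 gv] := pre S b hS bS.
exists u, v; split=> //; left; split=> //; apply/eqP => uv.
have [Ri Si] : R <= inf /\ S <= inf by move: hR hS; rewrite !inE; lia.
have := gu; rewrite uv gv => /esym/(fibre_inj Ri Si aR bS)[RS ab].
by case: h => [|[_]]; rewrite ?RS ?ab eqxx.
Qed.

Lemma first_line m : complete_cover es n0 m -> line_cover [:: 0; 1; 2] m.
Proof.
have n0n : n0 <= n by rewrite /n fibre_startE //; lia.
apply: (covers_map (g := id)) => // [x xn0|x y [P [a [Q [b [hP hQ [-> aP] [-> bQ] h]]]]]].
  exact: leq_trans n0n.
exists (fibre_start P + a), (fibre_start Q + b); split=> //; left.
have lt R c : R \in [:: 0; 1; 2] -> c < fibre_size R -> fibre_start R + c < n0.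
  by rewrite !inE => /or3P[]/eqP->; rewrite /= /n0; lia.
split; try exact: lt.
have [Pi Qi] : P <= inf /\ Q <= inf by move: hP hQ; rewrite !inE; lia.
apply/eqP => /(fibre_inj Pi Qi aP bQ)[PQ ab].
by case: h => [|[_]]; rewrite ?PQ ?ab eqxx.
Qed.

(** One complete graph on four fibres covers the pairs inside the fibre of [inf] too; therefore the
    other columns joined to [inf] need a multipartite cover only. *)
Lemma first_line_inf m : complete_cover es (n0 + winf) m -> line_cover [:: 0; 1; 2; inf] m.
Proof.
have n0n : n0 <= fibre_start inf by rewrite fibre_startE //; lia.
pose g x := if x < n0 then x else fibre_start inf + (x - n0).
apply: (covers_map (g := g)) => [x y|x|x y].
- by rewrite /in_mem /= /g; case: ifP; case: ifP; lia.
- by rewrite /g /n; case: ifP; lia.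
move=> [P [a [Q [b [hP hQ [-> aP] [-> bQ] h]]]]].
have pre R c : R \in [:: 0; 1; 2; inf] -> c < fibre_size R ->
    exists2 u, u < n0 + winf & g u = fibre_start R + c.
  rewrite !inE => /or4P[]/eqP->.
  - by rewrite /= => h0; exists 0; rewrite ?/g /=; rewrite /n0; lia.
  - by rewrite /= => h0; exists (1 + c); rewrite /g /=; [|case: ifP]; rewrite /n0; lia.
  - by rewrite /= => h0; exists (1 + w1 + c); rewrite /g /=; [|case: ifP]; rewrite /n0; lia.
  rewrite fibre_size_inf => h0; exists (n0 + c); first lia.
  by rewrite /g ifN; [congr (_ + _)|]; lia.
have [u un gu] := pre P a hP aP; have [v vn gv] := pre Q b hQ bQ.
exists u, v; split=> //; left; split=> //; apply/eqP => uv.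
have [Pi Qi] : P <= inf /\ Q <= inf by move: hP hQ; rewrite !inE; lia.
have := gu; rewrite uv gv => /esym/(fibre_inj Pi Qi aP bQ)[PQ ab].
by case: h => [|[_]]; rewrite ?PQ ?ab eqxx.
Qed.

(** Two vertices over the same point are served by the line that joins this point to 0. The bound
    [v] leaves out [inf] when its fibre is empty. *)
Lemma lines_complete (lines : seq nat -> Prop) (v : nat) m :
  (forall P a, P <= inf -> a < fibre_size P -> P < v) -> 0 < v ->
  (forall P Q, P < v -> Q < v -> P != Q -> exists l, [/\ lines l, P \in l & Q \in l]) ->
  covers es (fun x : nat => x < n) (fun x y => exists2 l, lines l & on_line l x y) m ->
  complete_cover es n m.
Proof.
move=> hv v0 pbd; apply: eq_covers => // x y [xn yn xy].
have [P [a [Pi aP xE]]] := fibre_surj xn; have [Q [b [Qi bQ yE]]] := fibre_surj yn.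
have Pv := hv P a Pi aP; have Qv := hv Q b Qi bQ.
have [PQ|PQ] := eqVneq P Q; last first.
  have [l [hl Pl Ql]] := pbd P Q Pv Qv PQ; exists l => //.
  by exists P, a, Q, b; split=> //; left.
subst Q.
have ab : a != b by apply: contraNneq xy => ab; rewrite xE yE ab.
have P0 : P != 0 by apply: contraNneq ab => P0; move: aP bQ; rewrite P0 /=; lia.
have [l [hl Pl l0]] := pbd P 0 Pv v0 P0; exists l => //.
by exists P, a, P, b; split=> //; right.
Qed.

End Fibres.

Lemma sum_const_seq (I : Type) (s : seq I) k : \sum_(i <- s) k = size s * k.
Proof. by rewrite big_const_seq count_predT iter_addn_0 mulnC. Qed.

Lemma sum_indicator M c k : c < M -> \sum_(h <- iota 0 M) (h == c) * k = k.
Proof.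
move=> cM; rewrite (bigD1_seq c) ?mem_iota ?iota_uniq //= eqxx mul1n.
by rewrite big1_seq ?addn0 // => h /andP[/negPf->].
Qed.

Definition next_level (i : nat) : nat := if i == 2 then 0 else i.+1.

(** * The Bose triple system on [6 m + 3] points *)

Section Bose.
Variables (es : seq (nat * nat)) (w1 w2 winf m : nat).
Let M := 2 * m + 1.
Let inf := 3 * M.
Let n := fibre_start w1 w2 inf + winf.
Let line_cover l k := covers es (fun x : nat => x < n) (on_line w1 w2 inf winf l) k.
Hypothesis cover30 : multipartite_cover es [:: 30; 30; 30] 90.
Hypothesis cover61 : complete_cover es 61 61.
Hypothesis cover_w1 : multipartite_cover es [:: 30; 30; w1] (30 + 2 * w1).
Hypothesis cover_w2 : multipartite_cover es [:: 30; 30; w2] (30 + 2 * w2).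
Let sc := special_cost w1 w2.

Let inf3 : 2 < inf. Proof. by rewrite /inf /M; lia. Qed.

Lemma ordinary_point x i : 0 < x < M -> i < 3 -> ordinary w1 w2 inf winf (3 * x + i).
Proof. by move=> xM i3; rewrite /ordinary fibre_sizeE ?eqxx /inf; lia. Qed.

Definition minus h d := if d <= h then h - d else h + M - d.

Definition plus h d := if h + d < M then h + d else h + d - M.

(** With [(x, i)] coded as [3 x + i], this is the usual triple of [(x, i)], [(y, i)] and
    [((x + y) / 2, i + 1)] over the integers modulo the odd number [M], indexed by the midpoint [h]
    and the half-difference [d]. *)
Definition bose_line i d h := [:: 3 * minus h d + i; 3 * plus h d + i; 3 * h + next_level i].

(** The exceptional cases are those where the line meets column 0: in its midpoint, in [h - d] or in
    [h + d]. *)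
Definition bose_cost i d h :=
  if h == 0 then sc (next_level i) else if (h == d) || (h == M - d) then sc i else 90.

Lemma bose_line_cover i d h : i < 3 -> 0 < d <= m -> h < M ->
  line_cover (bose_line i d h) (bose_cost i d h).
Proof.
move=> i3 dm hM; rewrite /bose_line /bose_cost.
have ni3 : next_level i < 3 by rewrite /next_level; case: ifP; lia.
have nii : next_level i != i by rewrite /next_level; case: ifP; lia.
have special := special_line inf3 cover61 cover_w1 cover_w2.
have [h0|h0] := eqVneq h 0.
  subst h; apply: special => //; rewrite /minus /plus ?ordinary_point //; rewrite /M; do ?case: ifP; lia.
have [hd|hd] := eqVneq h d.
  have -> : minus h d = 0 by rewrite /minus hd leqnn subnn.
  apply: (line_cover_eq (l := [:: 3 * plus h d + i; 3 * h + next_level i; i])).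
    by move=> z; rewrite !inE muln0 add0n; case: (z == i); rewrite /= ?orbT ?orbF.
  apply: special => //; rewrite ?ordinary_point // /plus; move: hM; rewrite /M; do ?case: ifP; lia.
have [hd'|hd'] := eqVneq h (M - d).
  have -> : plus h d = 0 by rewrite /plus hd'; case: ifP; rewrite /M; lia.
  apply: (line_cover_eq (l := [:: 3 * minus h d + i; 3 * h + next_level i; i])).
    by move=> z; rewrite !inE muln0 add0n; case: (z == i); rewrite /= ?orbT ?orbF.
  apply: special => //; rewrite ?ordinary_point // /minus; move: hM hd'; rewrite /M; do ?case: ifP; lia.
rewrite /=; apply: (ordinary_line inf3 cover30).
- by apply: ordinary_point => //; rewrite /minus; move: hM hd'; rewrite /M; do ?case: ifP; lia.
- by apply: ordinary_point => //; rewrite /plus; move: hM hd'; rewrite /M; do ?case: ifP; lia.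
- by apply: ordinary_point => //; lia.
rewrite /= !inE /minus /plus; move: hM hd'; rewrite /M; do ?case: ifP; lia.
Qed.

Lemma bose_cost_sum i d : 0 < d <= m ->
  \sum_(h <- iota 0 M) bose_cost i d h = sc (next_level i) + 2 * sc i + 90 * (M - 3).
Proof.
move=> dm.
(* Adding 90 on both sides at each exceptional [h] avoids subtraction of natural numbers. *)
have E : \sum_(h <- iota 0 M) bose_cost i d h +
    \sum_(h <- iota 0 M) ((h == 0) * 90 + (h == d) * 90 + (h == M - d) * 90) =
    \sum_(h <- iota 0 M) (90 + (h == 0) * sc (next_level i) + (h == d) * sc i + (h == M - d) * sc i).
  rewrite -big_split /=; apply: eq_big_seq => h; rewrite mem_iota => /= hM.
  rewrite /bose_cost; case: (eqVneq h 0) => [->|h0]; first by case: eqVneq; case: eqVneq; rewrite /M; lia.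
  by case: (eqVneq h d) => hd; case: (eqVneq h (M - d)) => hd'; rewrite ?orbT /=; move: hM; rewrite /M; lia.
move: E; rewrite !big_split /= sum_const_seq size_iota !sum_indicator; rewrite /M; lia.
Qed.

Lemma next_level_sum : sc (next_level 0) + sc (next_level 1) + sc (next_level 2) = sc 0 + sc 1 + sc 2.
Proof. by rewrite /next_level /=; lia. Qed.

Lemma bose_pair x x' i i' : x < M -> x' < M -> i < 3 -> i' < 3 -> 3 * x + i != 3 * x' + i' ->
  x = x' \/ exists i0 d h, [/\ i0 < 3, 0 < d <= m, h < M, 3 * x + i \in bose_line i0 d h &
    3 * x' + i' \in bose_line i0 d h].
Proof.
wlog le : x x' i i' / (i' == next_level i) || ((i == i') && (x <= x')).
  move=> W xM xM' i3 i3' ne.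
  have [h|h] := boolP ((i' == next_level i) || ((i == i') && (x <= x'))); first exact: W.
  have [] := W x' x i' i _ xM' xM i3' i3.
  - by move: h; rewrite /next_level; do ?case: ifP; lia.
  - by rewrite eq_sym.
  - by left.
  by move=> [i0 [d [y [? ? ? ? ?]]]]; right; exists i0, d, y.
move=> xM xM' i3 i3' ne; have [|xx] := eqVneq x x'; [by left | right].
have [iE|/negPf iE] := eqVneq i' (next_level i).
  (* [x] lies symmetrically to another point about the midpoint [x'] *)
  subst i'.
  pose e := if x < x' then x' - x else x - x'.
  have e0 : 0 < e < M by rewrite /e; case: ifP; lia.
  exists i, (if e <= m then e else M - e), x'; split=> //.
    by move: e0; rewrite /M; case: ifP; lia.
  have : (x == minus x' (if e <= m then e else M - e)) || (x == plus x' (if e <= m then e else M - e)).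
    by rewrite /e /minus /plus; move: xM xM'; rewrite /M; do ?case: ifP; lia.
  rewrite !inE; by case/orP => /eqP<-; rewrite eqxx ?orbT.
  by rewrite !inE eqxx !orbT.
move: le; rewrite iE /= => /andP[/eqP ii le]; subst i'.
pose e := x' - x.
(* Since [M] is odd, exactly one of the two arcs between [x] and [x'] has even length; [h] is its
   midpoint and [d] half its length. *)
pose d := if odd e then (M - e) %/ 2 else e %/ 2.
pose h := if odd e then (if x + x' < M then (x + x' + M) %/ 2 else (x + x' - M) %/ 2) else (x + x') %/ 2.
have oE : odd e = (e %% 2 == 1) by rewrite modn2; case: odd.
have [d1 [h1 [c1 c2]]] : 0 < d <= m /\ h < M /\
    ((x == minus h d) || (x == plus h d)) /\ ((x' == minus h d) || (x' == plus h d)).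
  by rewrite /d /h oE /minus /plus /e; move: xM xM'; rewrite /M; do ?case: ifP; lia.
exists i, d, h; split=> //.
  by rewrite !inE; case/orP: c1 => /eqP<-; rewrite eqxx ?orbT.
by rewrite !inE; case/orP: c2 => /eqP<-; rewrite eqxx ?orbT.
Qed.

(** Besides column 0, each of the points 0, 1, 2 is on [3 m] lines. For each level and each [d],
    [M - 3 = 2 (m - 1)] lines avoid column 0; at 90 blocks each this gives the factor 540. The other
    [2 m] columns cost [mc] each. *)
Lemma bose_complete mc mb :
  let infs := if winf == 0 then [::] else [:: inf] in
  (forall h, 0 < h < M -> line_cover ([:: 3 * h; 3 * h + 1; 3 * h + 2] ++ infs) mc) ->
  line_cover ([:: 0; 1; 2] ++ infs) mb ->
  complete_cover es n
    (m * (3 * (sc 0 + sc 1 + sc 2)) + m * (m - 1) * 540 + 2 * m * mc + mb).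
Proof.
move=> infs hcol hb.
have gen : covers es (fun x : nat => x < n) (fun x y => exists2 i, i \in iota 0 3 &
    exists2 d, d \in iota 1 m & exists2 h, h \in iota 0 M & on_line w1 w2 inf winf (bose_line i d h) x y)
    (\sum_(i <- iota 0 3) \sum_(d <- iota 1 m) \sum_(h <- iota 0 M) bose_cost i d h).
  apply: covers_seq => i; rewrite mem_iota => i3; apply: covers_seq => d; rewrite mem_iota => dm.
  apply: covers_seq => h; rewrite mem_iota => hM; apply: bose_line_cover => //; lia.
have cols : covers es (fun x : nat => x < n) (fun x y => exists2 h, h \in iota 1 (2 * m) &
    on_line w1 w2 inf winf ([:: 3 * h; 3 * h + 1; 3 * h + 2] ++ infs) x y) (\sum_(h <- iota 1 (2 * m)) mc).
  by apply: covers_seq => h; rewrite mem_iota => hm; apply: hcol; rewrite /M; lia.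
pose lines l := (exists i d h, [/\ i < 3, 0 < d <= m, h < M & l = bose_line i d h]) \/
  exists2 h, h < M & l = [:: 3 * h; 3 * h + 1; 3 * h + 2] ++ infs.
apply: (lines_complete (lines := lines) (v := if winf == 0 then inf else inf.+1) inf3).
- move=> P a; rewrite leq_eqVlt => /orP[/eqP->|Pi]; last by case: ifP => //; lia.
  by rewrite fibre_size_inf //; case: ifP; lia.
- by case: ifP; lia.
- have pbd P Q : P < inf -> Q < inf -> P != Q -> exists l, [/\ lines l, P \in l & Q \in l].
    move=> Pi Qi PQ.
    have PE := divn_eq P 3; have QE := divn_eq Q 3.
    rewrite mulnC in PE; rewrite mulnC in QE.
    have P3 : P %% 3 < 3 by rewrite ltn_mod.
    have Q3 : Q %% 3 < 3 by rewrite ltn_mod.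
    have PM : P %/ 3 < M by move: Pi; rewrite /inf; lia.
    have QM : Q %/ 3 < M by move: Qi; rewrite /inf; lia.
    have := bose_pair PM QM P3 Q3; rewrite -PE -QE => /(_ PQ)[E|[i [d [h [? ? ? hP hQ]]]]].
      exists ([:: 3 * (P %/ 3); 3 * (P %/ 3) + 1; 3 * (P %/ 3) + 2] ++ infs); split.
      + by right; exists (P %/ 3).
      + by rewrite mem_cat !inE; lia.
      + by rewrite mem_cat !inE; lia.
    by exists (bose_line i d h); split=> //; left; exists i, d, h.
  have pinf P : winf != 0 -> P < inf -> exists l, [/\ lines l, P \in l & inf \in l].
    move=> wi Pi; exists ([:: 3 * (P %/ 3); 3 * (P %/ 3) + 1; 3 * (P %/ 3) + 2] ++ infs); split.
    + by right; exists (P %/ 3) => //; move: Pi; rewrite /inf; lia.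
    + by rewrite mem_cat !inE; lia.
    + by rewrite mem_cat /infs (negPf wi) mem_head orbT.
  move=> P Q; case: ifP => [_|/negbT wi]; first exact: pbd.
  rewrite !ltnS [P <= _]leq_eqVlt [Q <= _]leq_eqVlt => /orP[/eqP->|Pi] /orP[/eqP->|Qi] PQ.
  + by rewrite eqxx in PQ.
  + by have [l [? ? ?]] := pinf Q wi Qi; exists l.
  + exact: pinf.
  + exact: pbd.
apply: eq_covers (covers_union (covers_union gen cols) hb) => [|x y [l [[i [d [h [i3 dm hM ->]]]]|[h hM ->]] hl]].
- have -> : \sum_(i <- iota 0 3) \sum_(d <- iota 1 m) \sum_(h <- iota 0 M) bose_cost i d h =
    \sum_(i <- iota 0 3) m * (sc (next_level i) + 2 * sc i + 90 * (M - 3)).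
    apply: eq_bigr => i _; rewrite -[X in X * _](size_iota 1) -sum_const_seq.
    by apply: eq_big_seq => d; rewrite mem_iota => dm; apply: bose_cost_sum; lia.
  rewrite !big_cons big_nil sum_const_seq size_iota; have := next_level_sum.
  rewrite /M; move: (sc (next_level 0)) (sc (next_level 1)) (sc (next_level 2)) (sc 0) (sc 1) (sc 2).
  by case: (m) => [|k] *; nia.
- left; left; exists i; first by rewrite mem_iota.
  exists d; first by rewrite mem_iota; lia.
  by exists h; rewrite ?mem_iota.
have [h0|h0] := posnP h; first by right; move: hl; rewrite h0.
by left; right; exists h => //; rewrite mem_iota; move: hM; rewrite /M; lia.
Qed.

End Bose.


(** * The Skolem triple system on [6 m + 1] points *)

Section Skolem.
Variables (es : seq (nat * nat)) (w1 w2 m : nat).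
Hypothesis m0 : 0 < m.
Let M := 2 * m.
Let inf := 3 * M.
Let n := fibre_start w1 w2 inf + 30.
Let line_cover l k := covers es (fun x : nat => x < n) (on_line w1 w2 inf 30 l) k.
Hypothesis cover30 : multipartite_cover es [:: 30; 30; 30] 90.
Hypothesis cover61 : complete_cover es 61 61.
Hypothesis cover_w1 : multipartite_cover es [:: 30; 30; w1] (30 + 2 * w1).
Hypothesis cover_w2 : multipartite_cover es [:: 30; 30; w2] (30 + 2 * w2).
Let sc := special_cost w1 w2.

Let inf3 : 2 < inf. Proof. by rewrite /inf /M; lia. Qed.
Let special := special_line (winf := 30) inf3 cover61 cover_w1 cover_w2.

Let point x i : 0 < x < M -> i < 3 -> ordinary w1 w2 inf 30 (3 * x + i).
Proof. by move=> xM i3; rewrite /ordinary fibre_sizeE ?eqxx /inf; lia. Qed.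

Let point_inf : ordinary w1 w2 inf 30 inf.
Proof. by rewrite /ordinary fibre_size_inf // eqxx leqnn inf3. Qed.

Let down h d := if d <= h then h - d else h + M - d.

(** Products in the half-idempotent commutative quasigroup of order [2 m]: residues with sum [2 h]
    have product [h], and residues with sum [2 h + 1] have product [h + m] (see [odd_line]), where
    [h < m]. The index [d] runs over the pairs with a given sum. *)
Definition even_line i d h := [:: 3 * down h d + i; 3 * (h + d) + i; 3 * h + next_level i].

Definition even_cost i d h := if h == 0 then sc (next_level i) else if h == d then sc i else 90.

Definition odd_line i d h :=
  [:: 3 * down h d + i; 3 * (h + 1 + d) + i; 3 * (h + m) + next_level i].

Definition odd_cost (i d h : nat) := if h == d then sc i else 90.

(** The square of [h + m] is [h] and not [h + m]. The resulting pair is completed by [inf], and only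
    the columns below [m] are lines. *)
Definition inf_line i h := [:: inf; 3 * (h + m) + i; 3 * h + next_level i].

Definition inf_cost i h := if h == 0 then sc (next_level i) else 90.

Let next3 i : i < 3 -> next_level i < 3 /\ next_level i != i.
Proof. by rewrite /next_level; case: ifP; lia. Qed.

Lemma even_line_cover i d h : i < 3 -> 0 < d < m -> h < m ->
  line_cover (even_line i d h) (even_cost i d h).
Proof.
move=> i3 dm hm; have [ni3 nii] := next3 i3; rewrite /even_line /even_cost.
have [h0|h0] := eqVneq h 0.
  subst h; apply: special => //; rewrite /down ?point //; rewrite /M; do ?case: ifP; lia.
have [hd|hd] := eqVneq h d.
  have -> : down h d = 0 by rewrite /down hd leqnn subnn.
  apply: (line_cover_eq (l := [:: 3 * (h + d) + i; 3 * h + next_level i; i])).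
    by move=> z; rewrite !inE muln0 add0n; case: (z == i); rewrite /= ?orbT ?orbF.
  apply: special => //; rewrite ?point // /M; lia.
apply: (ordinary_line inf3 cover30).
- by apply: point => //; rewrite /down /M; do ?case: ifP; lia.
- by apply: point => //; rewrite /M; lia.
- by apply: point => //; rewrite /M; lia.
rewrite /= !inE /down /M; do ?case: ifP; lia.
Qed.

Lemma odd_line_cover i d h : i < 3 -> d < m -> h < m ->
  line_cover (odd_line i d h) (odd_cost i d h).
Proof.
move=> i3 dm hm; have [ni3 nii] := next3 i3; rewrite /odd_line /odd_cost.
have [hd|hd] := eqVneq h d.
  have -> : down h d = 0 by rewrite /down hd leqnn subnn.
  apply: (line_cover_eq (l := [:: 3 * (h + 1 + d) + i; 3 * (h + m) + next_level i; i])).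
    by move=> z; rewrite !inE muln0 add0n; case: (z == i); rewrite /= ?orbT ?orbF.
  apply: special => //; rewrite ?point // /M; lia.
apply: (ordinary_line inf3 cover30).
- by apply: point => //; rewrite /down /M; do ?case: ifP; lia.
- by apply: point => //; rewrite /M; lia.
- by apply: point => //; rewrite /M; lia.
rewrite /= !inE /down /M; do ?case: ifP; lia.
Qed.

Lemma inf_line_cover i h : i < 3 -> h < m -> line_cover (inf_line i h) (inf_cost i h).
Proof.
move=> i3 hm; have [ni3 nii] := next3 i3; rewrite /inf_line /inf_cost.
have [h0|h0] := eqVneq h 0.
  subst h; apply: special; rewrite ?point_inf ?point //; rewrite /inf /M; lia.
apply: (ordinary_line inf3 cover30); rewrite ?point_inf //.
- by apply: point => //; rewrite /M; lia.
- by apply: point => //; rewrite /M; lia.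
rewrite /= !inE /inf /M; lia.
Qed.

Lemma even_cost_sum i d : 0 < d < m ->
  \sum_(h <- iota 0 m) even_cost i d h = sc (next_level i) + sc i + 90 * (m - 2).
Proof.
move=> dm.
have E : \sum_(h <- iota 0 m) even_cost i d h + \sum_(h <- iota 0 m) ((h == 0) * 90 + (h == d) * 90) =
    \sum_(h <- iota 0 m) (90 + (h == 0) * sc (next_level i) + (h == d) * sc i).
  rewrite -big_split /=; apply: eq_big_seq => h _; rewrite /even_cost.
  by case: (eqVneq h 0) => [->|h0]; case: (eqVneq _ d) => hd /=; lia.
move: E; rewrite !big_split /= sum_const_seq size_iota !sum_indicator; lia.
Qed.

Lemma odd_cost_sum i d : d < m ->
  \sum_(h <- iota 0 m) odd_cost i d h = sc i + 90 * (m - 1).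
Proof.
move=> dm.
have E : \sum_(h <- iota 0 m) odd_cost i d h + \sum_(h <- iota 0 m) (h == d) * 90 =
    \sum_(h <- iota 0 m) (90 + (h == d) * sc i).
  rewrite -big_split /=; apply: eq_big_seq => h _; rewrite /odd_cost.
  by case: (eqVneq _ d) => hd /=; lia.
move: E; rewrite !big_split /= sum_const_seq size_iota !sum_indicator; lia.
Qed.

Lemma inf_cost_sum i : \sum_(h <- iota 0 m) inf_cost i h = sc (next_level i) + 90 * (m - 1).
Proof.
have E : \sum_(h <- iota 0 m) inf_cost i h + \sum_(h <- iota 0 m) (h == 0) * 90 =
    \sum_(h <- iota 0 m) (90 + (h == 0) * sc (next_level i)).
  rewrite -big_split /=; apply: eq_big_seq => h _; rewrite /inf_cost.
  by case: (eqVneq _ 0) => hd /=; lia.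
move: E; rewrite !big_split /= sum_const_seq size_iota !sum_indicator; lia.
Qed.

Definition skolem_lines (l : seq nat) : Prop :=
  [\/ exists i d h, [/\ i < 3, 0 < d < m, h < m & l = even_line i d h],
      exists i d h, [/\ i < 3, d < m, h < m & l = odd_line i d h],
      exists i h, [/\ i < 3, h < m & l = inf_line i h] |
      exists2 h, h < m & l = [:: 3 * h; 3 * h + 1; 3 * h + 2]].

Lemma skolem_pair x x' i i' : x < M -> x' < M -> i < 3 -> i' < 3 -> 3 * x + i != 3 * x' + i' ->
  exists l, [/\ skolem_lines l, 3 * x + i \in l & 3 * x' + i' \in l].
Proof.
wlog le : x x' i i' / (i' == next_level i) || ((i == i') && (x <= x')).
  move=> W xM xM' i3 i3' ne.
  have [h|h] := boolP ((i' == next_level i) || ((i == i') && (x <= x'))); first exact: W.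
  have [] := W x' x i' i _ xM' xM i3' i3.
  - by move: h; rewrite /next_level; do ?case: ifP; lia.
  - by rewrite eq_sym.
  by move=> l [? ? ?]; exists l.
move=> xM xM' i3 i3' ne; have [ni3 nii] := next3 i3.
have even d h y y' : 0 < d < m -> h < m -> (y == 3 * down h d + i) || (y == 3 * (h + d) + i) ||
    (y == 3 * h + next_level i) -> (y' == 3 * down h d + i) || (y' == 3 * (h + d) + i) ||
    (y' == 3 * h + next_level i) -> exists l, [/\ skolem_lines l, y \in l & y' \in l].
  move=> dm hm h1 h2; exists (even_line i d h); rewrite !inE !orbA; split=> //.
  by constructor 1; exists i, d, h.
have odd d h y y' : d < m -> h < m -> (y == 3 * down h d + i) || (y == 3 * (h + 1 + d) + i) ||
    (y == 3 * (h + m) + next_level i) -> (y' == 3 * down h d + i) || (y' == 3 * (h + 1 + d) + i) ||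
    (y' == 3 * (h + m) + next_level i) -> exists l, [/\ skolem_lines l, y \in l & y' \in l].
  move=> dm hm h1 h2; exists (odd_line i d h); rewrite !inE !orbA; split=> //.
  by constructor 2; exists i, d, h.
have [iE|iE] := eqVneq i' (next_level i).
  subst i'; have [x'm|x'm] := ltnP x' m.
    have [xx|xx] := eqVneq x x'.
      exists [:: 3 * x; 3 * x + 1; 3 * x + 2]; split.
      + by constructor 4; exists x; rewrite // xx.
      + by rewrite !inE; lia.
      + by rewrite !inE xx; lia.
    have [xm|xm] := eqVneq x (x' + m).
      exists (inf_line i x'); split.
      + by constructor 3; exists i, x'.
      + by rewrite !inE xm eqxx orbT.
      + by rewrite !inE eqxx !orbT.
    (* [x] lies below [x'], or at most half a turn above it, or farther, where it is reached
       downwards across 0. *)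
    pose d := if x < x' then x' - x else if x < x' + m then x - x' else x' + M - x.
    apply: (even d x') => //; rewrite /d /down; move: xM xM'; rewrite /M; do ?case: ifP; lia.
  pose h := x' - m.
  pose d := if x <= h then h - x else if x <= h + m then x - h - 1 else h + M - x.
  apply: (odd d h) => //; rewrite /d /h /down; move: xM xM'; rewrite /M; do ?case: ifP; lia.
move: le; rewrite (negPf iE) /= => /andP[/eqP ii le]; subst i'.
have xx : x < x' by lia.
pose s := if x + x' < M then x + x' else x + x' - M.
pose h := s %/ 2.
pose e := x' - x.
have [sE|sE] := eqVneq (s %% 2) 0.
  pose d := if x + x' < M then e %/ 2 else (M - e) %/ 2.
  apply: (even d h) => //; rewrite /d /h /e /down; move: xM xM' sE; rewrite /s /M; do ?case: ifP; lia.
pose d := if x + x' < M then e %/ 2 else (M - e) %/ 2.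
by apply: (odd d h) => //; rewrite /d /h /e /down; move: xM xM' sE; rewrite /s /M; do ?case: ifP; lia.
Qed.

(** Each of the points 0, 1, 2 is on [3 m] lines, one of which is the first column. The terms with
    factor 270 count the even lines, the odd lines and the lines through [inf] that avoid this
    column, and the next term the other columns. *)
Lemma skolem_complete mb : line_cover [:: 0; 1; 2] mb ->
  complete_cover es n ((3 * m - 1) * (sc 0 + sc 1 + sc 2) +
    270 * ((m - 1) * (m - 2) + m * (m - 1) + (m - 1)) + 90 * (m - 1) + mb).
Proof.
move=> hb.
have ce : covers es (fun x : nat => x < n) (fun x y => exists2 i, i \in iota 0 3 &
    exists2 d, d \in iota 1 (m - 1) & exists2 h, h \in iota 0 m & on_line w1 w2 inf 30 (even_line i d h) x y)
    (\sum_(i <- iota 0 3) \sum_(d <- iota 1 (m - 1)) \sum_(h <- iota 0 m) even_cost i d h).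
  apply: covers_seq => i; rewrite mem_iota => i3; apply: covers_seq => d; rewrite mem_iota => dm.
  apply: covers_seq => h; rewrite mem_iota => hM; apply: even_line_cover => //; lia.
have co : covers es (fun x : nat => x < n) (fun x y => exists2 i, i \in iota 0 3 &
    exists2 d, d \in iota 0 m & exists2 h, h \in iota 0 m & on_line w1 w2 inf 30 (odd_line i d h) x y)
    (\sum_(i <- iota 0 3) \sum_(d <- iota 0 m) \sum_(h <- iota 0 m) odd_cost i d h).
  apply: covers_seq => i; rewrite mem_iota => i3; apply: covers_seq => d; rewrite mem_iota => dm.
  apply: covers_seq => h; rewrite mem_iota => hM; apply: odd_line_cover => //; lia.
have ci : covers es (fun x : nat => x < n) (fun x y => exists2 i, i \in iota 0 3 &
    exists2 h, h \in iota 0 m & on_line w1 w2 inf 30 (inf_line i h) x y)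
    (\sum_(i <- iota 0 3) \sum_(h <- iota 0 m) inf_cost i h).
  apply: covers_seq => i; rewrite mem_iota => i3.
  apply: covers_seq => h; rewrite mem_iota => hM; apply: inf_line_cover => //; lia.
have cc : covers es (fun x : nat => x < n) (fun x y => exists2 h, h \in iota 1 (m - 1) &
    on_line w1 w2 inf 30 [:: 3 * h; 3 * h + 1; 3 * h + 2] x y) (\sum_(h <- iota 1 (m - 1)) 90).
  apply: covers_seq => h; rewrite mem_iota => hm.
  have p i : i < 3 -> ordinary w1 w2 inf 30 (3 * h + i) by apply: point; rewrite /M; lia.
  apply: (ordinary_line inf3 cover30); rewrite ?p //; first by have := p 0; rewrite addn0; apply.
  by rewrite /= !inE; lia.
apply: (lines_complete (lines := skolem_lines) (v := inf.+1) inf3) => //.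
- move=> P Q; rewrite !ltnS [P <= _]leq_eqVlt [Q <= _]leq_eqVlt.
  have pinf P' : P' < inf -> exists l, [/\ skolem_lines l, P' \in l & inf \in l].
    move=> Pi; pose i := P' %% 3; pose x := P' %/ 3.
    (* On the lines through [inf], a column below [m] occurs in the last place, one level up, and
       the other columns in the middle. *)
    exists (if x < m then inf_line (if i == 0 then 2 else i - 1) x else inf_line i (x - m)).
    split.
    + constructor 3; case: ifP => xm.
        exists (if i == 0 then 2 else i - 1), x; split=> //; rewrite /i; case: ifP; lia.
      exists i, (x - m); split=> //; rewrite /i /x; first lia.
      by move: Pi xm; rewrite /inf /M /x; lia.
    + have PE : P' = 3 * x + i by rewrite /x /i; lia.
      have i3 : i < 3 by rewrite /i; lia.
      case: ifP => xm; rewrite !inE; last by lia.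
      rewrite /next_level; case: (eqVneq i 0) => i0 /=; first by lia.
      by case: ifP; lia.
    + by case: ifP => xm; rewrite mem_head.
  move=> /orP[/eqP->|Pi] /orP[/eqP->|Qi] PQ.
  + by rewrite eqxx in PQ.
  + by have [l [? ? ?]] := pinf Q Qi; exists l.
  + exact: pinf.
  have PE := divn_eq P 3; have QE := divn_eq Q 3.
  rewrite mulnC in PE; rewrite mulnC in QE.
  have P3 : P %% 3 < 3 by rewrite ltn_mod.
  have Q3 : Q %% 3 < 3 by rewrite ltn_mod.
  have PM : P %/ 3 < M by move: Pi; rewrite /inf; lia.
  have QM : Q %/ 3 < M by move: Qi; rewrite /inf; lia.
  by have := skolem_pair PM QM P3 Q3; rewrite -PE -QE; apply.
apply: eq_covers (covers_union (covers_union (covers_union ce co) (covers_union ci cc)) hb).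
  have -> : \sum_(i <- iota 0 3) \sum_(d <- iota 1 (m - 1)) \sum_(h <- iota 0 m) even_cost i d h =
    \sum_(i <- iota 0 3) (m - 1) * (sc (next_level i) + sc i + 90 * (m - 2)).
    apply: eq_bigr => i _; rewrite -[X in X * _](size_iota 1) -sum_const_seq.
    by apply: eq_big_seq => d; rewrite mem_iota => dm; apply: even_cost_sum; lia.
  have -> : \sum_(i <- iota 0 3) \sum_(d <- iota 0 m) \sum_(h <- iota 0 m) odd_cost i d h =
    \sum_(i <- iota 0 3) m * (sc i + 90 * (m - 1)).
    apply: eq_bigr => i _; rewrite -[X in X * _](size_iota 0) -sum_const_seq.
    by apply: eq_big_seq => d; rewrite mem_iota => dm; apply: odd_cost_sum; lia.
  have -> : \sum_(i <- iota 0 3) \sum_(h <- iota 0 m) inf_cost i h =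
    \sum_(i <- iota 0 3) (sc (next_level i) + 90 * (m - 1)) by apply: eq_bigr => i _; apply: inf_cost_sum.
  rewrite !big_cons !big_nil sum_const_seq size_iota; have := next_level_sum w1 w2.
  rewrite -/sc; move: (sc (next_level 0)) (sc (next_level 1)) (sc (next_level 2)) (sc 0) (sc 1) (sc 2).
  case: (m) m0 => // -[|k] _ *; nia.
move=> x y [l [[i [d [h [i3 dm hm ->]]]]|[i [d [h [i3 dm hm ->]]]]|[i [h [i3 hm ->]]]|[h hm ->]] hl].
- left; left; left; exists i; first by rewrite mem_iota.
  by exists d; [rewrite mem_iota; lia | exists h; rewrite ?mem_iota].
- left; left; right; exists i; first by rewrite mem_iota.
  by exists d; [rewrite mem_iota | exists h; rewrite ?mem_iota].
- left; right; left; exists i; first by rewrite mem_iota.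
  by exists h; rewrite ?mem_iota.
have [h0|h0] := posnP h; first by right; move: hl; rewrite h0.
by left; right; right; exists h => //; rewrite mem_iota; lia.
Qed.

End Skolem.

(** * Ingredient designs *)

Section Ingredients.
Variable es : seq (nat * nat).

Definition distinct_code (j k d : nat) : bool := (j != k) || (0 < d).

(** At most one fixed point is allowed because pairs between short orbits are not developed. *)
Lemma complete_cyclic N f e bs : 0 < N -> e <= 1 ->
  develops es N f (nseq f N ++ nseq e 1) distinct_code bs ->
  complete_cover es (f * N + e) (N * size bs).
Proof.
move=> N0 e1 /develops_covers.
have len j : orbit_length (nseq f N ++ nseq e 1) j = if j < f then N else if j < f + e then 1 else 0.
  rewrite /orbit_length nth_cat size_nseq !nth_nseq; case: ltnP => // fj.
  by rewrite ltn_subLR // addnC.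
have vp p : valid_point (nseq f N ++ nseq e 1) p -> p.2 < N /\ p.1 * N + p.2 < f * N + e.
  rewrite /valid_point len; case: ifP => [pf h|_]; last by case: ifP => // pf h; split; nia.
  by split=> //; nia.
apply: (covers_map (g := fun p => p.1 * N + p.2)).
- move=> [j a] [k b] /vp /= [aN _] /vp /= [bN _] E.
  have h c d : d < N -> (c * N + d) %/ N = c /\ (c * N + d) %% N = d.
    by move=> dN; rewrite divnMDl // divn_small // addn0 modnMDl modn_small.
  by have [j1 a1] := h j a aN; have [k1 b1] := h k b bN; move: j1 a1; rewrite E k1 b1 => -> ->.
- by move=> p /vp [].
move=> x y [xn yn xy].
have pre z : z < f * N + e -> z = z %/ N * N + z %% N /\
    valid_point (nseq f N ++ nseq e 1) (z %/ N, z %% N).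
  move=> zn; split; first exact: divn_eq.
  rewrite /valid_point len /=; case: ifP => zf; first by rewrite ltn_mod.
  have zE := divn_eq z N; have zN : z %% N < N by rewrite ltn_mod.
  have zf' : f <= z %/ N by lia.
  by case: ifP => h; nia.
have [xE xv] := pre x xn; have [yE yv] := pre y yn.
exists (x %/ N, x %% N), (y %/ N, y %% N); split=> //=.
have xN : x %% N < N by rewrite ltn_mod.
have yN : y %% N < N by rewrite ltn_mod.
have ok j a k b : j < f -> a < N -> b < N -> (j, a) != (k, b) ->
    distinct_code j k ((b + (N - a)) %% orbit_length (nseq f N ++ nseq e 1) k).
  move=> jf aN bN ne; rewrite /distinct_code; have [jk|//] := eqVneq j k.
  subst k; rewrite len jf lt0n /=; apply: contra ne => /eqP h.
  have [ab|ab] := leqP a b.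
    have := h; have -> : b + (N - a) = b - a + N by lia.
    by rewrite modnDr modn_small; [move=> ba; apply/eqP; congr pair; lia | lia].
  by have := h; rewrite modn_small; lia.
have ne : (x %/ N, x %% N) != (y %/ N, y %% N).
  by apply: contra xy => /eqP [E1 E2]; rewrite xE yE E1 E2.
have [xf|xf] := ltnP (x %/ N) f; first by left; split=> //; apply: ok.
have [yf|yf] := ltnP (y %/ N) f; first by right; split=> //; apply: ok => //; rewrite eq_sym.
have [xf' yf'] : f * N <= x /\ f * N <= y by split; nia.
by lia.
Qed.

Lemma cover_30_30_30 bs :
  develops es 90 1 [:: 90] (fun _ _ d => d %% 3 != 0) bs ->
  multipartite_cover es [:: 30; 30; 30] (90 * size bs).
Proof.
have val j a : valid_point [:: 90] (j, a) = (j == 0) && (a < 90).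
  by rewrite /valid_point /orbit_length; case: j => [|j] //=; rewrite nth_nil.
have part i u : (u < nth 0 [:: 30; 30; 30] i) = (i < 3) && (u < 30).
  by case: i => [|[|[|i]]] //=; rewrite ?nth_nil.
move=> /develops_covers; apply: (covers_map (g := fun p => (p.2 %% 3, p.2 %/ 3))).
- by move=> [j a] [k b]; rewrite /in_mem /= !val => ? ? [? ?]; congr pair; lia.
- by move=> [j a]; rewrite val part /=; lia.
move=> [i u] [i' u'] /=; rewrite !part => -[h h' ne].
exists (0, 3 * u + i), (0, 3 * u' + i'); split=> /=.
- by congr pair; lia.
- by congr pair; lia.
by left; split; rewrite ?val //= /orbit_length /=; lia.
Qed.

(** The residue classes modulo 3 of the full orbit are the parts of size 30; two orbits of length 30
    form the part of size 60. *)
Lemma cover_30_30_30_60 bs :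
  develops es 90 1 [:: 90; 30; 30] (fun _ k d => (0 < k) || (d %% 3 != 0)) bs ->
  multipartite_cover es [:: 30; 30; 30; 60] (90 * size bs).
Proof.
have val j a : valid_point [:: 90; 30; 30] (j, a) = ((j == 0) && (a < 90)) || ((0 < j < 3) && (a < 30)).
  by rewrite /valid_point /orbit_length; case: j => [|[|[|j]]] //=; rewrite ?nth_nil ?orbF.
have part i u : (u < nth 0 [:: 30; 30; 30; 60] i) = ((i < 3) && (u < 30)) || ((i == 3) && (u < 60)).
  by case: i => [|[|[|[|i]]]] //=; rewrite ?nth_nil ?orbF.
pose g (p : nat * nat) := if p.1 == 0 then (p.2 %% 3, p.2 %/ 3) else (3, 30 * (p.1 - 1) + p.2).
pose pt j c := if j == 3 then (if c < 30 then (1, c) else (2, c - 30)) else (0, 3 * c + j).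
have ptv j c : c < nth 0 [:: 30; 30; 30; 60] j -> valid_point [:: 90; 30; 30] (pt j c).
  by rewrite part /pt => h; do ?[case: ifP => ?]; rewrite val; lia.
have gpt j c : c < nth 0 [:: 30; 30; 30; 60] j -> g (pt j c) = (j, c).
  rewrite part /g /pt => h; case: (eqVneq j 3) => j3; last by rewrite /=; congr pair; lia.
  by case: (ltnP c 30) => c3; rewrite /=; congr pair; lia.
move=> /develops_covers; apply: (covers_map (g := g)).
- move=> [j a] [k b]; rewrite /in_mem /= !val /g /= => ? ?.
  by case: ifP => ?; case: ifP => ? [] *; congr pair; lia.
- by move=> [j a]; rewrite val /g /=; case: ifP => ? ?; rewrite part /=; lia.
move=> [i u] [i' u'] /= [h h' ne]; exists (pt i u), (pt i' u'); rewrite !gpt //; split=> //.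
have v := ptv i u h; have v' := ptv i' u' h'; rewrite !part in h h'.
have [iE|iE] := eqVneq i 3; [right | left]; split=> //.
- by rewrite /pt ifN //; lia.
- by apply/orP; left; rewrite /pt iE eqxx; case: ifP.
- by rewrite /pt ifN.
have [i3|i3] := eqVneq i' 3; first by apply/orP; left; rewrite /pt i3 eqxx; case: ifP.
by rewrite /pt !ifN // /orbit_length /=; lia.
Qed.

Section ThirdPart.
Variables (N f : nat) (lens : seq nat) (w : nat).
Variables (allow : nat -> nat -> nat -> bool) (pt : nat -> nat -> nat * nat) (g : nat * nat -> nat * nat).
Hypothesis pt_valid : forall i u, u < nth 0 [:: 30; 30; w] i -> valid_point lens (pt i u).
Hypothesis ptK : forall i u, u < nth 0 [:: 30; 30; w] i -> g (pt i u) = (i, u).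
Hypothesis g_inj : forall p q, valid_point lens p -> valid_point lens q -> g p = g q -> p = q.
Hypothesis g_valid : forall p, valid_point lens p -> (g p).2 < nth 0 [:: 30; 30; w] (g p).1.
Hypothesis pt_full : forall i u, i < 2 -> u < 30 -> (pt i u).1 < f.
Hypothesis pt_allow : forall i u i' u', i < 2 -> u < 30 ->
  u' < nth 0 [:: 30; 30; w] i' -> i != i' ->
  allow (pt i u).1 (pt i' u').1 (((pt i' u').2 + (N - (pt i u).2)) %% orbit_length lens (pt i' u').1).

(** A pair between different parts has an end in one of the first two, which lie in full orbits; so
    the third part may consist of short ones. *)
Lemma third_part_cover bs : develops es N f lens allow bs ->
  multipartite_cover es [:: 30; 30; w] (N * size bs).
Proof.
move=> /develops_covers; apply: (covers_map (g := g)).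
- by move=> p q vp vq; apply: g_inj.
- exact: g_valid.
move=> [i u] [i' u'] /= [h h' ne]; exists (pt i u), (pt i' u'); rewrite !ptK //; split=> //.
have small j c : c < nth 0 [:: 30; 30; w] j -> j < 2 -> c < 30 by case: j => [|[|]].
have [i2|i2] := ltnP i 2.
  by left; split; [apply: pt_valid | apply: pt_valid | apply: pt_full (small _ _ h i2) | apply: pt_allow (small _ _ h i2) _ _].
have i2' : i' < 2.
  have le2 j c : c < nth 0 [:: 30; 30; w] j -> j <= 2 by case: j => [|[|[|j]]] //=; rewrite nth_nil.
  by have := le2 _ _ h; have := le2 _ _ h'; lia.
right; split; [exact: pt_valid | exact: pt_valid | exact: pt_full (small _ _ h' i2') |].
by apply: pt_allow (small _ _ h' i2') _ _ => //; rewrite eq_sym.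
Qed.

End ThirdPart.

Lemma cover_30_30_45 bs :
  develops es 60 1 [:: 60; 30; 15] (fun _ k d => (0 < k) || (d %% 2 != 0)) bs ->
  multipartite_cover es [:: 30; 30; 45] (60 * size bs).
Proof.
have val j a : valid_point [:: 60; 30; 15] (j, a) =
    [|| (j == 0) && (a < 60), (j == 1) && (a < 30) | (j == 2) && (a < 15)].
  by rewrite /valid_point /orbit_length; case: j => [|[|[|j]]] //=; rewrite ?nth_nil ?orbF.
have part i u : (u < nth 0 [:: 30; 30; 45] i) = ((i < 2) && (u < 30)) || ((i == 2) && (u < 45)).
  by case: i => [|[|[|i]]] //=; rewrite ?nth_nil ?orbF.
apply: (@third_part_cover _ _ _ _ _
  (fun i u => if i < 2 then (0, 2 * u + i) else if u < 30 then (1, u) else (2, u - 30))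
  (fun p => if p.1 == 0 then (p.2 %% 2, p.2 %/ 2) else (2, 30 * (p.1 - 1) + p.2))).
- by move=> i u; rewrite part => h; do ?[case: ifP => ?]; rewrite val; lia.
- move=> i u; rewrite part => h; case: (ltnP i 2) => i2; first by rewrite /=; congr pair; lia.
  by case: (ltnP u 30) => u3; rewrite /=; congr pair; lia.
- by move=> [j a] [k b]; rewrite !val /= => ? ?; case: ifP => ?; case: ifP => ? [] *; congr pair; lia.
- by move=> [j a]; rewrite val /=; case: ifP => ? ?; rewrite part /=; lia.
- by move=> i u i2 u30; rewrite i2.
move=> i u i' u' i2 u30; rewrite i2 part => h ne; case: ifP => h2; last by case: ifP.
by rewrite /orbit_length /=; lia.
Qed.

(** The 108 blocks are nine orbits of length 12. Five full orbits split by parity form the parts of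
    size 30, and [39 = 3 * 12 + 3]. *)
Lemma cover_30_30_39 bs :
  develops es 12 5 [:: 12; 12; 12; 12; 12; 12; 12; 12; 3] (fun _ k d => (4 < k) || (d %% 2 != 0)) bs ->
  multipartite_cover es [:: 30; 30; 39] (12 * size bs).
Proof.
have len j : orbit_length [:: 12; 12; 12; 12; 12; 12; 12; 12; 3] j = if j < 8 then 12 else if j == 8 then 3 else 0.
  by do 9 (case: j => [|j] //); rewrite /orbit_length /= nth_nil.
have val j a : valid_point [:: 12; 12; 12; 12; 12; 12; 12; 12; 3] (j, a) = ((j < 8) && (a < 12)) || ((j == 8) && (a < 3)).
  by rewrite /valid_point len /=; do ?case: ifP; lia.
have part i u : (u < nth 0 [:: 30; 30; 39] i) = ((i < 2) && (u < 30)) || ((i == 2) && (u < 39)).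
  by case: i => [|[|[|i]]] //=; rewrite ?nth_nil ?orbF.
apply: (@third_part_cover _ _ _ _ _
  (fun i u => if i < 2 then (u %/ 6, 2 * (u %% 6) + i) else (5 + u %/ 12, u %% 12))
  (fun p => if p.1 < 5 then (p.2 %% 2, 6 * p.1 + p.2 %/ 2) else (2, 12 * (p.1 - 5) + p.2))).
- by move=> i u; rewrite part; case: ifP => h; rewrite val; lia.
- by move=> i u; rewrite part => h; case: (ltnP i 2) => i2 /=; [case: ifP => ?; congr pair; lia | congr pair; lia].
- move=> [j a] [k b]; rewrite !val /= => vp vq; case: ifP => h1; case: ifP => h2 [] *; congr pair; lia.
- move=> [j a]; rewrite val /=; case: ifP => h1 h2; rewrite part /=; lia.
- by move=> i u i2 u30; rewrite i2 /=; lia.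
move=> i u i' u' i2 u30; rewrite i2 part len => h; have [h2|h2] := ltnP i' 2 => ne.
  by rewrite /= (_ : u' %/ 6 < 8); lia.
by apply/orP; left; rewrite /=; lia.
Qed.

Lemma cover_30_30_60 bs :
  develops es 30 2 [:: 30; 30; 30; 30] (fun j k _ => j != k) bs ->
  multipartite_cover es [:: 30; 30; 60] (30 * size bs).
Proof.
have val j a : valid_point [:: 30; 30; 30; 30] (j, a) = (j < 4) && (a < 30).
  by rewrite /valid_point /orbit_length; case: j => [|[|[|[|j]]]] //=; rewrite nth_nil.
have part i u : (u < nth 0 [:: 30; 30; 60] i) = ((i < 2) && (u < 30)) || ((i == 2) && (u < 60)).
  by case: i => [|[|[|i]]] //=; rewrite ?nth_nil ?orbF.
apply: (@third_part_cover _ _ _ _ _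
  (fun i u => if i < 2 then (i, u) else (2 + u %/ 30, u %% 30))
  (fun p => if p.1 < 2 then p else (2, 30 * (p.1 - 2) + p.2))).
- by move=> i u; rewrite part; case: ifP => h; rewrite val; lia.
- move=> i u; rewrite part => h; case: (ltnP i 2) => i2 /=; first by rewrite i2.
  by congr pair; lia.
- move=> [j a] [k b]; rewrite !val /= => vp vq; case: ifP => h1; case: ifP => h2 [] *; congr pair; lia.
- move=> [j a]; rewrite val /=; case: ifP => h1 h2; rewrite part /=; lia.
- by move=> i u i2 u30; rewrite i2 /=; lia.
move=> i u i' u' i2 u30; rewrite i2 part /= => h; case: ifP => h2 /=; lia.
Qed.

(** * Complete graphs from groups filled with smaller complete graphs *)

Definition in_group (n q e i x : nat) : bool :=
  (i * q <= x < i * q + q) || ((e == 1) && (x == n.-1)).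

Lemma group_cover n u q e k : e <= 1 -> u * q + e <= n -> complete_cover es (q + e) k ->
  covers es (fun x : nat => x < n) (fun x y => exists2 i, i \in iota 0 u &
    [/\ x != y, in_group n q e i x & in_group n q e i y]) (u * k).
Proof.
move=> e1 un ck; rewrite -[X in X * k](size_iota 0 u) -sum_const_seq; apply: covers_seq => i.
rewrite mem_iota => /= iu; have iq : i * q + q <= u * q by rewrite -mulSnr leq_mul2r iu orbT.
apply: (covers_map (g := fun x => if x < q then i * q + x else n.-1) _ _ _ ck).
- by move=> x y; rewrite /in_mem /= => xq yq; case: ifP; case: ifP; lia.
- by move=> x xq; case: ifP; lia.
move=> x y [xy hx hy].
have pre z : in_group n q e i z -> exists2 t, t < q + e & (if t < q then i * q + t else n.-1) = z.
  case/orP => [h|/andP[/eqP e_1 /eqP->]]; first by exists (z - i * q); [|rewrite ifT]; lia.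
  by exists q; rewrite ?ltnn // e_1 addn1.
have [t tq tx] := pre x hx; have [s sq sy] := pre y hy.
exists t, s; split=> //; left; split=> //; apply: contra xy => /eqP ts.
by rewrite -tx -sy ts.
Qed.

(** [145 = 6 * 24 + 1]: the last point completes each group to K_25, and the groups are the residue
    classes modulo 6 of the cyclic group of order 144. *)
Lemma complete145 bs k : complete_cover es 25 k ->
  develops es 144 1 [:: 144] (fun _ _ d => d %% 6 != 0) bs ->
  complete_cover es 145 (6 * k + 144 * size bs).
Proof.
move=> c25 /develops_covers dv.
have gc := group_cover (n := 145) (u := 6) (q := 24) (e := 1) isT isT c25.
have pc : covers es (fun x : nat => x < 145)
    (fun x y => [/\ x < 144, y < 144 & x %/ 24 != y %/ 24]) (144 * size bs).
  apply: (covers_map (g := fun p : nat * nat => p.2 %% 6 * 24 + p.2 %/ 6) _ _ _ dv).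
  - by move=> [[|j] a] [[|j'] b]; rewrite /in_mem /valid_point /orbit_length //= ?nth_nil //= => *; congr pair; lia.
  - by move=> [[|j] a]; rewrite /valid_point /orbit_length //= ?nth_nil //=; lia.
  move=> x y [xn yn xy]; exists (0, x %% 24 * 6 + x %/ 24), (0, y %% 24 * 6 + y %/ 24); split=> /=; try lia.
  by left; split=> //=; rewrite /valid_point /orbit_length /=; lia.
apply: eq_covers (covers_union gc pc) => // x y [xn yn xy].
have [h|h] := boolP [&& x < 144, y < 144 & x %/ 24 != y %/ 24]; first by right; apply/and3P.
left; exists (if x < 144 then x %/ 24 else y %/ 24); first by rewrite mem_iota; case: ifP; lia.
by rewrite /in_group /=; split=> //; case: ifP; lia.
Qed.

Lemma complete160 bs k : complete_cover es 40 k ->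
  develops es 160 1 [:: 160] (fun _ _ d => d %% 4 != 0) bs ->
  complete_cover es 160 (4 * k + 160 * size bs).
Proof.
move=> c40 /develops_covers dv.
have gc := group_cover (n := 160) (u := 4) (q := 40) (e := 0) isT isT c40.
have pc : covers es (fun x : nat => x < 160)
    (fun x y => [/\ x < 160, y < 160 & x %/ 40 != y %/ 40]) (160 * size bs).
  apply: (covers_map (g := fun p : nat * nat => p.2 %% 4 * 40 + p.2 %/ 4) _ _ _ dv).
  - by move=> [[|j] a] [[|j'] b]; rewrite /in_mem /valid_point /orbit_length //= ?nth_nil //= => *; congr pair; lia.
  - by move=> [[|j] a]; rewrite /valid_point /orbit_length //= ?nth_nil //=; lia.
  move=> x y [xn yn xy]; exists (0, x %% 40 * 4 + x %/ 40), (0, y %% 40 * 4 + y %/ 40); split=> /=; try lia.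
  by left; split=> //=; rewrite /valid_point /orbit_length /=; lia.
apply: eq_covers (covers_union gc pc) => // x y [xn yn xy].
have [h|h] := eqVneq (x %/ 40) (y %/ 40); last by right.
by left; exists (x %/ 40); rewrite ?mem_iota /in_group /=; [|split=> //]; lia.
Qed.

Lemma complete100 bs k : complete_cover es 25 k ->
  develops es 25 4 [:: 25; 25; 25; 25] (fun j k _ => j != k) bs ->
  complete_cover es 100 (4 * k + 25 * size bs).
Proof.
move=> c25 /develops_covers dv.
have val j a : valid_point [:: 25; 25; 25; 25] (j, a) = (j < 4) && (a < 25).
  by rewrite /valid_point /orbit_length; case: j => [|[|[|[|j]]]] //=; rewrite nth_nil.
have gc := group_cover (n := 100) (u := 4) (q := 25) (e := 0) isT isT c25.
have pc : covers es (fun x : nat => x < 100)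
    (fun x y => [/\ x < 100, y < 100 & x %/ 25 != y %/ 25]) (25 * size bs).
  apply: (covers_map (g := fun p : nat * nat => p.1 * 25 + p.2) _ _ _ dv).
  - by move=> [j a] [j' b]; rewrite /in_mem /= !val => *; congr pair; lia.
  - by move=> [j a]; rewrite val /=; lia.
  move=> x y [xn yn xy]; exists (x %/ 25, x %% 25), (y %/ 25, y %% 25); split=> /=; try lia.
  by left; split; rewrite ?val //=; lia.
apply: eq_covers (covers_union gc pc) => // x y [xn yn xy].
have [h|h] := eqVneq (x %/ 25) (y %/ 25); last by right.
by left; exists (x %/ 25); rewrite ?mem_iota /in_group /=; [|split=> //]; lia.
Qed.

(** [136 = 4 * 24 + 40]: the point 135 belongs to the group of 40 and completes every group of 24 to
    K_25. There remains the multipartite graph with parts 24, 24, 24, 24, 39: the four equal parts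
    are the parity classes of two orbits of length 48, and [39 = 24 + 12 + 3]. *)
Lemma complete136 bs k k' : complete_cover es 25 k -> complete_cover es 40 k' ->
  develops es 48 2 [:: 48; 48; 24; 12; 3] (fun j k d => (j != k) || (d %% 2 != 0)) bs ->
  complete_cover es 136 (4 * k + k' + 48 * size bs).
Proof.
move=> c25 c40 /develops_covers dv.
have len j : orbit_length [:: 48; 48; 24; 12; 3] j =
    if j < 2 then 48 else if j == 2 then 24 else if j == 3 then 12 else if j == 4 then 3 else 0.
  by rewrite /orbit_length; case: j => [|[|[|[|[|j]]]]] //=; rewrite nth_nil.
have val j a : valid_point [:: 48; 48; 24; 12; 3] (j, a) = [|| (j < 2) && (a < 48), (j == 2) && (a < 24),
    (j == 3) && (a < 12) | (j == 4) && (a < 3)].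
  by rewrite /valid_point len /=; do ?case: ifP; lia.
have gc := group_cover (n := 136) (u := 4) (q := 24) (e := 1) isT isT c25.
have hc : covers es (fun x : nat => x < 136) (fun x y => [/\ 96 <= x < 136, 96 <= y < 136 & x != y]) k'.
  apply: (covers_map (g := fun x => 96 + x) _ _ _ c40).
  - by move=> x y _ _; lia.
  - by move=> x; lia.
  by move=> x y [xn yn xy]; exists (x - 96), (y - 96); split; try lia; left; split; lia.
pose start j := if j == 2 then 96 else if j == 3 then 120 else 132.
have pc : covers es (fun x : nat => x < 136)
    (fun x y => [/\ x < 96, y < 135 & x %/ 24 != y %/ 24]) (48 * size bs).
  apply: (covers_map (g := fun p : nat * nat =>
    if p.1 < 2 then (2 * p.1 + p.2 %% 2) * 24 + p.2 %/ 2 else start p.1 + p.2) _ _ _ dv).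
  - move=> [j a] [j' b]; rewrite /in_mem /= !val /start => h h'.
    by do ?[case: ifP => ?] => ?; congr pair; lia.
  - by move=> [j a]; rewrite val /start /=; do ?[case: ifP => ?]; lia.
  pose pt x := if x < 96 then (x %/ 24 %/ 2, x %% 24 * 2 + x %/ 24 %% 2) else
    if x < 120 then (2, x - 96) else if x < 132 then (3, x - 120) else (4, x - 132).
  have gpt x : x < 135 -> (if (pt x).1 < 2 then (2 * (pt x).1 + (pt x).2 %% 2) * 24 + (pt x).2 %/ 2
      else start (pt x).1 + (pt x).2) = x.
    rewrite /pt /start => xn; have [h1|h1] := ltnP x 96; first by rewrite /=; case: ifP; lia.
    by have [h2|h2] := ltnP x 120; last have [h3|h3] := ltnP x 132; rewrite /=; lia.
  have vpt x : x < 135 -> valid_point [:: 48; 48; 24; 12; 3] (pt x).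
    by rewrite /pt; do ?[case: ifP => ? /=]; rewrite val; lia.
  move=> x y [xn yn xy]; exists (pt x), (pt y); rewrite !gpt //; try lia; split=> //.
  left; split; try by apply: vpt; lia.
    by rewrite /pt xn /=; lia.
  rewrite len /pt xn; have [y1|y1] := ltnP y 96.
    by rewrite /= (_ : y %/ 24 %/ 2 < 2); lia.
  apply/orP; left.
  by have [h2|h2] := ltnP y 120; last have [h3|h3] := ltnP y 132; rewrite /=; lia.
have un : covers es (fun x : nat => x < 136)
    (fun x y => [/\ x < 96, y < 135 & x %/ 24 != y %/ 24] \/ [/\ y < 96, x < 135 & y %/ 24 != x %/ 24])
    (48 * size bs).
  apply: (covers_map (g := id) _ _ _ pc) => // x y hxy; exists x, y; split=> //.
apply: eq_covers (covers_union (covers_union gc hc) un) => // x y [xn yn xy].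
have [hx|hx] := leqP 96 x; have [hy|hy] := leqP 96 y.
- by left; right; split=> //; lia.
- have [y1|y1] := eqVneq x 135; last by right; right; split=> //; lia.
  left; left; exists (y %/ 24); first by rewrite mem_iota; lia.
  by rewrite /in_group /=; split=> //; lia.
- have [y1|y1] := eqVneq y 135; last by right; left; split=> //; lia.
  left; left; exists (x %/ 24); first by rewrite mem_iota; lia.
  by rewrite /in_group /=; split=> //; lia.
have [h|h] := eqVneq (x %/ 24) (y %/ 24); last by right; left; split=> //; lia.
left; left; exists (x %/ 24); first by rewrite mem_iota; lia.
by rewrite /in_group /=; split=> //; lia.
Qed.

End Ingredients.

(** * From the ingredients to all admissible orders *)

Definition exact_cover es n := exists2 m, 60 * m = n * (n - 1) & complete_cover es n m.

Lemma bose_count w1 w2 q k : 60 * k = (1 + w1 + w2) * (1 + w1 + w2 - 1) ->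
  60 * (q * (3 * (121 + 2 * w1 + 2 * w2)) + q * (q - 1) * 540 + 2 * q * 90 + k) =
  (1 + w1 + w2 + 60 * (3 * q + 0)) * (1 + w1 + w2 + 60 * (3 * q + 0) - 1).
Proof. by case: q => [|q]; nia. Qed.

Lemma bose_fan_count w1 w2 q k : 60 * k = (1 + w1 + w2 + 60) * (1 + w1 + w2 + 60 - 1) ->
  60 * (q * (3 * (121 + 2 * w1 + 2 * w2)) + q * (q - 1) * 540 + 2 * q * 270 + k) =
  (1 + w1 + w2 + 60 * (3 * q + 1)) * (1 + w1 + w2 + 60 * (3 * q + 1) - 1).
Proof. by case: q => [|q]; nia. Qed.

Lemma skolem_count w1 w2 q k : 60 * k = (1 + w1 + w2) * (1 + w1 + w2 - 1) ->
  60 * ((3 * q.+1 - 1) * (121 + 2 * w1 + 2 * w2) +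
    270 * ((q.+1 - 1) * (q.+1 - 2) + q.+1 * (q.+1 - 1) + (q.+1 - 1)) + 90 * (q.+1 - 1) + k) =
  (1 + w1 + w2 + 60 * (3 * q + 2)) * (1 + w1 + w2 + 60 * (3 * q + 2) - 1).
Proof.
have -> : 1 + w1 + w2 - 1 = w1 + w2 by lia.
have -> : 1 + w1 + w2 + 60 * (3 * q + 2) - 1 = w1 + w2 + 60 * (3 * q + 2) by lia.
have -> : 3 * q.+1 - 1 = 3 * q + 2 by lia.
case: q => [|q]; first by move=> *; lia.
have -> : q.+2 - 1 = q.+1 by lia.
have -> : q.+2 - 2 = q by lia.
by move=> *; lia.
Qed.

(** Beyond the first line the Bose system has [6 q] fibres of size 30, hence [180 q] vertices, and
    its extra fibre adds 60. The Skolem system with [m = q + 1] has [6 q + 4] such fibres, hence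
    [180 q + 120] vertices. This serves the three residues of [t] modulo 3. *)
Lemma all_orders es w1 w2 : 0 < w1 -> 0 < w2 ->
  multipartite_cover es [:: 30; 30; 30] 90 -> multipartite_cover es [:: 30; 30; 30; 60] 270 ->
  complete_cover es 61 61 ->
  multipartite_cover es [:: 30; 30; w1] (30 + 2 * w1) ->
  multipartite_cover es [:: 30; 30; w2] (30 + 2 * w2) ->
  exact_cover es (1 + w1 + w2) -> exact_cover es (1 + w1 + w2 + 60) ->
  forall t, exact_cover es (1 + w1 + w2 + 60 * t).
Proof.
move=> w1p w2p c30 cfan c61 cw1 cw2 [k0 k0E ck0] [k1 k1E ck1] t.
pose q := t %/ 3; have tE : t = 3 * q + t %% 3 by rewrite /q; lia.
have S3 : special_cost w1 w2 0 + special_cost w1 w2 1 + special_cost w1 w2 2 = 121 + 2 * w1 + 2 * w2.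
  by rewrite /=; lia.
have col winf h : 0 < h < 2 * q + 1 -> forall i, i < 3 ->
    ordinary w1 w2 (3 * (2 * q + 1)) winf (3 * h + i).
  by move=> hq i i3; apply: ordinary_point.
case r: (t %% 3) tE => [|[|[|r3]]] tE; last by have := ltn_pmod t (isT : 0 < 3); rewrite r; lia.
- have E : fibre_start w1 w2 (3 * (2 * q + 1)) + 0 = 1 + w1 + w2 + 60 * (3 * q + 0).
    by rewrite fibre_startE; lia.
  rewrite tE -E; eexists; last apply: (@bose_complete es w1 w2 0 q c30 c61 cw1 cw2 90 k0).
  + by rewrite E S3; apply: bose_count.
  + move=> h hq; have p := col 0 h hq; have p0 := p 0 isT; rewrite addn0 in p0.
    by apply: ordinary_line; rewrite ?p //= ?inE; lia.
  + by apply: first_line => //; lia.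
- have E : fibre_start w1 w2 (3 * (2 * q + 1)) + 60 = 1 + w1 + w2 + 60 * (3 * q + 1).
    by rewrite fibre_startE; lia.
  rewrite tE -E; eexists; last apply: (@bose_complete es w1 w2 60 q c30 c61 cw1 cw2 270 k1).
  + by rewrite E S3; apply: bose_fan_count.
  + move=> h hq; have p i (i3 : i < 3) : fibre_size w1 w2 (3 * (2 * q + 1)) 60 (3 * h + i) = 30.
      by apply/eqP; have /and3P[] := col 60 h hq i i3.
    have p0 := p 0 isT; rewrite addn0 in p0.
    apply: multipartite_line => /=; rewrite ?inE ?p0 ?p ?fibre_size_inf //; lia.
  + by apply: first_line_inf => //; lia.
have E : fibre_start w1 w2 (3 * (2 * q.+1)) + 30 = 1 + w1 + w2 + 60 * (3 * q + 2).
  by rewrite fibre_startE; lia.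
rewrite tE -E; eexists; last apply: (@skolem_complete es w1 w2 q.+1 isT c30 c61 cw1 cw2 k0).
+ by rewrite E S3; apply: skolem_count.
+ by apply: first_line => //; lia.
Qed.

(* Base blocks, one field per group divisible ingredient; the entry [p] of a
   block stands for the point [p %% N] of the orbit [p %/ N], with [N] the order
   of the cyclic group used for that ingredient. *)
Record kit := Kit {
  kit_30_30_30 : seq (seq BinNums.N);
  kit_30_30_30_60 : seq (seq BinNums.N);
  kit_30_30_39 : seq (seq BinNums.N);
  kit_30_30_45 : seq (seq BinNums.N);
  kit_30_30_60 : seq (seq BinNums.N);
  kit25 : seq (seq BinNums.N);
  kit40 : seq (seq BinNums.N);
  kit61 : seq (seq BinNums.N);
  kit76 : seq (seq BinNums.N);
  kit85 : seq (seq BinNums.N);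
  kit121 : seq (seq BinNums.N);
  kit100 : seq (seq BinNums.N);
  kit136 : seq (seq BinNums.N);
  kit145 : seq (seq BinNums.N);
  kit160 : seq (seq BinNums.N)
}.

Definition generates es N f lens allow (k : nat) (bs : seq (seq BinNums.N)) : bool :=
  develops es N f lens allow (map (map (decode N)) bs) && (size bs == k).

(** Each number of base blocks is forced: the number of edges to be covered, divided by 30 and by
    the order of the group. *)
Definition kit_ok es (K : kit) : bool :=
  [&& [&& generates es 90 1 [:: 90] (fun _ _ d => d %% 3 != 0) 1 (kit_30_30_30 K),
      generates es 90 1 [:: 90; 30; 30] (fun _ k d => (0 < k) || (d %% 3 != 0)) 3 (kit_30_30_30_60 K),
      generates es 12 5 [:: 12; 12; 12; 12; 12; 12; 12; 12; 3]
        (fun _ k d => (4 < k) || (d %% 2 != 0)) 9 (kit_30_30_39 K),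
      generates es 60 1 [:: 60; 30; 15] (fun _ k d => (0 < k) || (d %% 2 != 0)) 2 (kit_30_30_45 K) &
      generates es 30 2 [:: 30; 30; 30; 30] (fun j k _ => j != k) 5 (kit_30_30_60 K)],
  [&& generates es 5 5 (nseq 5 5 ++ nseq 0 1) distinct_code 2 (kit25 K),
      generates es 13 3 (nseq 3 13 ++ nseq 1 1) distinct_code 2 (kit40 K),
      generates es 61 1 (nseq 1 61 ++ nseq 0 1) distinct_code 1 (kit61 K),
      generates es 19 4 (nseq 4 19 ++ nseq 0 1) distinct_code 5 (kit76 K) &
      generates es 17 5 (nseq 5 17 ++ nseq 0 1) distinct_code 7 (kit85 K)] &
  [&& generates es 121 1 (nseq 1 121 ++ nseq 0 1) distinct_code 2 (kit121 K),
      generates es 25 4 [:: 25; 25; 25; 25] (fun j k _ => j != k) 5 (kit100 K),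
      generates es 48 2 [:: 48; 48; 24; 12; 3] (fun j k d => (j != k) || (d %% 2 != 0)) 5 (kit136 K),
      generates es 144 1 [:: 144] (fun _ _ d => d %% 6 != 0) 2 (kit145 K) &
      generates es 160 1 [:: 160] (fun _ _ d => d %% 4 != 0) 2 (kit160 K)]].

Lemma generates_develops es N f lens allow k bs : generates es N f lens allow k bs ->
  exists2 bs', develops es N f lens allow bs' & size bs' = k.
Proof. by case/andP => h /eqP <-; exists (map (map (decode N)) bs); rewrite ?size_map. Qed.

(** The four series start at [61 = 1 + 30 + 30], [76 = 1 + 45 + 30], [85 = 1 + 39 + 45] and
    [100 = 1 + 39 + 60]; the smaller orders 1, 25 and 40 are treated singly. *)
Lemma kit_orders es K n : kit_ok es K -> n %% 60 \in [:: 1; 16; 25; 40] -> n <> 16 ->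
  exact_cover es n.
Proof.
case/and3P => /and5P[/generates_develops[b1 /cover_30_30_30 c30 s1] /generates_develops[b2 /cover_30_30_30_60 cfan s2]
  /generates_develops[b3 /cover_30_30_39 c39 s3] /generates_develops[b4 /cover_30_30_45 c45 s4]
  /generates_develops[b5 /cover_30_30_60 c60 s5]].
case/and5P => /generates_develops[b6 /complete_cyclic c25 s6] /generates_develops[b7 /complete_cyclic c40 s7]
  /generates_develops[b8 /complete_cyclic c61 s8] /generates_develops[b9 /complete_cyclic c76 s9]
  /generates_develops[b10 /complete_cyclic c85 s10].
case/and5P => /generates_develops[b11 /complete_cyclic c121 s11] /generates_develops[b12 d100 s12]
  /generates_develops[b13 d136 s13] /generates_develops[b14 d145 s14] /generates_develops[b15 d160 s15].
have {}c25 : complete_cover es 25 10 by have := c25 isT isT; rewrite s6.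
have {}c40 : complete_cover es 40 26 by have := c40 isT isT; rewrite s7.
have {}c61 : complete_cover es 61 61 by have := c61 isT isT; rewrite s8.
have {}c76 : complete_cover es 76 95 by have := c76 isT isT; rewrite s9.
have {}c85 : complete_cover es 85 119 by have := c85 isT isT; rewrite s10.
have {}c121 : complete_cover es 121 242 by have := c121 isT isT; rewrite s11.
have {d100} c100 : complete_cover es 100 165 by have := complete100 c25 d100; rewrite s12.
have {d136} c136 : complete_cover es 136 306 by have := complete136 c25 c40 d136; rewrite s13.
have {d145} c145 : complete_cover es 145 348 by have := complete145 c25 d145; rewrite s14.
have {d160} c160 : complete_cover es 160 424 by have := complete160 c40 d160; rewrite s15.
rewrite s1 in c30; rewrite s2 in cfan; rewrite s3 in c39; rewrite s4 in c45; rewrite s5 in c60.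
have orders w1 w2 := @all_orders es w1 w2.
have c1 : exact_cover es 1.
  by exists 0 => //; apply: covers0 => x y []; case: x => //; case: y.
have nE : n = n %/ 60 * 60 + n %% 60 := divn_eq n 60.
have tail n0 m : n0 %% 60 = n %% 60 -> n0 <= n + 59 -> n0 <= n -> m = n0 -> (forall t, exact_cover es (m + 60 * t)) ->
    exact_cover es n.
  move=> E _ le -> h; have := h ((n - n0) %/ 60).
  by rewrite (_ : n0 + 60 * ((n - n0) %/ 60) = n) //; lia.
rewrite !inE => /or4P[]/eqP r n16.
- have [n1|n1] := leqP n 60; first by rewrite (_ : n = 1) //; lia.
  apply: (tail 61 (1 + 30 + 30)); rewrite ?r //; try lia.
  by apply: orders => //; [exists 61 | exists 242].
- have [n1|n1] := leqP n 75; first by lia.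
  apply: (tail 76 (1 + 45 + 30)); rewrite ?r //; try lia.
  by apply: orders => //; [exists 95 | exists 306].
- have [n1|n1] := leqP n 84; first by rewrite (_ : n = 25); [exists 10 | lia].
  apply: (tail 85 (1 + 39 + 45)); rewrite ?r //; try lia.
  by apply: orders => //; [exists 119 | exists 348].
have [n1|n1] := leqP n 99; first by rewrite (_ : n = 40); [exists 26 | lia].
apply: (tail 100 (1 + 39 + 60)); rewrite ?r //; try lia.
by apply: orders => //; [exists 165 | exists 424].
Qed.

Definition table_edges (t : seq vrec) : seq (nat * nat) :=
  [seq (index e.1 labels, index e.2 labels) | e <- back_edges t].

(** * Base blocks for the six snarks *)

Open Scope N_scope.

Definition kit_snark1 : kit := Kit
  [:: [:: 66;49;57;35;28;43;81;86;0;59;47;42;67;76;21;39;11;26;75;61]]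
  [:: [:: 180;14;48;115;71;80;84;200;87;18;30;12;101;195;35;41;205;109;82;11];
   [:: 80;119;54;187;70;205;86;102;20;3;19;48;207;37;2;42;193;67;65;61];
   [:: 54;23;15;31;115;97;78;29;106;13;21;44;82;190;114;46;55;27;107;193]]
  [:: [:: 58;93;32;53;97;55;56;31;40;48;50;54;94;29;34;36;88;37;91;45];
   [:: 65;22;31;62;32;3;11;44;49;89;74;63;16;56;15;82;66;2;53;13];
   [:: 77;10;43;74;44;15;23;32;49;95;62;75;4;56;3;70;78;14;53;1];
   [:: 90;2;17;89;26;50;80;84;39;73;77;72;21;48;18;31;96;83;28;34];
   [:: 84;14;5;95;38;50;68;90;27;61;65;60;9;48;6;43;96;71;40;46];
   [:: 60;26;1;90;32;49;13;40;17;76;67;88;30;44;45;9;86;63;28;23];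
   [:: 72;38;13;84;44;49;1;28;5;64;79;94;42;32;33;21;92;75;40;11];
   [:: 0;86;6;79;33;67;37;82;7;69;3;51;56;14;1;41;70;96;8;40];
   [:: 12;92;18;67;45;79;25;70;19;81;15;51;56;2;13;29;82;96;20;28]]
  [:: [:: 28;62;52;68;47;31;40;79;3;12;130;133;25;29;24;6;134;65;51;41];
   [:: 46;65;45;126;13;122;56;75;11;26;34;40;71;73;47;7;4;16;87;82]]
  [:: [:: 69;1;45;84;9;56;77;8;7;92;74;101;30;10;102;44;46;117;52;5];
   [:: 87;1;51;72;9;32;65;8;7;110;62;119;36;10;90;50;52;105;58;5];
   [:: 75;1;57;60;9;38;83;8;7;98;80;107;42;10;108;56;58;93;34;5];
   [:: 63;1;33;78;9;44;71;8;7;116;68;95;48;10;96;32;34;111;40;5];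
   [:: 81;1;39;66;9;50;89;8;7;104;86;113;54;10;114;38;40;99;46;5]]
  [:: [:: 13;12;6;2;22;3;19;4;7;16;15;9;18;24;10;0;23;14;5;1];
   [:: 2;14;24;23;15;0;18;22;9;6;16;19;20;13;4;10;12;21;8;7]]
  [:: [:: 17;26;4;12;8;7;2;19;1;29;23;25;33;31;20;6;0;18;21;28];
   [:: 29;24;31;12;2;34;20;17;5;38;30;1;13;15;28;9;16;35;32;39]]
  [:: [:: 35;0;23;47;39;3;7;36;32;55;33;43;58;57;38;48;10;51;50;37]]
  [:: [:: 37;43;10;18;49;23;66;70;63;3;27;74;40;46;55;71;69;1;41;50];
   [:: 39;0;35;66;50;40;71;37;74;61;36;54;57;28;60;46;70;27;3;24];
   [:: 57;2;27;20;74;37;6;35;58;52;8;1;15;7;34;51;56;16;65;3];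
   [:: 70;7;60;72;16;43;44;13;20;64;1;33;56;50;22;18;9;68;19;30];
   [:: 16;45;0;27;36;40;43;22;71;56;32;49;19;61;7;15;30;12;53;66]]
  [:: [:: 72;52;33;0;21;27;78;65;37;4;73;77;47;66;13;60;40;70;79;39];
   [:: 13;43;12;17;42;20;57;77;41;21;46;69;59;29;58;72;66;73;10;32];
   [:: 15;52;35;12;4;14;62;46;83;81;65;27;18;13;58;69;2;41;26;74];
   [:: 44;80;11;79;55;31;13;57;56;22;18;75;10;38;53;33;78;74;70;16];
   [:: 84;49;52;47;14;1;31;82;51;9;63;46;48;70;36;68;20;54;28;5];
   [:: 0;49;21;35;74;26;36;44;69;58;46;25;55;17;37;32;27;52;73;20];
   [:: 14;35;43;67;40;52;37;4;0;70;5;16;53;60;24;2;27;59;17;9]]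
  [:: [:: 5;79;17;1;90;54;10;52;91;113;118;60;103;64;25;62;18;36;16;4];
   [:: 9;30;5;92;93;86;106;97;54;82;83;16;101;115;84;47;114;8;41;74]]
  [:: [:: 0;42;57;15;92;99;78;44;88;51;73;11;22;32;98;81;74;38;93;83];
   [:: 13;45;1;40;63;50;74;60;51;0;5;29;27;18;24;30;39;87;43;53];
   [:: 44;17;71;23;78;91;74;92;69;20;60;43;8;2;63;27;5;1;79;84];
   [:: 98;65;33;78;7;40;49;2;47;56;11;57;51;84;89;32;67;23;93;48];
   [:: 78;3;72;82;13;18;38;97;31;99;86;41;56;69;30;44;94;11;71;51]]
  [:: [:: 22;87;2;48;118;74;151;119;193;63;154;85;45;80;6;18;7;53;37;4];
   [:: 97;49;151;52;67;56;110;90;61;146;24;75;95;27;39;147;113;4;31;9];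
   [:: 0;87;98;60;146;76;192;66;117;44;29;53;14;34;39;3;26;57;115;84];
   [:: 50;20;58;8;57;71;89;17;53;56;1;27;149;115;72;48;0;28;98;103];
   [:: 23;108;55;13;105;98;68;149;115;56;8;78;113;81;2;45;7;88;27;44]]
  [:: [:: 60;15;88;86;87;117;43;39;4;98;127;50;134;10;76;74;135;97;101;115];
   [:: 133;33;11;72;63;94;64;16;118;55;137;60;9;35;30;141;86;49;8;136]]
  [:: [:: 73;46;155;24;99;135;109;96;93;20;90;153;87;143;50;94;128;148;91;67];
   [:: 54;1;40;82;67;61;103;10;125;42;126;155;33;122;24;153;146;130;53;36]].

Definition kit_snark2 : kit := Kit
  [:: [:: 17;66;70;18;49;73;2;42;34;56;68;63;83;67;46;78;38;48;0;35]]
  [:: [:: 73;60;185;190;14;50;181;89;61;7;186;44;117;99;54;12;183;58;38;2];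
   [:: 55;77;185;3;58;69;40;66;35;115;110;51;116;32;2;8;106;70;52;98];
   [:: 190;24;25;6;206;63;197;105;31;28;14;4;184;26;96;107;68;56;21;43]]
  [:: [:: 50;14;53;88;3;74;1;97;52;54;11;92;19;84;56;89;48;68;49;17];
   [:: 0;21;78;39;87;66;6;24;83;17;19;82;48;93;32;64;56;85;35;36];
   [:: 12;9;66;27;93;78;18;36;71;5;7;70;48;87;44;76;56;91;47;24];
   [:: 7;1;65;28;81;6;69;50;84;39;67;36;13;24;51;2;55;16;60;85];
   [:: 19;13;77;40;69;18;81;50;90;27;79;24;1;36;51;14;55;4;72;91];
   [:: 90;69;10;4;21;51;38;80;45;40;46;31;82;98;75;72;24;26;13;17];
   [:: 84;81;22;16;9;51;26;68;33;28;34;43;70;98;63;60;36;38;1;5];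
   [:: 29;45;91;28;71;42;84;38;97;53;13;3;8;16;56;63;30;75;69;41];
   [:: 41;33;85;40;83;30;90;26;97;53;1;15;20;4;56;75;42;63;81;29]]
  [:: [:: 61;56;1;22;131;28;72;71;23;54;64;17;85;5;59;3;0;34;87;122];
   [:: 36;122;27;65;46;59;38;64;52;19;83;23;120;75;42;3;134;35;11;22]]
  [:: [:: 58;73;18;98;7;107;10;71;6;39;43;49;117;2;85;8;72;4;56;112];
   [:: 12;14;108;74;55;33;98;41;29;62;114;56;81;24;7;36;113;53;37;66];
   [:: 0;85;33;80;41;86;7;87;39;3;10;116;11;58;57;79;34;93;90;22];
   [:: 47;14;81;116;32;13;87;23;42;70;102;51;68;43;31;2;101;9;16;104];
   [:: 103;4;30;5;75;16;92;65;34;55;76;32;117;2;15;43;12;59;105;118]]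
  [:: [:: 19;22;2;7;16;4;18;24;8;21;13;0;23;11;12;3;5;14;15;9];
   [:: 21;1;2;10;4;22;14;18;16;20;19;8;11;6;15;12;0;7;9;24]]
  [:: [:: 34;16;8;19;17;20;7;31;22;1;3;6;18;5;37;13;33;36;30;39];
   [:: 0;19;32;29;25;33;14;8;13;36;37;3;6;15;35;2;17;4;27;9]]
  [:: [:: 42;51;56;15;32;3;14;25;43;33;18;37;46;20;50;34;30;44;10;8]]
  [:: [:: 15;18;20;4;34;40;33;47;0;7;22;49;68;61;10;56;32;72;9;8];
   [:: 58;44;51;66;68;37;11;69;35;32;63;21;25;14;62;13;15;20;75;45];
   [:: 58;1;68;0;33;42;7;3;39;66;53;29;12;11;61;24;43;5;52;62];
   [:: 31;72;24;12;21;30;60;67;54;42;19;65;50;47;51;35;37;73;17;57];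
   [:: 41;20;43;47;64;21;51;73;19;52;67;71;32;55;53;8;5;54;10;17]]
  [:: [:: 0;66;4;7;5;17;59;34;2;80;79;50;67;57;77;12;37;69;8;6];
   [:: 46;77;83;48;49;52;6;84;60;74;58;82;0;23;61;26;54;78;43;57];
   [:: 30;79;84;68;44;77;57;81;37;47;27;18;61;63;34;48;15;26;72;11];
   [:: 49;14;82;21;27;1;80;53;34;23;32;41;56;12;20;22;66;19;39;68];
   [:: 0;13;23;21;39;54;16;26;74;1;4;58;22;65;3;68;53;37;32;25];
   [:: 35;64;43;47;7;82;55;26;2;84;10;71;58;44;19;45;39;0;3;22];
   [:: 79;1;9;75;19;54;40;62;61;21;58;50;63;48;76;38;24;17;32;74]]
  [:: [:: 68;107;26;79;108;78;9;113;115;36;25;17;50;64;99;28;21;93;16;43];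
   [:: 110;61;80;9;44;71;34;93;33;111;13;85;97;31;112;72;117;22;5;6]]
  [:: [:: 20;4;61;29;68;87;65;16;94;95;7;25;21;43;89;32;99;70;51;86];
   [:: 0;72;87;55;38;52;97;42;92;61;80;23;37;21;9;11;83;90;69;29];
   [:: 66;74;98;20;36;41;80;35;53;92;61;17;27;56;45;26;55;57;89;3];
   [:: 57;51;7;86;45;15;30;83;65;24;41;17;82;26;11;9;37;47;73;98];
   [:: 40;27;98;21;55;23;75;7;82;90;66;38;14;64;10;96;1;61;32;37]]
  [:: [:: 1;107;73;32;17;100;92;80;149;97;16;41;30;88;21;102;89;62;113;35];
   [:: 91;51;47;33;146;149;26;55;8;16;57;105;65;94;11;194;18;96;95;61];
   [:: 47;52;149;46;65;67;112;37;119;10;56;34;25;74;144;28;117;60;5;15];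
   [:: 107;6;60;11;49;38;87;20;90;70;41;45;192;97;115;34;68;14;77;51];
   [:: 0;105;62;19;79;145;5;67;153;109;90;71;54;81;65;29;149;39;84;110]]
  [:: [:: 62;105;142;55;34;85;0;87;10;59;17;110;125;92;61;75;19;108;30;73];
   [:: 34;81;127;29;32;8;91;118;43;24;130;95;75;141;114;49;136;76;71;89]]
  [:: [:: 62;6;83;53;103;31;84;45;8;116;132;99;89;2;113;66;1;138;87;139];
   [:: 30;73;3;16;71;91;80;9;67;112;86;11;28;83;32;133;8;62;50;40]].

Definition kit_snark3 : kit := Kit
  [:: [:: 82;70;65;36;11;89;42;30;88;1;75;41;34;51;20;54;63;23;43;25]]
  [:: [:: 97;201;30;9;10;33;20;79;115;53;181;82;8;86;182;32;56;25;63;100];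
   [:: 75;62;115;50;72;23;92;60;112;58;195;65;25;88;107;12;201;33;27;188];
   [:: 194;93;37;61;72;2;46;206;29;70;103;62;12;33;14;197;67;115;189;13]]
  [:: [:: 43;55;24;90;34;93;50;51;26;45;28;53;87;39;48;98;44;57;85;58];
   [:: 68;86;57;7;22;42;1;70;48;15;65;98;31;94;64;20;47;96;4;19];
   [:: 80;92;57;19;10;30;13;82;48;3;77;98;43;88;76;8;35;96;16;7];
   [:: 13;3;0;68;54;79;30;86;21;71;41;45;20;56;51;69;40;91;89;33];
   [:: 1;15;12;80;54;67;42;92;9;83;29;33;8;56;51;81;28;85;95;45];
   [:: 23;46;63;36;9;62;17;42;90;67;40;82;85;2;58;15;4;35;74;79];
   [:: 11;34;75;24;21;74;5;30;84;79;28;70;91;14;58;3;16;47;62;67];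
   [:: 0;33;62;45;61;91;22;43;46;10;17;59;73;81;55;74;83;14;38;37];
   [:: 12;45;74;33;73;85;10;31;34;22;5;59;61;69;55;62;71;2;26;25]]
  [:: [:: 6;87;19;126;35;70;58;120;12;76;7;55;16;121;48;68;26;128;11;51];
   [:: 52;39;70;53;20;87;34;3;121;76;25;17;69;55;49;28;24;59;79;74]]
  [:: [:: 0;63;35;92;3;65;34;61;31;64;2;93;40;4;6;30;37;12;91;94];
   [:: 0;81;41;116;3;83;40;79;37;82;2;117;46;4;6;36;43;12;115;118];
   [:: 0;69;47;110;3;71;46;67;43;70;2;111;52;4;6;42;49;12;109;112];
   [:: 0;87;53;104;3;89;52;85;49;88;2;105;58;4;6;48;55;12;103;106];
   [:: 0;75;59;98;3;77;58;73;55;76;2;99;34;4;6;54;31;12;97;100]]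
  [:: [:: 10;7;3;0;23;16;18;4;5;22;2;20;13;9;17;14;12;6;21;19];
   [:: 1;0;16;18;24;23;2;15;11;22;8;5;6;7;10;13;17;4;20;12]]
  [:: [:: 33;7;13;19;36;18;24;11;38;14;4;27;10;37;39;5;17;12;29;31];
   [:: 14;33;22;17;30;6;31;20;8;10;34;35;16;24;2;12;1;5;32;25]]
  [:: [:: 31;53;25;27;38;34;15;46;1;43;44;49;26;40;56;20;18;35;42;28]]
  [:: [:: 32;16;59;49;12;1;22;72;68;13;21;71;55;31;62;53;28;60;33;25];
   [:: 2;23;34;53;56;36;49;52;0;72;3;42;25;74;64;62;51;61;73;14];
   [:: 5;67;33;50;64;59;46;71;26;36;0;25;13;7;6;45;18;42;70;17];
   [:: 25;48;50;69;12;26;29;20;42;35;66;11;43;72;45;51;27;31;60;47];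
   [:: 34;61;22;10;8;24;66;12;17;0;65;54;39;52;75;5;55;44;14;2]]
  [:: [:: 14;82;58;64;75;44;56;0;20;52;21;53;10;83;77;60;47;31;61;17];
   [:: 59;43;7;25;83;38;1;72;35;41;30;10;42;65;79;78;76;14;9;0];
   [:: 6;69;47;61;35;65;80;26;56;43;84;16;81;62;25;79;75;48;40;5];
   [:: 11;45;50;33;73;57;71;61;10;55;32;21;22;24;40;47;20;84;18;48];
   [:: 32;69;15;8;40;68;17;14;2;64;10;4;59;62;51;30;73;31;53;74];
   [:: 0;29;77;34;61;15;42;5;1;44;38;22;21;65;60;31;26;11;40;64];
   [:: 84;7;80;36;38;82;26;68;55;42;74;67;64;37;13;31;32;27;34;2]]
  [:: [:: 0;21;103;56;111;96;50;110;15;27;51;82;115;98;87;86;4;52;19;88];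
   [:: 24;108;15;71;27;91;102;120;101;40;20;68;32;2;57;119;19;11;54;25]]
  [:: [:: 4;38;59;43;67;63;75;28;18;80;21;46;56;87;62;14;79;33;19;60];
   [:: 40;45;21;65;87;74;90;94;3;48;80;31;23;91;98;1;83;43;30;58];
   [:: 35;38;17;20;94;90;11;93;61;74;30;69;67;86;42;13;34;18;0;58];
   [:: 99;3;50;55;78;21;29;12;95;67;49;6;65;32;17;28;98;11;68;76];
   [:: 60;97;16;99;48;30;63;93;64;17;56;49;4;3;87;66;62;42;40;83]]
  [:: [:: 35;18;110;62;11;56;98;58;22;32;27;43;46;151;15;113;40;74;57;91];
   [:: 9;145;59;193;80;155;1;6;58;33;51;56;43;28;18;103;147;62;72;3];
   [:: 61;68;98;109;83;13;99;65;28;19;110;35;32;155;90;106;55;33;17;24];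
   [:: 0;55;113;72;14;91;106;70;69;75;66;95;115;56;54;107;15;50;61;41];
   [:: 81;11;119;42;73;145;46;32;101;154;9;147;58;0;88;43;76;95;96;192]]
  [:: [:: 128;133;70;101;86;64;9;116;7;29;132;97;121;20;129;95;30;82;115;111];
   [:: 109;11;3;34;1;27;18;126;33;114;139;58;122;56;7;132;13;96;129;53]]
  [:: [:: 31;105;128;16;87;96;102;115;129;157;42;19;108;112;159;101;124;5;133;154];
   [:: 25;6;116;124;1;56;137;83;105;35;149;20;48;135;146;71;47;134;145;96]].

Definition kit_snark4 : kit := Kit
  [:: [:: 22;26;54;74;48;32;87;5;51;50;49;83;39;59;6;13;30;25;46;84]]
  [:: [:: 93;39;70;75;76;27;96;45;34;41;192;24;108;80;5;183;191;83;67;73];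
   [:: 26;63;108;69;195;55;29;57;73;84;188;52;79;209;36;205;111;81;4;89];
   [:: 95;40;21;39;200;79;90;7;77;72;107;20;110;190;53;114;192;18;13;35]]
  [:: [:: 58;51;98;59;54;19;16;53;88;7;48;89;10;4;17;22;56;5;95;90];
   [:: 63;29;50;14;78;9;77;5;68;26;86;40;92;24;54;90;59;46;81;39];
   [:: 75;41;50;2;66;21;65;17;80;38;92;28;86;36;54;84;59;34;69;27];
   [:: 29;69;28;71;57;76;38;47;12;20;7;27;82;98;89;24;60;26;46;17];
   [:: 41;81;40;83;57;64;26;35;0;8;19;39;70;98;95;36;72;38;34;5];
   [:: 0;28;97;71;3;88;57;29;52;61;43;73;56;70;83;32;8;65;9;19];
   [:: 12;40;97;83;15;94;57;41;52;73;31;61;56;82;71;44;20;77;21;7];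
   [:: 93;46;19;37;86;59;82;91;16;3;79;43;32;9;14;74;2;17;81;28];
   [:: 87;34;7;25;92;59;70;85;4;15;67;31;44;21;2;62;14;5;69;40]]
  [:: [:: 10;16;126;1;79;27;67;4;124;50;61;32;62;30;18;68;37;2;121;51];
   [:: 75;47;48;23;79;51;18;131;42;5;74;41;50;45;36;123;54;69;61;38]]
  [:: [:: 0;61;35;64;33;62;32;91;3;93;2;95;38;60;94;5;31;6;1;39];
   [:: 0;79;41;82;39;80;38;109;3;111;2;113;44;78;112;5;37;6;1;45];
   [:: 0;67;47;70;45;68;44;97;3;99;2;101;50;66;100;5;43;6;1;51];
   [:: 0;85;53;88;51;86;50;115;3;117;2;119;56;84;118;5;49;6;1;57];
   [:: 0;73;59;76;57;74;56;103;3;105;2;107;32;72;106;5;55;6;1;33]]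
  [:: [:: 16;6;10;19;5;3;9;17;7;0;11;1;23;13;14;4;2;21;24;8];
   [:: 19;12;15;2;16;21;17;7;18;1;13;20;22;23;4;6;8;10;24;14]]
  [:: [:: 39;10;9;34;2;19;22;13;11;4;17;23;38;7;36;16;26;15;32;29];
   [:: 2;29;32;23;0;26;37;5;19;7;27;6;14;1;25;34;9;35;20;17]]
  [:: [:: 3;49;27;43;31;16;35;26;52;28;32;33;51;37;4;38;41;0;48;6]]
  [:: [:: 35;53;38;51;71;17;21;47;1;69;68;42;13;46;34;32;59;26;45;57];
   [:: 44;53;66;4;55;50;19;16;46;39;17;43;1;37;57;0;69;3;38;13];
   [:: 65;34;19;3;22;12;48;35;6;73;33;43;36;67;25;51;8;16;52;44];
   [:: 13;19;57;22;32;6;61;35;70;2;37;72;41;67;56;62;59;23;20;46];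
   [:: 10;67;37;5;22;68;63;15;30;65;1;75;16;25;72;48;47;57;18;11]]
  [:: [:: 0;21;74;33;82;44;55;3;58;49;35;40;28;46;23;47;72;30;20;9];
   [:: 46;60;55;83;40;52;70;80;13;25;19;74;7;78;39;5;50;15;77;2];
   [:: 77;75;9;26;45;83;62;61;42;2;59;68;22;14;35;50;28;54;56;23];
   [:: 58;67;4;22;7;9;49;35;27;2;60;80;66;28;51;61;40;44;34;5];
   [:: 74;4;65;60;23;20;68;70;12;9;42;27;7;41;1;31;18;13;80;66];
   [:: 57;53;54;7;37;72;43;60;31;73;17;11;62;42;0;1;22;66;29;28];
   [:: 20;51;38;37;71;67;84;43;1;69;79;17;44;73;33;57;81;72;76;12]]
  [:: [:: 77;74;58;107;62;68;78;19;67;114;57;72;94;102;39;93;12;108;34;46];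
   [:: 14;106;93;51;114;91;21;78;101;20;3;116;23;11;86;118;44;16;45;40]]
  [:: [:: 55;2;26;99;36;93;49;59;16;51;4;86;34;31;54;1;10;75;78;67];
   [:: 91;9;66;56;38;71;47;83;2;97;1;16;69;28;60;33;39;87;21;0];
   [:: 43;38;92;71;80;4;69;63;11;54;40;14;42;55;24;83;51;97;87;6];
   [:: 0;82;37;51;9;75;60;72;88;95;39;22;49;45;18;92;77;5;54;61];
   [:: 94;91;41;67;9;64;34;99;35;55;42;4;7;75;68;49;83;32;48;22]]
  [:: [:: 86;56;97;148;31;8;73;94;9;114;62;194;37;85;17;48;0;84;116;2];
   [:: 26;109;53;9;16;1;62;103;42;118;70;46;31;75;89;144;193;36;52;68];
   [:: 150;32;51;57;103;54;146;1;46;59;10;61;113;11;154;38;74;22;71;111];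
   [:: 81;119;15;40;11;117;77;145;80;154;64;116;21;89;101;67;30;111;19;41];
   [:: 0;10;63;51;31;39;113;8;50;93;78;70;7;77;22;65;12;84;147;98]]
  [:: [:: 88;96;11;75;110;121;98;15;31;42;52;69;73;74;63;12;133;26;136;82];
   [:: 33;27;8;38;72;88;66;40;23;92;42;104;93;63;35;76;41;102;14;128]]
  [:: [:: 7;50;104;36;61;98;121;137;58;23;113;116;146;16;4;31;110;80;69;62];
   [:: 121;154;4;66;133;48;51;150;92;20;130;125;39;105;131;86;63;122;70;88]].

Definition kit_snark5 : kit := Kit
  [:: [:: 9;11;64;32;33;35;24;71;37;79;31;82;17;50;69;15;41;36;58;67]]
  [:: [:: 73;87;111;66;105;14;180;77;209;61;67;53;42;93;39;84;112;2;76;193];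
   [:: 27;36;94;32;207;26;182;53;19;88;113;61;201;107;59;57;203;24;25;187];
   [:: 194;109;39;59;33;56;54;86;45;88;40;31;96;91;63;199;83;16;79;35]]
  [:: [:: 42;59;69;57;96;63;56;39;89;49;50;78;33;87;54;81;53;36;30;27];
   [:: 35;61;18;69;25;66;26;83;28;50;21;73;59;15;1;2;32;30;90;79];
   [:: 47;73;6;81;37;78;38;71;40;50;9;61;59;3;13;14;44;42;84;67];
   [:: 25;1;58;8;69;98;26;94;11;17;21;43;42;38;75;95;20;66;47;55];
   [:: 37;13;58;20;81;98;38;88;23;5;9;31;30;26;63;89;8;78;35;55];
   [:: 93;44;37;48;89;4;64;74;17;23;3;34;86;82;18;16;72;49;55;67];
   [:: 87;32;25;48;95;16;76;62;5;11;15;46;92;70;6;4;60;49;55;79];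
   [:: 0;54;82;97;13;15;78;37;26;34;91;4;72;95;21;1;89;46;36;73];
   [:: 12;54;70;97;1;3;66;25;38;46;85;16;60;89;9;13;95;34;24;61]]
  [:: [:: 14;55;132;47;86;59;46;49;79;5;52;121;9;16;131;51;32;124;65;30];
   [:: 39;64;10;130;5;84;17;66;58;71;1;63;41;59;43;36;38;22;79;70]]
  [:: [:: 46;36;114;28;80;111;4;21;107;7;54;64;23;50;119;65;43;74;9;52];
   [:: 52;42;108;28;68;105;4;21;101;7;30;82;23;56;113;83;49;62;9;58];
   [:: 58;48;102;28;86;99;4;21;95;7;36;70;23;32;107;71;55;80;9;34];
   [:: 34;54;96;28;74;93;4;21;119;7;42;88;23;38;101;89;31;68;9;40];
   [:: 40;30;90;28;62;117;4;21;113;7;48;76;23;44;95;77;37;86;9;46]]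
  [:: [:: 23;24;10;21;9;11;8;14;19;6;7;22;18;15;1;12;17;0;3;4];
   [:: 18;2;14;12;23;15;21;17;10;24;7;11;0;4;16;3;5;22;6;9]]
  [:: [:: 13;16;26;24;6;21;20;33;10;35;30;31;23;3;2;9;19;28;12;4];
   [:: 19;38;8;22;29;4;30;36;37;31;5;16;10;15;25;12;0;32;21;39]]
  [:: [:: 41;10;45;8;13;48;27;25;19;51;35;29;11;2;42;20;58;33;21;6]]
  [:: [:: 70;46;26;36;18;2;74;27;62;1;8;49;57;63;38;64;6;20;41;16];
   [:: 30;28;38;26;6;52;16;33;54;15;18;1;51;75;70;7;64;49;45;56];
   [:: 69;21;57;56;14;65;47;67;46;75;26;36;54;41;17;15;22;29;28;62];
   [:: 19;54;2;10;20;67;64;9;49;66;25;62;30;14;58;75;12;68;39;28];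
   [:: 36;35;25;20;14;19;52;32;55;9;5;57;41;66;38;8;58;54;7;53]]
  [:: [:: 51;17;6;73;70;38;48;20;79;59;42;15;74;23;76;21;50;19;81;31];
   [:: 82;71;73;83;51;25;59;4;27;66;8;32;38;45;52;13;76;28;2;37];
   [:: 66;63;21;40;25;11;20;3;82;43;30;71;38;34;31;8;22;49;72;29];
   [:: 0;57;34;14;61;36;41;54;44;20;72;66;31;84;4;16;35;30;59;52];
   [:: 73;52;41;45;6;77;2;13;3;83;36;84;12;31;67;65;57;50;25;17];
   [:: 45;76;46;68;39;20;8;80;59;36;67;79;1;71;29;48;16;57;65;66];
   [:: 56;46;51;75;9;16;0;57;5;11;58;20;66;19;78;7;68;12;22;39]]
  [:: [:: 77;15;60;23;34;22;59;69;21;6;10;120;25;16;28;89;96;107;31;57];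
   [:: 120;83;86;46;60;85;91;104;53;29;21;78;58;50;81;101;6;25;7;65]]
  [:: [:: 12;35;91;90;8;77;70;47;15;82;10;25;53;11;54;71;19;49;44;2];
   [:: 48;36;94;65;98;6;99;44;16;30;51;72;78;10;19;32;38;25;68;89];
   [:: 45;13;63;94;56;81;27;98;21;32;62;4;60;55;80;77;57;97;43;25];
   [:: 69;34;10;78;56;7;72;67;27;40;42;6;87;11;24;12;54;57;95;75];
   [:: 0;52;97;34;76;67;81;8;99;15;88;56;5;69;41;43;82;48;22;74]]
  [:: [:: 30;81;1;153;70;76;103;99;90;67;6;77;115;50;194;102;43;59;49;15];
   [:: 149;95;11;60;7;17;32;12;53;75;68;100;27;54;3;47;65;87;194;106];
   [:: 52;119;14;2;29;77;19;73;114;64;28;22;39;0;112;75;11;149;153;94];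
   [:: 0;59;106;102;32;65;153;66;37;75;146;29;144;9;148;6;52;82;87;15];
   [:: 113;28;3;69;99;85;119;55;27;84;0;35;40;36;105;104;74;49;43;92]]
  [:: [:: 140;101;34;33;108;18;15;36;67;25;129;97;8;78;11;113;84;57;130;37];
   [:: 101;48;58;72;87;78;73;102;142;60;22;105;6;19;117;3;116;10;66;38]]
  [:: [:: 135;147;82;114;148;74;157;53;27;47;156;76;5;89;34;3;29;22;48;136];
   [:: 133;151;136;144;126;102;28;61;111;77;104;79;88;107;83;90;149;142;52;21]].

Definition kit_snark6 : kit := Kit
  [:: [:: 85;28;42;75;47;44;60;82;62;21;61;26;23;63;46;14;65;43;19;57]]
  [:: [:: 79;95;59;204;67;112;53;110;22;3;65;27;15;102;38;19;203;29;77;84];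
   [:: 60;75;199;101;2;79;93;87;17;111;205;40;109;183;41;49;45;53;36;70];
   [:: 38;59;191;99;9;36;207;62;26;37;41;202;84;75;200;48;205;47;112;85]]
  [:: [:: 58;70;53;64;3;59;50;82;23;54;97;52;5;72;78;66;57;14;17;2];
   [:: 77;26;33;40;88;36;97;80;11;29;61;18;55;90;42;92;43;24;54;89];
   [:: 65;38;45;28;94;24;97;68;23;41;73;6;55;84;30;86;31;36;54;95];
   [:: 0;37;63;57;91;47;18;10;88;42;66;51;5;30;96;33;56;65;78;21];
   [:: 12;25;75;57;85;35;6;22;94;30;78;51;17;42;96;45;56;77;66;9];
   [:: 51;48;74;14;93;24;25;11;71;9;17;65;2;26;80;22;85;3;87;16];
   [:: 51;48;62;2;87;36;37;23;83;21;5;77;14;38;68;10;91;15;93;4];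
   [:: 40;10;91;19;78;62;47;11;77;59;27;24;44;21;75;42;0;82;71;35];
   [:: 28;22;85;7;66;74;35;23;65;59;39;36;32;9;63;30;12;70;83;47]]
  [:: [:: 55;44;88;4;7;68;1;19;134;85;40;74;126;3;50;59;41;14;52;124];
   [:: 75;68;58;52;17;39;18;127;23;62;71;22;16;132;3;50;55;77;9;63]]
  [:: [:: 0;3;62;61;35;91;34;5;1;95;33;92;97;30;7;6;60;36;64;41];
   [:: 0;3;80;79;41;109;40;5;1;113;39;110;115;36;7;6;78;42;82;47];
   [:: 0;3;68;67;47;97;46;5;1;101;45;98;103;42;7;6;66;48;70;53];
   [:: 0;3;86;85;53;115;52;5;1;119;51;116;91;48;7;6;84;54;88;59];
   [:: 0;3;74;73;59;103;58;5;1;107;57;104;109;54;7;6;72;30;76;35]]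
  [:: [:: 24;19;21;16;18;9;10;20;3;1;11;13;15;22;5;2;6;7;4;14];
   [:: 6;3;9;17;14;22;5;16;23;1;12;11;7;2;21;15;19;4;24;13]]
  [:: [:: 25;27;9;14;20;30;18;28;29;0;17;6;39;36;23;34;8;1;31;4];
   [:: 23;20;6;24;15;26;2;7;14;36;27;4;5;12;13;19;29;33;38;0]]
  [:: [:: 2;32;16;21;60;52;59;40;42;25;48;10;31;13;23;0;5;51;12;18]]
  [:: [:: 67;1;35;33;14;17;16;41;11;69;0;66;12;52;54;60;55;32;47;37];
   [:: 34;63;6;48;59;9;44;50;10;26;46;37;40;75;14;8;49;25;70;42];
   [:: 6;22;35;14;53;15;8;42;66;32;45;23;68;50;24;75;65;19;74;34];
   [:: 50;16;60;58;65;42;43;37;61;14;55;53;21;1;62;17;4;25;57;68];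
   [:: 57;33;31;40;62;21;26;42;61;39;14;38;22;7;18;70;30;17;68;29]]
  [:: [:: 0;47;81;50;58;33;51;73;16;69;77;21;75;15;7;27;63;57;5;2];
   [:: 55;32;70;35;18;5;46;69;28;1;19;56;23;9;22;38;27;16;62;47];
   [:: 48;55;46;3;51;66;63;16;69;17;6;81;10;36;77;45;41;83;9;72];
   [:: 79;30;75;5;51;44;80;53;56;38;47;15;69;76;43;46;71;0;73;24];
   [:: 40;51;80;15;68;50;29;22;57;78;44;4;32;30;2;24;17;47;46;60];
   [:: 62;34;35;46;63;55;80;84;50;61;36;27;73;2;25;29;59;54;17;19];
   [:: 64;31;18;33;84;42;4;15;66;7;81;54;55;75;56;16;44;1;3;32]]
  [:: [:: 106;118;44;18;22;83;8;76;20;39;40;90;31;33;59;13;49;97;71;100];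
   [:: 33;3;34;36;42;75;97;106;28;6;105;0;85;35;25;117;38;20;1;78]]
  [:: [:: 84;55;35;10;89;53;43;59;64;21;42;20;0;93;29;70;69;82;47;1];
   [:: 74;69;84;97;25;8;86;34;21;59;70;78;94;40;27;13;1;49;58;85];
   [:: 0;50;94;31;18;75;12;64;93;60;17;84;48;22;5;86;78;14;58;44];
   [:: 10;64;34;68;42;63;13;72;40;16;11;41;88;80;56;76;91;35;28;21];
   [:: 23;8;33;40;55;75;45;66;0;98;51;87;88;73;37;7;34;63;48;91]]
  [:: [:: 0;149;84;64;55;94;22;79;193;194;33;104;19;50;12;40;147;62;105;66];
   [:: 97;0;55;81;74;42;39;108;103;109;147;88;36;25;76;19;40;116;54;7];
   [:: 38;112;7;70;5;144;80;117;69;113;60;2;23;25;94;45;83;146;75;42];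
   [:: 21;56;154;60;118;145;53;87;22;20;5;54;114;75;93;152;42;62;30;117];
   [:: 72;43;85;55;96;13;61;66;27;84;34;15;113;14;28;9;39;76;71;97]]
  [:: [:: 116;67;107;94;131;84;32;31;111;135;104;105;117;82;19;4;70;11;66;21];
   [:: 56;53;103;112;45;1;42;64;133;30;44;127;90;108;33;35;11;21;135;104]]
  [:: [:: 124;11;1;35;20;123;144;74;97;145;110;77;4;95;38;100;136;69;45;119];
   [:: 141;83;90;102;17;42;0;41;11;40;36;79;87;157;146;59;58;29;2;121]].
Close Scope N_scope.

Lemma kit_snark1_ok : kit_ok (table_edges snark1) kit_snark1.
Proof. by vm_compute. Qed.

Lemma kit_snark2_ok : kit_ok (table_edges snark2) kit_snark2.
Proof. by vm_compute. Qed.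

Lemma kit_snark3_ok : kit_ok (table_edges snark3) kit_snark3.
Proof. by vm_compute. Qed.

Lemma kit_snark4_ok : kit_ok (table_edges snark4) kit_snark4.
Proof. by vm_compute. Qed.

Lemma kit_snark5_ok : kit_ok (table_edges snark5) kit_snark5.
Proof. by vm_compute. Qed.

Lemma kit_snark6_ok : kit_ok (table_edges snark6) kit_snark6.
Proof. by vm_compute. Qed.

(** * Designs from covers, and necessity *)

Lemma edge_pairP n (e : {set complete_graph n}) :
  reflect (exists u v : 'I_n, u != v /\ e = [set u; v]) (e \in edges (complete_graph n)).
Proof.
apply: (iffP imsetP) => [[[u v] + ->]|[u [v [uv ->]]]].
  by rewrite inE => uv; exists u, v.
by exists (u, v); rewrite ?inE.
Qed.

Lemma card_complete_edges n : #|edges (complete_graph n)| = 'C(n, 2).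
Proof.
rewrite -[X in 'C(X, 2)]card_ord -card_draws; apply: eq_card => e; rewrite inE.
by apply/edge_pairP/cards2P.
Qed.

Lemma sum_incidences (T : finType) (F : {set {set T}}) (u : T) :
  \sum_(e in F) (u \in e) = #|[set e in F | u \in e]|.
Proof.
rewrite -sum1dep_card big_mkcondr /=.
by apply: eq_bigr => e _; case: (u \in e).
Qed.

(** * An exact cover yields a design *)

Section FromCover.
Variables (G : sgraph) (es : seq (nat * nat)) (psi : nat -> G) (n : nat).
Hypothesis card20 : #|G| = 20.
Hypothesis psi_inj : forall i j, i < 20 -> j < 20 -> psi i = psi j -> i = j.
Hypothesis es_size : size es = 30.
Hypothesis es20 : all (fun e => (e.1 < 20) && (e.2 < 20)) es.
Hypothesis psi_adj : forall i j, i < 20 -> j < 20 ->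
  adj (psi i) (psi j) = ((i, j) \in es) || ((j, i) \in es).
Hypothesis n0 : 0 < n.

Let x0 : 'I_n := Ordinal n0.
Let rank (x : G) : nat := find (fun i => psi i == x) (iota 0 20).

Let psi_surj x : exists2 i, i < 20 & psi i = x.
Proof.
have u : uniq [seq psi i | i <- iota 0 20].
  rewrite map_inj_in_uniq ?iota_uniq // => i j; rewrite !mem_iota => i20 j20; exact: psi_inj.
have sub : {subset [seq psi i | i <- iota 0 20] <= enum G} by move=> y _; rewrite mem_enum.
have [] := uniq_min_size u sub _; first by rewrite -cardE card20 size_map size_iota.
move=> _ /(_ x); rewrite mem_enum => /mapP[i]; rewrite mem_iota => /= i20 ->.
by exists i.
Qed.

Let rankK i : i < 20 -> rank (psi i) = i.
Proof.
move=> i20; have h : has (fun k => psi k == psi i) (iota 0 20).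
  by apply/hasP; exists i; rewrite ?mem_iota.
have lt : rank (psi i) < 20 by move: h; rewrite has_find size_iota.
have := nth_find 0 h; rewrite nth_iota ?add0n // => /eqP; exact: psi_inj.
Qed.

(** The default [x0] does not matter when [b] is [good], since then all entries are below [n]. *)
Let place (b : seq nat) (x : G) : complete_graph n := insubd x0 (nth 0 b (rank x)).

Let image (b : seq nat) : {set {set complete_graph n}} :=
  [set [set place b p.1; place b p.2] | p : G * G & adj p.1 p.2].

Let good b := [/\ size b = 20, uniq b & all (fun x => x < n) b].

Let place_psi b i : good b -> i < 20 -> place b (psi i) = nth 0 b i :> nat.
Proof.
move=> [sb _ /allP bn] i20; rewrite /place rankK // val_insubd.
by rewrite (bn (nth 0 b i)) ?mem_nth ?sb.
Qed.

Let place_inj b : good b -> injective (place b).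
Proof.
move=> gb x y; have [i i20 <-] := psi_surj x; have [j j20 <-] := psi_surj y.
move/(congr1 val); rewrite /= !place_psi //; case: gb => sb ub _ /eqP.
by rewrite nth_uniq ?sb // => /eqP->.
Qed.

Let image_edges b : good b -> image b \subset edges (complete_graph n).
Proof.
move=> gb; apply/subsetP => _ /imsetP[[x y] + ->]; rewrite inE /= => xy.
apply/edge_pairP; exists (place b x), (place b y); split=> //.
by apply: contraTneq xy => /(place_inj gb)->; rewrite adj_irrefl.
Qed.

Let card_image b : good b -> #|image b| <= 30.
Proof.
move=> gb; rewrite -es_size -(size_map (fun e => [set place b (psi e.1); place b (psi e.2)])).
apply: leq_trans (card_size _); apply: subset_leq_card; apply/subsetP => _ /imsetP[[x y] + ->].
rewrite inE /=; have [i i20 <-] := psi_surj x; have [j j20 <-] := psi_surj y.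
rewrite psi_adj // => /orP[h|h]; apply/mapP.
  by exists (i, j).
by exists (j, i); [exact: h | exact: setUC].
Qed.

Lemma design_of_cover : exact_cover es n ->
  exists D : {set {set {set complete_graph n}}}, is_design G D.
Proof.
move=> [m mE [B [sB gB cB]]].
pose D := [set F | F \in [seq image b | b <- B]].
have claw_open F : F \in D -> exists2 b, good b & F = image b.
  by rewrite inE => /mapP[b /gB gb ->]; exists b.
have cov : cover D = edges (complete_graph n).
  apply/eqP; rewrite eqEsubset; apply/andP; split.
    by apply/bigcupsP => F /claw_open[b gb ->]; apply: image_edges.
  apply/subsetP => e /edge_pairP[u [v [uv ->]]].
  have [b bB /hasP[[i j] ein he]] : exists2 b, b \in B & joined es b (val u) (val v).
    apply: cB; split; [exact: ltn_ord | exact: ltn_ord |].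
    by apply: contraNneq uv => /val_inj->.
  have gb := gB b bB; have /andP[/= i20 j20] := allP es20 _ ein.
  apply/bigcupP; exists (image b); first by rewrite inE map_f.
  have pl k x : k < 20 -> onth b k = Some (val x) -> place b (psi k) = x.
    move=> k20 /(onth_nth 0) E; apply: val_inj => /=.
    by rewrite place_psi.
  have aij : adj (psi i) (psi j) by rewrite psi_adj // ein.
  case/orP: he => /andP[/eqP h1 /eqP h2]; apply/imsetP.
    by exists (psi i, psi j); rewrite ?inE //= (pl i u) // (pl j v).
  by exists (psi j, psi i); rewrite ?inE 1?adj_sym //= (pl i v) // (pl j u).
have ne : set0 \notin D.
  apply/negP => /claw_open[b _ /esym/eqP]; apply/negP/set0Pn.
  have /= : 0 < size es by rewrite es_size.
  case: es es20 psi_adj => [//|[i j] s] /= /andP[/andP[i20 j20] _] pa _.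
  exists [set place b (psi i); place b (psi j)]; apply/imsetP; exists (psi i, psi j) => //.
  by rewrite inE /= pa // mem_head.
(* Repeated images merge in the set [D], so it has at most [m] members, each of at most 30 edges;
   their total cannot exceed the number of edges they cover. *)
have cD : #|cover D| = \sum_(F in D) #|F|.
  apply/eqP; rewrite eqn_leq leq_card_cover cov card_complete_edges /=.
  have le1 : \sum_(F in D) #|F| <= \sum_(F in D) 30.
    by apply: leq_sum => F /claw_open[b gb ->]; apply: card_image.
  apply: leq_trans le1 _; rewrite sum_nat_const.
  have le2 : #|D| <= m.
    by rewrite -sB -(size_map image); apply: leq_trans (card_size _); rewrite cardsE.
  have : #|D| * 30 <= m * 30 by rewrite leq_mul2r le2 orbT.
  move=> /leq_trans; apply; rewrite bin2 -subn1 -mE.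
  by rewrite (_ : 60 * m = (m * 30).*2) ?doubleK //; lia.
exists D; split.
  apply/and3P; split=> //; first by rewrite cov.
  (* Equality in the union bound characterises pairwise disjoint families. *)
  by rewrite -leq_card_cover cD.
move=> F /claw_open[b gb ->]; exists (place b @: [set: G]); split.
  split; first exact: image_edges.
  by move=> _ /imsetP[[x y] _ ->]; apply/subsetP => z /set2P[]->; apply: imset_f; apply: in_setT.
exists (place b); split; [exact: place_inj | reflexivity |].
move=> x y; apply/idP/imsetP => [xy|[[x' y'] xy' /set2_inj]]; first by exists (x, y); [rewrite inE; exact: xy | reflexivity].
have {}xy' : adj x' y' by move: xy'; rewrite inE.
case=> -[/(place_inj gb)-> /(place_inj gb)->]; first exact: xy'.
rewrite adj_sym; exact: xy'.
Qed.

End FromCover.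

(** * Necessary conditions on the order *)

Section Necessary.
Variables (G : sgraph) (n : nat) (D : {set {set {set complete_graph n}}}).
Hypothesis cubic : regular 3 G.
Hypothesis card20 : #|G| = 20.
Hypothesis n0 : 0 < n.
Hypothesis designD : is_design G D.

Let degree (F : {set {set complete_graph n}}) (u : 'I_n) := \sum_(e in F) (u \in e).

Let block_degree F : F \in D -> exists2 f : G -> 'I_n, injective f &
  forall u, degree F u = (u \in f @: [set: G]) * 3.
Proof.
move=> FD; have [_ /(_ F FD)[W [[Fe FW] [f [inj fW fadj]]]]] := designD.
exists f => // u; rewrite /degree sum_incidences.
have [/imsetP[x _ ->]|uW] := boolP (u \in f @: [set: G]); last first.
  apply: eq_card0 => e; rewrite inE; apply/negP => /andP[eF ue]; case/negP: uW; rewrite fW.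
  exact: (subsetP (FW e eF)).
rewrite mul1n -(cubic x) -(card_in_imset (f := fun y => [set f x; f y])); last first.
  move=> y y'; rewrite !inE => xy xy' /setP/(_ (f y)); rewrite !inE eqxx orbT !(inj_eq inj).
  case: eqVneq => [E|_ /esym/eqP//]; by rewrite E adj_irrefl in xy.
apply: eq_card => e; rewrite inE; apply/andP/imsetP => [[eF xe]|[y + ->]].
  have /edge_pairP[u' [v' [_ eE]]] := subsetP Fe e eF.
  have inW z : z \in e -> exists y, z = f y.
    by move=> ze; have := subsetP (FW e eF) z ze; rewrite -fW => /imsetP[y _ ->]; exists y.
  have [a aE] : exists y, u' = f y by apply: inW; rewrite eE set21.
  have [b bE] : exists y, v' = f y by apply: inW; rewrite eE set22.
  have ab : adj a b by rewrite fadj -aE -bE -eE.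
  move: xe; rewrite eE aE bE !inE !(inj_eq inj) => /orP[]/eqP->.
    by exists b; rewrite ?inE.
  by exists a; rewrite ?inE 1?adj_sym // setUC.
rewrite inE => xy; split; last by rewrite !inE eqxx.
by rewrite -fadj.
Qed.

Let vertex_degree u : \sum_(F in D) degree F u = n - 1.
Proof.
have [/and3P[/eqP cov triv _] _] := designD.
rewrite /degree -(big_trivIset _ triv) cov sum_incidences.
have -> : n - 1 = #|[set~ u]| by rewrite cardsC1 card_ord subn1.
rewrite -(card_in_imset (f := fun v : 'I_n => [set u; v])); last first.
  move=> v v'; rewrite !inE => vu vu' /setP/(_ v); rewrite !inE eqxx orbT (negPf vu) /=.
  by move/esym/eqP.
apply: eq_card => e; rewrite inE; apply/andP/imsetP => [[/edge_pairP[a [b [ab ->]]]]|[v + ->]].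
  rewrite !inE => /orP[]/eqP->; first by exists b; rewrite ?inE // eq_sym.
  by exists a; rewrite ?inE // setUC.
rewrite in_setC1 => vu; split; last exact: set21.
by apply/edge_pairP; exists u, v; rewrite eq_sym.
Qed.

Lemma design_order : n %% 60 \in [:: 1; 16; 25; 40] /\ n <> 16.
Proof.
have three : 3 %| n - 1.
  rewrite -(vertex_degree (Ordinal n0)); apply: dvdn_sum => F FD.
  by have [f _ ->] := block_degree FD; apply: dvdn_mull.
have total : n * (n - 1) = #|D| * 60.
  have -> : n * (n - 1) = \sum_(u : 'I_n) \sum_(F in D) degree F u.
    by rewrite (eq_bigr _ (fun u _ => vertex_degree u)) sum_nat_const card_ord.
  rewrite exchange_big -sum_nat_const; apply: eq_bigr => F FD.
  have [f inj fE] := block_degree FD.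
  rewrite (eq_bigr _ (fun u _ => fE u)) -big_distrl /=.
  have -> : \sum_(u : 'I_n) (u \in f @: [set: G]) = #|f @: [set: G]|.
    by rewrite -sum1_card [RHS]big_mkcond; apply: eq_bigr => u _; case: (u \in _).
  by rewrite card_imset // cardsT card20.
split; last first.
  move=> n16; have /card_gt0P[F FD] : 0 < #|D|.
    rewrite lt0n; apply/eqP => D0; move: total; rewrite D0 mul0n => /eqP.
    by rewrite muln_eq0; lia.
  have [f inj _] := block_degree FD.
  by have := leq_card f inj; rewrite card20 card_ord; lia.
(* [r + 59] stands for [r - 1] modulo 60, which is also right at [r = 0]. *)
have h : all (fun r => (r %% 3 == 1) && (r * (r + 59) %% 60 == 0) ==> (r \in [:: 1; 16; 25; 40]))
  (iota 0 60) by vm_compute.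
have := allP h (n %% 60); rewrite mem_iota ltn_mod => /(_ isT)/implyP; apply.
apply/andP; split; first by lia.
rewrite modnMml -modnMmr modnDml modnMmr.
have -> : n * (n + 59) = n * (n - 1) + n * 60 by nia.
by rewrite addnC modnMDl total modnMl.
Qed.

End Necessary.

Lemma snark_exact_covers t n : t \in snarks -> n %% 60 \in [:: 1; 16; 25; 40] -> n <> 16 ->
  exact_cover (table_edges t) n.
Proof.
move=> ts nr n16; move: ts; rewrite !inE => /or4P[/eqP->|/eqP->|/eqP->|/or3P[]/eqP->].
- exact (kit_orders kit_snark1_ok nr n16).
- exact (kit_orders kit_snark2_ok nr n16).
- exact (kit_orders kit_snark3_ok nr n16).
- exact (kit_orders kit_snark4_ok nr n16).
- exact (kit_orders kit_snark5_ok nr n16).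
- exact (kit_orders kit_snark6_ok nr n16).
Qed.

Lemma snarks_table_ok t : t \in snarks ->
  [/\ size (table_edges t) = 30, all (fun e => (e.1 < 20) && (e.2 < 20)) (table_edges t) &
    all (fun i => all (fun j => tadj t (nth L0 labels i) (nth L0 labels j) ==
      ((i, j) \in table_edges t) || ((j, i) \in table_edges t)) (iota 0 20)) (iota 0 20)].
Proof.
have h : all (fun t => [&& size (table_edges t) == 30,
    all (fun e => (e.1 < 20) && (e.2 < 20)) (table_edges t) &
    all (fun i => all (fun j => tadj t (nth L0 labels i) (nth L0 labels j) ==
      ((i, j) \in table_edges t) || ((j, i) \in table_edges t)) (iota 0 20)) (iota 0 20)]) snarks.
  by vm_compute.
by move=> /(allP h)/and3P[/eqP].
Qed.

Theorem theorem3 (G : sgraph) (hG : nontrivial_snark G) (hV : #|G| = 20)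
    (n : nat) (hn : 0 < n) :
  (exists D : {set {set {set complete_graph n}}}, is_design G D) <->
  (n %% 60 \in [:: 1; 16; 25; 40]) /\ n <> 16.
Proof.
have cubic : regular 3 G by case: hG => -[].
split=> [[D dD]|[nr n16]]; first exact: (design_order cubic hV hn dD).
have [t ts [phi inj padj]] := nontrivial_snark20 hG hV.
have [s30 e20 /allP tab] := snarks_table_ok ts.
have sz : size labels = 20 by [].
apply: (design_of_cover (psi := fun i => phi (nth L0 labels i)) hV _ s30 e20 _ hn).
- move=> i j i20 j20 /inj/eqP; rewrite nth_uniq ?sz // => /eqP; exact.
- move=> i j i20 j20; rewrite padj; apply/eqP.
  by have := tab i; rewrite mem_iota => /(_ i20)/allP/(_ j); rewrite mem_iota; apply.
exact: snark_exact_covers.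
Qed.
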